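(* Let $k\geq 1$ be an integer and let $E\subset\mathbb{R}^2$ be a compact set with Hausdorff dimension $\dim E>2-\frac{1}{2k}$. Then $\mathcal{L}_{2k-1}(\mathcal{A}_k(E))>0$, where $\mathcal{A}_k(E)$ is the set of area types of $(k+1)$-point configurations in $E$, viewed as a subset of a $(2k-1)$-dimensional flat.
   Context: Throughout, for $v=(v_1,v_2)\in\mathbb{R}^2$ write $v^\perp=(v_2,-v_1)$, so that $u\cdot v^\perp=u_1v_2-u_2v_1$ is the determinant of the matrix with columns $u,v$ (the signed area of the parallelogram spanned by $u,v$). $\dim$ denotes Hausdorff dimension. A $(k+1)$-point configuration is $x=(x^1,\dots,x^{k+1})\in(\mathbb{R}^2)^{k+1}$. Its area type is the vector $(x^i\cdot x^{j\perp})_{1\leq i<j\leq k+1}\in\mathbb{R}^{\binom{k+1}{2}}$. The configuration $x$ is called non-degenerate if $\{x^1,x^2\}$ is linearly independent. For non-degenerate $x$ there is a unique $g\in \mathrm{SL}_2(\mathbb{R})$ with $gx^1=(1,0)$ and $gx^2=(0,x^1\cdot x^{2\perp})$; set $$A(x)=(gx^1,\dots,gx^{k+1})=(1,0,0,x^1\cdot x^{2\perp},gx^3,\dots,gx^{k+1})\in\mathbb{R}^{2k+2}.$$ Two non-degenerate configurations have the same area type if and only if they have the same image under $A$, so the non-degenerate area types are identified with points of the $(2k-1)$-dimensional flat in $\mathbb{R}^{2k+2}$ of points whose first three coordinates are $(1,0,0)$. This flat is equipped with $(2k-1)$-dimensional Lebesgue measure $\mathcal{L}_{2k-1}$ (in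 the last $2k-1$ coordinates). Under this identification, $\mathcal{A}_k(E)$ is the set $\{A(x): x\in E^{k+1},\ x \text{ non-degenerate}\}$ (degenerate configurations are disregarded). *)

(* Defs.v *)
From mathcomp Require Import all_boot all_order all_algebra.
From mathcomp Require Import all_classical all_reals all_analysis.
Set Implicit Arguments.
Unset Strict Implicit.
Unset Printing Implicit Defensive.
Import Order.TTheory GRing.Theory Num.Theory.
Import numFieldNormedType.Exports.
Local Open Scope classical_set_scope.
Local Open Scope ring_scope.

Section Hausdorff.
Context {R : realType} {n : nat}.
Implicit Types (x y : 'cV[R]_n) (U E : set 'cV[R]_n).

(* The library norm on matrices is the sup norm, hence this definition. *)
Definition euclidean_dist x y : R :=
  Num.sqrt (\sum_(i < n) (x i 0 - y i 0) ^+ 2).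

Definition diameter U : \bar R :=
  ereal_sup [set (euclidean_dist p.1 p.2)%:E | p in U `*` U].

(* The empty set has weight 0 for every s, also for s = 0, where every nonempty
   set has weight 1 (poweR sends 0 and the exponent 0 to 1). *)
Definition diameter_pow (s : R) U : \bar R :=
  if U == set0 then 0%E else poweR (diameter U) s.

Definition hausdorff_premeasure (s delta : R) E : \bar R :=
  ereal_inf [set (\sum_(0 <= j <oo) diameter_pow s (U j))%E
            | U in [set U : nat -> set 'cV[R]_n |
                     (forall j, (diameter (U j) <= delta%:E)%E) /\
                     E `<=` \bigcup_j U j]].

(* The premeasure increases as delta decreases, so the limit as delta tends
   to 0 is a supremum. *)
Definition hausdorff_measure (s : R) E : \bar R :=
  ereal_sup [set hausdorff_premeasure s delta E
            | delta in [set delta : R | 0 < delta]].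

Definition hausdorff_dim E : \bar R :=
  ereal_inf [set s%:E | s in [set s : R | 0 <= s /\
                                hausdorff_measure s E = 0%E]].

End Hausdorff.

Section Lebesgue.
Context {R : realType} {n : nat}.

Definition closed_box (a b : 'rV[R]_n) : set 'rV[R]_n :=
  [set x | forall i, a 0 i <= x 0 i <= b 0 i].

(* n-dimensional Lebesgue (outer) measure, defined on all subsets of R^n; it is
   the Lebesgue measure of A whenever A is Lebesgue measurable. *)
Definition lebesgue_measure_rV (A : set 'rV[R]_n) : \bar R :=
  ereal_inf [set (\sum_(0 <= j <oo) (\prod_(i < n) (ab.2 j 0 i - ab.1 j 0 i))%:E)%E
            | ab in [set ab : (nat -> 'rV[R]_n) * (nat -> 'rV[R]_n) |
                      (forall j i, ab.1 j 0 i <= ab.2 j 0 i) /\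
                      A `<=` \bigcup_j closed_box (ab.1 j) (ab.2 j)]].

End Lebesgue.

Section AreaTypes.
Context {R : realType}.
Implicit Types (u v : 'cV[R]_2) (g : 'M[R]_2).

Definition vec2 (a b : R) : 'cV[R]_2 := \col_(i < 2) (if i == 0 then a else b).

Definition dotp u v : R := (u^T *m v) 0 0.

Definition perp v : 'cV[R]_2 := vec2 (v 1 0) (- v 0 0).

Context {k : nat}.

(* The points x^1, ..., x^(k+1) are x 0, ..., x k. For k >= 1, inord 1 is the
   index of the second point. *)
Definition configuration := 'I_k.+1 -> 'cV[R]_2.
Implicit Types x : configuration.

Definition nondegenerate_conf x : Prop := free [:: x ord0; x (inord 1)].

Definition is_normalizer x g : Prop :=
  [/\ \det g = 1, g *m x ord0 = vec2 1 0 &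
      g *m x (inord 1) = vec2 0 (dotp (x ord0) (perp (x (inord 1))))].

(* The concatenation (g x^1, ..., g x^(k+1)) as a vector of R^(2k+2). *)
Definition act_coords g x : 'rV[R]_(k.*2.+2) :=
  \row_(m < k.*2.+2) (g *m x (inord m./2)) (inord (odd m)) 0.

(* The set of all A(x), where A(x) = act_coords g x for the unique normalizer
   g of the non-degenerate configuration x. *)
Definition area_types (E : set 'cV[R]_2) : set 'rV[R]_(k.*2.+2) :=
  [set y | exists x g, [/\ forall i, E (x i), nondegenerate_conf x,
                           is_normalizer x g & y = act_coords g x]].

Definition flat : set 'rV[R]_(k.*2.+2) :=
  [set y | [/\ y 0 (inord 0) = 1, y 0 (inord 1) = 0 & y 0 (inord 2) = 0]].

Definition last_coords (y : 'rV[R]_(k.*2.+2)) : 'rV[R]_(k.*2.-1) :=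
  \row_(m < k.*2.-1) y 0 (inord (m + 3)).

(* Lebesgue measure of the (2k-1)-dimensional flat. *)
Definition flat_measure (A : set 'rV[R]_(k.*2.+2)) : \bar R :=
  lebesgue_measure_rV (last_coords @` (A `&` flat)).

End AreaTypes.

Arguments configuration R k : clear implicits.
Arguments flat {R} k.
Arguments area_types {R} k E.

(* Main.v *)
(* Let [eps = 2 ^- J] and [a = 2 ^- s] for some [s] slightly below [dim E].  A Frostman argument on
   dyadic cells gives finitely many weighted points of [E], of total mass [1], such that balls of
   radius [2 ^- i >= eps] carry mass [O(a ^ i)].  Round the area types of the configurations of
   these points to precision [eps].  By Cauchy-Schwarz the number of rounded types is at least of
   order [1 / P], where [P] is the mass of the pairs of configurations with the same rounded type;
   a null set meets only [o(eps ^ -(2k-1))] of them, so it suffices that [P = O(eps ^ (2k-1))].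

   Two configurations with the same rounded type are related, up to [O(eps)], by some [g] in [SL_2]
   which may be taken close to [1].  For a direction [t] use the coordinates
   [ln (X + t Y)] and [Y / (X + t Y)] of the point [(X, Y)].  From the chart of a direction [t'] to
   the chart of a direction [t = g t'], the map [g] acts as a translation on the first coordinate
   and as an affine map on the second; the factor and the offset of the latter are rounded to
   integer parameters [m] and [n].  Each pair of configurations is seen by about [1 / eps] pairs of
   directions, hence [P / eps] is bounded by the normalized sum of [Lam ^ (k + 1)] over [t], [t'],
   [m] and [n], where [Lam] is the mass of the pairs of points matched by these parameters.
   For all but few directions, the pairs of points lying in a common strip have small mass at every
   scale.  For the remaining ones [Lam] is telescoped over the dyadic scales [2 ^- j]: its
   increments are small in [L^2], because averaging over [m] makes the second difference of the
   overlap of two boxes cancel, and [Lam] is bounded by [O(eps A ^ j)] with [A] close to [2 a].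
   The sum over the scales converges when [2 ^ k * A ^ (k + 1) < 1], which can be arranged when
   [dim E > 2 - 1 / (k + 1)]. *)

Require Import Defs.
From mathcomp Require Import all_boot all_order all_algebra.
From mathcomp Require Import all_classical all_reals all_analysis.
From mathcomp Require Import zify ring lra.
Import Order.TTheory GRing.Theory Num.Theory.
Import numFieldNormedType.Exports.
Local Open Scope classical_set_scope.
Local Open Scope ring_scope.

Set Implicit Arguments.
Unset Strict Implicit.
Unset Printing Implicit Defensive.

(** * Overlaps of boxes *)

(** The four parameters [t], [t'], [m] and the offset describe the three-dimensional group [SL_2]
    with one degree of redundancy: a given [g] has a partner [t'] for every direction [t]. This
    redundancy is the factor [1 / eps], and it allows a small proportion of bad directions to be
    dropped.

    The power [Lam ^ (k + 1)] is beyond [L^2] methods alone, so at each scale two factors are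
    estimated in [L^2] and the other [k - 1] in sup norm. For densities normalized to be bounded at
    scale [1], the increment at scale [2 ^- j] is [O((2 A) ^ j)] in sup norm, and its square
    averages to [O((2 A ^ 2) ^ j)]; the ratio of the series is [(2 A) ^ (k - 1) * (2 A ^ 2)]. The
    obstacle is the case [k >= 2], where [2 A ^ 2 < 1] near the threshold: merely counting the
    matched [m] would bound the averaged square by [O(1)], and [(2 A) ^ (k - 1)] does not decay. The
    cancellation in [m] supplies the missing decay.

    With [A] near [2 ^ (1 - s)] the ratio is below [1] when [k + (k + 1) (1 - s) < 0], and
    [k + 1 <= 2 k] relates this to the exponent of the theorem. *)

Section IntSums.
Context {R : realType}.
Implicit Types (F G : int -> R) (W A L : nat).

(* The window [- W <= z < W] stands for all integers: the summands of interest vanish outside. *)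
Definition zsum W F : R := \sum_(0 <= i < W.*2) F (i%:Z - W%:Z).

Lemma zsum_shiftn W A (r : nat) F :
  (forall z, A%:Z <= `|z| -> F z = 0) -> (r + A <= W)%N ->
  zsum W (fun z => F (z + r%:Z)) = zsum W F.
Proof.
move=> F0 rAW; rewrite /zsum.
have -> : \sum_(0 <= i < W.*2) F (i%:Z - W%:Z + r%:Z) =
          \sum_(r <= i < W.*2 + r) F (i%:Z - W%:Z).
  rewrite -{2}(add0n r) big_addn addnK.
  by apply: eq_bigr => i _; congr F; lia.
have e1 : \sum_(0 <= i < W.*2 + r) F (i%:Z - W%:Z) =
   \sum_(r <= i < W.*2 + r) F (i%:Z - W%:Z).
  rewrite (@big_cat_nat _ _ _ r) //=; last by lia.
  rewrite big_nat_cond big1 ?add0r // => i /andP[/andP[_ ir] _].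
  by apply: F0; lia.
rewrite -e1 (@big_cat_nat _ _ _ W.*2) //=; last by lia.
rewrite [X in _ + X]big_nat_cond [X in _ + X]big1 ?addr0 // => i /andP[/andP[ir _] _].
by apply: F0; lia.
Qed.

Lemma zsum_shift W A (r : int) F :
  (forall z, A%:Z <= `|z| -> F z = 0) -> (`|r| *+ 2 + A%:Z <= W%:Z) ->
  zsum W (fun z => F (z + r)) = zsum W F.
Proof.
move=> F0 rAW; case: (lerP 0 r) => r0.
  have -> : r = (`|r|%N)%:Z by lia.
  by apply: (@zsum_shiftn _ A) => //; lia.
rewrite -[LHS](@zsum_shiftn _ (A + `|r|)%N `|r|%N); last by lia.
  by apply: eq_bigr => i _; congr F; lia.
by move=> z hz; apply: F0; lia.
Qed.

Lemma zsumZ W (c : R) F : zsum W (fun z => c * F z) = c * zsum W F.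
Proof. by rewrite /zsum mulr_sumr. Qed.

Lemma zsumB W F G : zsum W (fun z => F z - G z) = zsum W F - zsum W G.
Proof. by rewrite /zsum -sumrB. Qed.

Lemma ler_zsum W F G : (forall z, F z <= G z) -> zsum W F <= zsum W G.
Proof. by move=> FG; apply: ler_sum. Qed.

Lemma ler_norm_zsum W F : `|zsum W F| <= zsum W (fun z => `|F z|).
Proof. exact: ler_norm_sum. Qed.

Lemma zsum_ge0 W F : (forall z, 0 <= F z) -> 0 <= zsum W F.
Proof. by move=> F0; apply: sumr_ge0. Qed.

Lemma eq_zsum W F G : F =1 G -> zsum W F = zsum W G.
Proof. by move=> FG; apply: eq_bigr => i _; rewrite FG. Qed.

Lemma zsum_cst W (c : R) : zsum W (fun=> c) = c * W.*2%:R.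
Proof. by rewrite /zsum big_const_nat iter_addr_0 subn0 mulr_natr. Qed.

Lemma exchange_zsum W (I : Type) (r : seq I) (P : pred I) (F : I -> int -> R) :
  zsum W (fun z => \sum_(i <- r | P i) F i z) = \sum_(i <- r | P i) zsum W (F i).
Proof. exact: exchange_big. Qed.

Lemma zsum_itv W (lo hi : int) : - W%:Z <= lo -> lo <= hi -> hi <= W%:Z ->
  zsum W (fun z => ((lo <= z) && (z < hi))%:R) = (hi - lo)%:~R.
Proof.
move=> h1 h2 h3; rewrite /zsum.
have [a ea] : exists a : nat, lo = a%:Z - W%:Z by exists `|(lo + W%:Z)%R|%N; lia.
have [b eb] : exists b : nat, hi = b%:Z - W%:Z by exists `|(hi + W%:Z)%R|%N; lia.
rewrite (@big_cat_nat _ _ _ a) //=; last by lia.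
rewrite [X in _ + X](@big_cat_nat _ _ _ b) //=; [|lia|lia].
rewrite big_nat_cond big1 ?add0r; last first.
  by move=> i /andP[/andP[_ ir] _]; rewrite (_ : _ && _ = false) //; lia.
rewrite [X in _ + X]big_nat_cond [X in _ + X]big1 ?addr0; last first.
  by move=> i /andP[/andP[ir _] _]; rewrite (_ : _ && _ = false) //; lia.
rewrite (eq_big_nat _ _ (F2 := fun=> 1)); last first.
  by move=> i /andP[ir ib]; rewrite (_ : _ && _ = true) //; lia.
rewrite big_const_nat iter_addr_0.
by rewrite (_ : hi - lo = (b - a)%N%:Z) //; lia.
Qed.

Lemma zsum_itv_le W (lo hi : int) : lo <= hi ->
  zsum W (fun z => ((lo <= z) && (z < hi))%:R) <= (hi - lo)%:~R.
Proof.
move=> h2.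
pose lo' := Order.max (- W%:Z) (Order.min lo W%:Z).
pose hi' := Order.min W%:Z (Order.max hi (- W%:Z)).
have e : zsum W (fun z => ((lo <= z) && (z < hi))%:R) =
         zsum W (fun z => ((lo' <= z) && (z < hi'))%:R).
  rewrite /zsum; apply: eq_big_nat => i /andP[_ hi0].
  congr (_%:R); congr nat_of_bool; rewrite /lo' /hi'; lia.
rewrite e zsum_itv; [|rewrite /lo'; lia|rewrite /lo' /hi'; lia|rewrite /hi'; lia].
by rewrite ler_int /lo' /hi'; lia.
Qed.

Definition box L (z : int) : R := ((0 <= z) && (z < L%:Z))%:R.
Definition tent L (z : int) : R := (Order.max 0 (L%:Z - `|z|))%:~R.

Lemma zsum_box2 W L (a b : int) :
  `|a| + L%:Z <= W%:Z -> `|b| + L%:Z <= W%:Z ->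
  zsum W (fun g => box L (g + a) * box L (g + b)) = tent L (a - b).
Proof.
move=> ha hb.
case: (lerP L%:Z `|a - b|) => hab.
  rewrite /tent (_ : Order.max _ _ = 0); last by lia.
  rewrite /zsum big1 // => i _; rewrite /box -natrM mulnb (_ : _ && _ = false) //; lia.
pose lo := Order.max (- a) (- b); pose hi := Order.min (- a) (- b) + L%:Z.
rewrite (eq_zsum _ (G := fun z => ((lo <= z) && (z < hi))%:R)); last first.
  move=> z; rewrite /box -natrM mulnb; congr (_%:R); congr nat_of_bool.
  by rewrite /lo /hi; lia.
rewrite zsum_itv; [|rewrite /lo; lia|rewrite /lo /hi; lia|rewrite /hi; lia].
by rewrite /tent /lo /hi; congr intr; lia.
Qed.

Lemma tent_ge0 L z : 0 <= tent L z.
Proof. by rewrite /tent ler0z; lia. Qed.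

Lemma tent_le L z : tent L z <= L%:R.
Proof. by rewrite /tent -[L%:R]/(L%:Z%:~R) ler_int; lia. Qed.

Lemma tent_eq0 L z : L%:Z <= `|z| -> tent L z = 0.
Proof. by move=> h; rewrite /tent (_ : Order.max _ _ = 0) //; lia. Qed.

Lemma tent_lip L z z' : `|tent L z - tent L z'| <= `|z - z'|%:~R.
Proof. by rewrite /tent -rmorphB /= -intr_norm ler_int; lia. Qed.

(* The autocorrelation of [box L - box L (. - L)]. *)
Definition tent2 L (z : int) : R :=
  tent L z *+ 2 - tent L (z + L%:Z) - tent L (z - L%:Z).

Lemma zsum_dbox2 W L (a b : int) :
  `|a| + L%:Z *+ 2 <= W%:Z -> `|b| + L%:Z *+ 2 <= W%:Z ->
  zsum W (fun g => (box L (g + a) - box L (g + a - L%:Z)) *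
                   (box L (g + b) - box L (g + b - L%:Z))) = tent2 L (a - b).
Proof.
move=> ha hb.
pose c := L%:Z.
rewrite (eq_zsum _ (G := fun z =>
  (box L (z + a) * box L (z + b) - box L (z + a) * box L (z + (b - c)))
  - (box L (z + (a - c)) * box L (z + b) - box L (z + (a - c)) * box L (z + (b - c))))).
  rewrite !zsumB !zsum_box2 /c; try lia.
  rewrite /tent2 mulr2n (_ : a - L%:Z - (b - L%:Z) = a - b); last by lia.
  rewrite (_ : a - (b - L%:Z) = a - b + L%:Z); last by lia.
  rewrite (_ : a - L%:Z - b = a - b - L%:Z); last by lia.
  ring.
by move=> z /=; rewrite !addrA; ring.
Qed.

Lemma tent2_eq0 L z : L%:Z *+ 2 <= `|z| -> tent2 L z = 0.
Proof. by move=> h; rewrite /tent2 !tent_eq0 ?mul0rn ?subr0 //; lia. Qed.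

Lemma tent2_le L z : `|tent2 L z| <= 2 * L%:R.
Proof.
have := tent_ge0 L z; have := tent_ge0 L (z + L%:Z); have := tent_ge0 L (z - L%:Z).
have := tent_le L z; have := tent_le L (z + L%:Z); have := tent_le L (z - L%:Z).
by rewrite /tent2 mulr2n ler_norml => *; apply/andP; split; lra.
Qed.

End IntSums.

(** * Cancellation in the average over the factor [m] *)

Section Oscillation.
Context {R : realType}.

(** A Lipschitz cutoff keeping the factor [m / H] between [1/2] and [3/2]. Its regularity matters:
    in [osc_far] the second difference of [tent] is transferred to this weight. *)
Definition hat (H : nat) (m : int) : R :=
  Num.max 0 (1 - 2 * `|m%:~R / H%:R - 1|).

Lemma hat_ge0 H m : 0 <= hat H m.
Proof. by rewrite /hat le_max lexx. Qed.

Lemma hat_le1 H m : hat H m <= 1.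
Proof. by rewrite /hat ge_max ler01 /= gerBl mulr_ge0. Qed.

Lemma hat_supp H m : (0 < H)%N -> hat H m != 0 ->
  H%:R / 2 < m%:~R :> R /\ m%:~R < 3 / 2 * H%:R :> R.
Proof.
move=> H0 h; have H0' : 0 < H%:R :> R by rewrite ltr0n.
have : 2 * `|m%:~R / H%:R - 1| < 1 :> R.
  rewrite ltNge; apply: contra h => h; rewrite /hat.
  by apply/eqP/max_idPl; rewrite subr_le0.
have -> : m%:~R / H%:R - 1 = (m%:~R - H%:R) / H%:R :> R.
  by rewrite mulrBl divff // gt_eqF.
rewrite normrM [`|_^-1|]gtr0_norm ?invr_gt0 // mulrA ltr_pdivrMr // mul1r => h1.
have : `|m%:~R - H%:R| < H%:R / 2 :> R by lra.
by rewrite ltr_norml => /andP[]; split; lra.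
Qed.

Lemma hat_eq0 H (m : int) : (0 < H)%N -> 2 * H%:Z <= `|m| -> hat H m = 0.
Proof.
move=> H0 h; apply/eqP; apply: contraT => /(hat_supp H0)[h1 h2].
have h3 : 0 < m by rewrite -(ltr0z R); apply: le_lt_trans h1; rewrite divr_ge0.
have : m%:~R < (2 * H%:Z)%:~R :> R.
  apply: lt_le_trans h2 _; rewrite rmorphM /=; apply: ler_wpM2r => //.
  by rewrite -[2%:~R]/2; lra.
by rewrite ltr_int; lia.
Qed.

Lemma hat_lip H m m' : (0 < H)%N ->
  `|hat H m - hat H m'| <= 2 * `|m - m'|%:~R / H%:R.
Proof.
move=> H0; have H0' : 0 < H%:R :> R by rewrite ltr0n.
have -> : 2 * `|m - m'|%:~R / H%:R = 2 * `|(m%:~R / H%:R - 1) - (m'%:~R / H%:R - 1)| :> R.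
  rewrite opprB addrA subrK -mulrBl normrM (@gtr0_norm _ H%:R^-1) ?invr_gt0 //.
  by rewrite -mulrzBr -intr_norm mulrA.
set u := _ - 1; set v := (m'%:~R / _ - 1).
rewrite /hat -/u -/v.
have h1 := lerB_dist u v; have h2 := lerB_dist v u; rewrite distrC in h2.
set d := `|u - v| in h1 h2 *; set a := `|u| in h1 h2 *; set b := `|v| in h1 h2 *.
have hd : 0 <= d by rewrite normr_ge0.
rewrite /Num.max; case: ifP => ha; case: ifP => hb; rewrite ler_norml; apply/andP; split; lra.
Qed.

(** [z] follows an affine function of slope [P] up to an error [1], so [|z m| < L] confines [m] to
    an interval of radius [(L + 1) / |P|]. *)
Lemma zsum_near (W L : nat) (P Q : R) (z : int -> int) :
  P != 0 -> (forall m : int, `|(z m)%:~R - (m%:~R * P + Q)| <= 1) ->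
  zsum W (fun m => (`|z m| < L%:Z)%R%:R) <= 2 * (L%:R + 1) / `|P| + 2 :> R.
Proof.
move=> P0 hz; pose c := - Q / P; pose rho : R := (L%:R + 1) / `|P|.
have nP : 0 < `|P| by rewrite normr_gt0.
have rho0 : 0 <= rho by rewrite divr_ge0 // addr_ge0.
have hlt := floorD1_gt (c - rho); have hle := floor_le (c + rho).
pose lo := Num.floor (c - rho); pose hi := Num.floor (c + rho) + 1.
have lohi : lo <= hi.
  rewrite /lo /hi (le_trans (y := Num.floor (c + rho))) ?lerDl //.
  by apply: le_floor; rewrite lerD2l; lra.
apply: le_trans (_ : (hi - lo)%:~R <= _).
  apply: le_trans (zsum_itv_le W lohi); apply: ler_zsum => m.
  case: (ltrP `|z m| L%:Z) => hm /=; last by rewrite ler0n.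
  suff : (lo <= m) && (m < hi) by move=> ->.
  have hzL : `|(z m)%:~R| < L%:R :> R by rewrite -intr_norm -[L%:R]/(L%:Z%:~R) ltr_int.
  have h1 : `|m%:~R * P + Q| <= L%:R + 1.
    have := ler_normD ((m%:~R * P + Q) - (z m)%:~R) (z m)%:~R.
    rewrite subrK distrC => h; move: (hz m) hzL h; lra.
  have h2 : `|m%:~R - c| <= rho.
    have e : m%:~R - c = (m%:~R * P + Q) / P by rewrite /c; field.
    by rewrite e normrM normfV ler_pM2r // invr_gt0.
  move: h2; rewrite ler_norml => /andP[h2 h3].
  apply/andP; split.
    by rewrite /lo -(ler_int R); apply: le_trans (floor_le _) _; lra.
  have : m <= Num.floor (c + rho) by rewrite floor_ge_int; lra.
  by rewrite /hi; lia.
have -> : 2 * (L%:R + 1) / `|P| = 2 * rho by rewrite /rho mulrA.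
rewrite /hi /lo rmorphB rmorphD /= in hlt *.
by move: hlt hle; rewrite rmorphD /=; lra.
Qed.

(** If [|Q|] exceeds the range of [m * P] on the support of [hat], then [z m] stays outside the
    support of [tent2]. In [osc_pair] this leaves only the case where [Q] is controlled by [P] and
    [L]. *)
Lemma hat_tent2_eq0 (H L : nat) (P Q : R) (z : int -> int) (m : int) : (0 < H)%N ->
  (forall m : int, `|(z m)%:~R - (m%:~R * P + Q)| <= 1) ->
  2 * L%:R + 1 + 3 / 2 * H%:R * `|P| <= `|Q| ->
  hat H m * tent2 L (z m) = 0.
Proof.
move=> H0 hz hQ; apply/eqP; rewrite mulf_eq0.
case: eqP => //= /eqP hm; have [h1 h2] := hat_supp H0 hm.
have H0' : 0 < H%:R :> R by rewrite ltr0n.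
rewrite tent2_eq0 //.
rewrite -(ler_int R) intr_norm.
have h3 : `|m%:~R * P| <= 3 / 2 * H%:R * `|P|.
  by rewrite normrM ler_wpM2r // ger0_norm; lra.
have h4 := ler_normB (m%:~R * P + Q - (z m)%:~R) (m%:~R * P - (z m)%:~R).
have e4 : m%:~R * P + Q - (z m)%:~R - (m%:~R * P - (z m)%:~R) = Q by ring.
have h5 := ler_normB (m%:~R * P) (z m)%:~R.
rewrite e4 distrC in h4.
rewrite (_ : (L%:Z *+ 2)%:~R = 2 * L%:R :> R); last by rewrite rmorphMn /= mulr2n; ring.
by move: (hz m); lra.
Qed.

(* Translating [m] by [r ~ L / P] moves [z m] by about [L], so the second
   difference hidden in [tent2] can be transferred to the weight [hat]. *)
Lemma osc_far (H L D : nat) (P Q : R) (z : int -> int) :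
  (0 < L)%N -> (0 < D)%N -> H = (L * D)%N -> (D ^ 3 <= H)%N ->
  D%:R^-1 < `|P| -> `|P| <= 4 ->
  (forall m : int, `|(z m)%:~R - (m%:~R * P + Q)| <= 1) ->
  `|zsum (8 * H) (fun m => hat H m * tent2 L (z m))|
    <= 4000 * (H%:R ^+ 2 / (D%:R ^+ 3 * `|P| ^+ 2)).
Proof.
move=> L0 D0 HLD HD3 PD P4 hz.
have H0 : (0 < H)%N by rewrite HLD muln_gt0 L0.
have [L0' D0' H0'] : [/\ 0 < L%:R :> R, 0 < D%:R :> R & 0 < H%:R :> R].
  by rewrite !ltr0n.
have L1 : 1 <= L%:R :> R by rewrite ler1n.
have nP : 0 < `|P| by apply: le_lt_trans PD; rewrite invr_ge0.
have P0 : P != 0 by rewrite -normr_gt0.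
have HLDr : H%:R = L%:R * D%:R :> R by rewrite HLD natrM.
pose r := Num.floor (L%:R / P).
have hr1 := floor_le (L%:R / P); have hr2 := floorD1_gt (L%:R / P).
have hrP : `|r%:~R * P - L%:R| <= `|P|.
  have -> : r%:~R * P - L%:R = (r%:~R - L%:R / P) * P by field.
  rewrite normrM ler_piMl //.
  by rewrite ler_norml; move: hr2; rewrite rmorphD /= -/r in hr1 *; rewrite -/r => hr2;
    apply/andP; split; lra.
(* Here [1 / D < |P|] enters: the translation [r] stays at most [H], so the translated weights still
   fit in the window [8 * H]. *)
have LP_H : L%:R / `|P| < H%:R.
  by rewrite ltr_pdivrMr // HLDr -mulrA ltr_pMr // mulrC -ltr_pdivrMr // mul1r.
have hrn : `|r%:~R| <= L%:R / `|P| + 1 :> R.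
  have := ler_normD (r%:~R - L%:R / P) (L%:R / P); rewrite subrK normrM normfV normr_nat.
  have : `|r%:~R - L%:R / P| <= 1.
    by rewrite ler_norml; move: hr2; rewrite rmorphD /= -/r in hr1 *; rewrite -/r => hr2;
      apply/andP; split; lra.
  lra.
have hrH : `|r| <= H%:Z.
  have : `|r|%:~R < (H%:Z + 1)%:~R :> R.
    by rewrite intr_norm rmorphD /=; apply: le_lt_trans hrn _; rewrite ltrD2r.
  by rewrite ltr_int ltzD1.
set W := (8 * H)%N.
(* The error [6] consists of [1 + 1] for the two roundings in [z] and [|P| <= 4] for rounding
   [L / P] to [r]. *)
have near (e : int) m : e = 1 \/ e = -1 ->
    `|tent L (z (m + e * r)) - tent L (z m + e * L%:Z)| <= 6 :> R.
  move=> he; apply: le_trans (tent_lip _ _ _) _.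
  rewrite intr_norm rmorphB rmorphD rmorphM /=.
  have h1 := hz (m + e * r); have h2 := hz m.
  rewrite rmorphD rmorphM /= in h1.
  set A := (z _)%:~R in h1 *; set B := (z m)%:~R in h2 *.
  have en : `|e%:~R| = 1 :> R by case: he => ->; rewrite ?normrN1 // normr1.
  have -> : A - (B + e%:~R * L%:Z%:~R) =
    (A - ((m%:~R + e%:~R * r%:~R) * P + Q)) + ((m%:~R * P + Q) - B)
      + e%:~R * (r%:~R * P - L%:R) by rewrite -[L%:Z%:~R]/(L%:R); ring.
  apply: le_trans (ler_normD _ _) _; rewrite normrM en mul1r.
  have := ler_normD (A - ((m%:~R + e%:~R * r%:~R) * P + Q)) ((m%:~R * P + Q) - B).
  rewrite distrC in h2; lra.
have shift (e : int) : e = 1 \/ e = -1 ->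
    zsum W (fun m => hat H m * tent L (z (m + e * r))) =
    zsum W (fun m => hat H (m - e * r) * tent L (z m)).
  move=> he; pose F m : R := hat H (m - e * r) * tent L (z m).
  rewrite -[RHS](@zsum_shift _ _ (3 * H) (e * r) F) //.
  - by apply: eq_zsum => m; rewrite /F addrK.
  - by move=> m hm; rewrite /F hat_eq0 ?mul0r //; case: he => ->; clear -hm hrH; lia.
  - by case: he => ->; rewrite /W; clear -hrH; lia.
pose main := zsum W (fun m => (hat H m *+ 2 - hat H (m + r) - hat H (m - r)) * tent L (z m)).
have step1 : `|zsum W (fun m => hat H m * tent2 L (z m)) - main| <= 12 * (16 * H%:R).
  have -> : main = zsum W (fun m => hat H m *
      (tent L (z m) *+ 2 - tent L (z (m + r)) - tent L (z (m - r)))).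
    have s1 := shift 1 (or_introl erefl); have s2 := shift (-1) (or_intror erefl).
    rewrite [RHS](eq_zsum _ (G := fun m => hat H m * tent L (z m) *+ 2
       - hat H m * tent L (z (m + 1 * r)) - hat H m * tent L (z (m + (-1) * r)))); last first.
      by move=> m /=; rewrite mul1r mulN1r !mulrBr mulrnAr.
    rewrite [RHS]zsumB zsumB s1 s2 -!zsumB.
    by apply: eq_zsum => m; rewrite mul1r mulN1r opprK !mulr2n; ring.
  rewrite -zsumB.
  apply: le_trans (ler_norm_zsum _ _) _.
  rewrite (_ : 12 * (16 * H%:R) = zsum W (fun=> 12)); last first.
    by rewrite zsum_cst /W -!mul2n !natrM; ring.
  apply: ler_zsum => m /=.
  rewrite -mulrBr normrM ger0_norm ?hat_ge0 //.
  apply: le_trans (ler_piMl _ (hat_le1 _ _)) _ => //.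
  have n1 := near 1 m (or_introl erefl); have n2 := near (-1) m (or_intror erefl).
  rewrite mul1r in n1; rewrite mulN1r in n2.
  rewrite /tent2 mul1r in n1 *; rewrite mulN1r in n2.
  have -> (a b c b' c' : R) : a *+ 2 - b - c - (a *+ 2 - b' - c') = (b' - b) + (c' - c).
    by ring.
  by apply: le_trans (ler_normD _ _) _; lra.
have hrn5 : `|r%:~R| <= 5 * L%:R / `|P| :> R.
  apply: le_trans hrn _.
  have -> : 5 * L%:R / `|P| = L%:R / `|P| + 4 * L%:R / `|P| by ring.
  by rewrite lerD2l ler_pdivlMr //; lra.
(* Three factors: the Lipschitz bound for the second difference of [hat], the height [L] of the
   tent, and the number [12 L / |P|] of integers [m] in its support. *)
have step2 : `|main| <= 4 * (5 * L%:R / `|P|) / H%:R * (L%:R * (12 * L%:R / `|P|)).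
  apply: le_trans (ler_norm_zsum _ _) _.
  apply: le_trans (_ : zsum W (fun m =>
    4 * (5 * L%:R / `|P|) / H%:R * (L%:R * (`|z m| < L%:Z)%R%:R)) <= _).
    apply: ler_zsum => m; rewrite normrM; apply: ler_pM => //.
      have -> (a b c : R) : a *+ 2 - b - c = (a - b) + (a - c) by ring.
      apply: le_trans (ler_normD _ _) _.
      have l1 := hat_lip m (m + r) H0; have l2 := hat_lip m (m - r) H0.
      have er1 : `|m - (m + r)|%:~R = `|r%:~R| :> R by rewrite -intr_norm; congr intr; clear; lia.
      have er2 : `|m - (m - r)|%:~R = `|r%:~R| :> R by rewrite -intr_norm; congr intr; clear; lia.
      rewrite er1 in l1; rewrite er2 in l2.
      have : 2 * `|r%:~R| / H%:R <= 2 * (5 * L%:R / `|P|) / H%:R :> R.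
        by rewrite ler_pM2r ?invr_gt0 // ler_pM2l.
      have -> : 4 * (5 * L%:R / `|P|) / H%:R =
        2 * (5 * L%:R / `|P|) / H%:R + 2 * (5 * L%:R / `|P|) / H%:R :> R by ring.
      lra.
    rewrite ger0_norm ?tent_ge0 //.
    case: (ltrP `|z m| L%:Z) => hm; first by rewrite mulr1 tent_le.
    by rewrite tent_eq0 // mulr0.
  rewrite !zsumZ ler_wpM2l // ler_wpM2l //.
  apply: le_trans (zsum_near _ _ P0 hz) _.
  rewrite ler_pdivlMr // mulrDl divfK ?gt_eqF //; lra.
have e2 : 4 * (5 * L%:R / `|P|) / H%:R * (L%:R * (12 * L%:R / `|P|)) =
   240 * (H%:R ^+ 2 / (D%:R ^+ 3 * `|P| ^+ 2)) :> R.
  by rewrite HLDr; field; rewrite !gt_eqF.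
rewrite e2 in step2.
(* The rounding error [192 H] of [step1] is absorbed because [D ^ 3 <= H] and [|P| ^ 2 <= 16]. *)
have e1 : 12 * (16 * H%:R) <= 3072 * (H%:R ^+ 2 / (D%:R ^+ 3 * `|P| ^+ 2)) :> R.
  rewrite [leRHS]mulrA ler_pdivlMr; last by rewrite mulr_gt0 // exprn_gt0.
  have d3 : D%:R ^+ 3 <= H%:R :> R by rewrite -natrX ler_nat.
  have p2 : `|P| ^+ 2 <= 16.
    by rewrite (_ : 16 = 4 ^+ 2) ?lerXn2r // ?nnegrE //; ring.
  have : D%:R ^+ 3 * `|P| ^+ 2 <= H%:R * 16 by apply: ler_pM => //; rewrite exprn_ge0 // ltW.
  move=> h; have := ler_wpM2l (ltW H0') h.
  by rewrite expr2; lra.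
have := ler_normD (zsum W (fun m => hat H m * tent2 L (z m)) - main) main.
rewrite subrK.
set X := H%:R ^+ 2 / _ in e1 step2 *.
have X0 : 0 <= X by rewrite divr_ge0 ?mulr_ge0 ?exprn_ge0 // ltW.
lra.
Qed.

Lemma osc_near (H L : nat) (z : int -> int) :
  `|zsum (8 * H) (fun m => hat H m * tent2 L (z m))| <= 32 * H%:R * L%:R :> R.
Proof.
apply: le_trans (ler_norm_zsum _ _) _.
rewrite (_ : 32 * H%:R * L%:R = zsum (8 * H) (fun=> 2 * L%:R)); last first.
  by rewrite zsum_cst -!mul2n !natrM; ring.
apply: ler_zsum => m /=; rewrite normrM ger0_norm ?hat_ge0 //.
by apply: le_trans (ler_piMl _ (hat_le1 _ _)) (tent2_le _ _).
Qed.

(** For [|P| <= 1 / D] one has [D ^ 3 * M ^ 2 = D], and the trivial bound, a multiple of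
    [H * L = H ^ 2 / D], already has the required size. *)
Lemma osc_bound (H L D : nat) (P Q M : R) (z : int -> int) :
  (0 < L)%N -> (0 < D)%N -> H = (L * D)%N -> (D ^ 3 <= H)%N -> `|P| <= 4 ->
  (forall m : int, `|(z m)%:~R - (m%:~R * P + Q)| <= 1) ->
  M = Num.max D%:R^-1 `|P| ->
  `|zsum (8 * H) (fun m => hat H m * tent2 L (z m))|
    <= 4000 * (H%:R ^+ 2 / (D%:R ^+ 3 * M ^+ 2)).
Proof.
move=> L0 D0 HLD HD3 P4 hz ->.
have [L0' D0'] : [/\ 0 < L%:R :> R & 0 < D%:R :> R] by rewrite !ltr0n.
case: (ltrP D%:R^-1 `|P|) => hP; first exact: (@osc_far _ _ _ _ Q).
apply: le_trans (osc_near _ _ _) _; rewrite HLD natrM.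
have -> : (L%:R * D%:R) ^+ 2 / (D%:R ^+ 3 * D%:R^-1 ^+ 2) = L%:R * D%:R * L%:R :> R.
  by field; rewrite gt_eqF.
have : 0 <= L%:R * D%:R * L%:R :> R by rewrite !mulr_ge0 // ltW.
lra.
Qed.

End Oscillation.

(** * Correlations of keys *)

Section KeySums.
Context {R : realType} {K : eqType}.

Lemma key_ind (r : seq K) (x y : K) : uniq r -> x \in r ->
  (x == y)%:R = \sum_(k <- r) (x == k)%:R * (y == k)%:R :> R.
Proof.
move=> ur xr; rewrite (bigD1_seq x) //= eqxx mul1r big1 ?addr0.
  by rewrite eq_sym.
by move=> k; rewrite eq_sym => /negPf ->; rewrite mul0r.
Qed.

Lemma sum_keys (I J : finType) (kx : I -> K) (ky : J -> K) (r : seq K) (a : I -> R) (b : J -> R) :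
  uniq r -> (forall i, a i != 0 -> kx i \in r) ->
  \sum_i \sum_j (kx i == ky j)%:R * (a i * b j) =
  \sum_(k <- r) (\sum_i (kx i == k)%:R * a i) * (\sum_j (ky j == k)%:R * b j).
Proof.
move=> ur ra; under [RHS]eq_bigr => k _ do rewrite big_distrlr.
rewrite [RHS]exchange_big; apply: eq_bigr => i _; rewrite [RHS]exchange_big.
apply: eq_bigr => j _ /=; have [->|ai] := eqVneq (a i) 0.
  by rewrite mul0r mulr0 big1 // => k _; rewrite mulr0 mul0r.
rewrite (key_ind (ky j) ur (ra i ai)) mulr_suml; apply: eq_bigr => k _; ring.
Qed.

Context {I J : finType} (kx : I -> K) (ky : J -> K).

Let keys := undup (map kx (enum I) ++ map ky (enum J)).

Let keysP i : kx i \in keys.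
Proof. by rewrite mem_undup mem_cat; apply/orP; left; apply: map_f; rewrite mem_enum. Qed.

Let keysP' j : ky j \in keys.
Proof. by rewrite mem_undup mem_cat; apply/orP; right; apply: map_f; rewrite mem_enum. Qed.

Let keysU : uniq keys.
Proof. exact: undup_uniq. Qed.

(** Key by key this is [2 A B <= A ^ 2 + B ^ 2]: a cross-correlation is controlled by the two
    self-correlations. *)
Lemma key_sum_le (a : I -> R) (b : J -> R) :
  (\sum_i \sum_j (kx i == ky j)%:R * (a i * b j)) *+ 2 <=
  \sum_i \sum_i' (kx i == kx i')%:R * (a i * a i') +
  \sum_j \sum_j' (ky j == ky j')%:R * (b j * b j').
Proof.
rewrite !(sum_keys _ _ keysU) // -big_split -sumrMnl; apply: ler_sum => k _ /=.
set A := \sum_i _; set B := \sum_j _.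
by have := sqr_ge0 (A - B); rewrite expr2 mulr2n; lra.
Qed.

(* Cauchy-Schwarz for [\sum_(k, k') C k k' * C k' k]. *)
Lemma key_swap_le (F : I * J -> R) :
  \sum_p \sum_q ((kx p.1 == ky q.2) && (kx q.1 == ky p.2))%:R * (F p * F q) <=
  \sum_p \sum_q ((kx p.1 == kx q.1) && (ky p.2 == ky q.2))%:R * (F p * F q).
Proof.
pose C k l := \sum_p (kx p.1 == k)%:R * (ky p.2 == l)%:R * F p.
have e1 : \sum_p \sum_q ((kx p.1 == ky q.2) && (kx q.1 == ky p.2))%:R * (F p * F q) =
    \sum_(k <- keys) \sum_(l <- keys) C k l * C l k.
  under eq_bigr => p _ do under eq_bigr => q _ do
    rewrite -mulnb natrM (key_ind (ky q.2) keysU (keysP p.1)) (key_ind (ky p.2) keysU (keysP q.1))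
     big_distrlr /= mulr_suml.
  under eq_bigr => p _ do rewrite exchange_big.
  rewrite exchange_big; apply: eq_bigr => k _.
  under eq_bigr => p _ do under eq_bigr => q _ do rewrite mulr_suml.
  under eq_bigr => p _ do rewrite exchange_big.
  rewrite exchange_big; apply: eq_bigr => l _.
  rewrite big_distrlr; apply: eq_bigr => p _; apply: eq_bigr => q _ /=; ring.
have e2 : \sum_p \sum_q ((kx p.1 == kx q.1) && (ky p.2 == ky q.2))%:R * (F p * F q) =
    \sum_(k <- keys) \sum_(l <- keys) C k l * C k l.
  under eq_bigr => p _ do under eq_bigr => q _ do
    rewrite -mulnb natrM (key_ind (kx q.1) keysU (keysP p.1)) (key_ind (ky q.2) keysU (keysP' p.2))
     big_distrlr /= mulr_suml.
  under eq_bigr => p _ do rewrite exchange_big.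
  rewrite exchange_big; apply: eq_bigr => k _.
  under eq_bigr => p _ do under eq_bigr => q _ do rewrite mulr_suml.
  under eq_bigr => p _ do rewrite exchange_big.
  rewrite exchange_big; apply: eq_bigr => l _.
  rewrite big_distrlr; apply: eq_bigr => p _; apply: eq_bigr => q _ /=; ring.
rewrite e1 e2.
have e3 : \sum_(k <- keys) \sum_(l <- keys) C k l * C k l =
   \sum_(k <- keys) \sum_(l <- keys) C l k * C l k by rewrite exchange_big.
rewrite -(ler_pMn2r (n := 2)) // [leRHS]mulr2n {2}e3 -big_split -sumrMnl /=.
apply: ler_sum => k _; rewrite -big_split -sumrMnl /=; apply: ler_sum => l _ /=.
by have := sqr_ge0 (C k l - C l k); rewrite expr2 mulr2n; lra.
Qed.

End KeySums.

Section Correlation.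
Context {R : realType} {S : finType} (mu : S -> R) (kx ky : S -> int).
Hypothesis mu_ge0 : forall x, 0 <= mu x.

Definition corr (L : nat) (p q : S -> int) (g : int) : R :=
  \sum_x \sum_y (kx x == ky y)%:R * (mu x * mu y) * box L (g + (p x - q y)).

Lemma corr_ge0 L p q g : 0 <= corr L p q g.
Proof.
by do 2! apply: sumr_ge0 => ? _; rewrite !mulr_ge0 ?mu_ge0 ?ler0n.
Qed.

(** Squaring gives quadruples whose keys match across, [x] with [y] and [x'] with [y']. Exchanging
    [y] and [y'] turns the kernel into another autocorrelation, with sums of positions in place of
    differences, so [key_swap_le] applies and matches [x] with [x'] and [y] with [y'] instead. The
    relation between [kx] and [ky] disappears from the bound. *)
Lemma corr_sqr_le (L W B : nat) (p q : S -> int) :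
  (forall x, `|p x| <= B%:Z) -> (forall x, `|q x| <= B%:Z) ->
  (2 * B + 2 * L <= W)%N ->
  zsum W (fun g => (corr L p q g - corr L p q (g - L%:Z)) ^+ 2) <=
  \sum_(a : S * S) \sum_(b : S * S) ((kx a.1 == kx b.1) && (ky a.2 == ky b.2))%:R *
    ((mu a.1 * mu a.2) * (mu b.1 * mu b.2)) * tent2 L (p a.1 - p b.1 + (q a.2 - q b.2)).
Proof.
move=> hp hq hW.
pose db (z : int) : R := box L z - box L (z - L%:Z).
have e1 g : corr L p q g - corr L p q (g - L%:Z) =
    \sum_(a : S * S) (kx a.1 == ky a.2)%:R * (mu a.1 * mu a.2) * db (g + (p a.1 - q a.2)).
  rewrite /corr -sumrB -(pair_big predT predT (fun x y =>
    (kx x == ky y)%:R * (mu x * mu y) * db (g + (p x - q y)))) /=.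
  apply: eq_bigr => x _; rewrite -sumrB; apply: eq_bigr => y _.
  by rewrite /db mulrBr addrAC.
pose w (a b : S * S) := (mu a.1 * mu a.2) * (mu b.1 * mu b.2).
have e2 : zsum W (fun g => (corr L p q g - corr L p q (g - L%:Z)) ^+ 2) =
  \sum_(a : S * S) \sum_(b : S * S) ((kx a.1 == ky a.2) && (kx b.1 == ky b.2))%:R *
    w a b * tent2 L ((p a.1 - q a.2) - (p b.1 - q b.2)).
  rewrite (eq_zsum _ (G := fun g => \sum_(a : S * S) \sum_(b : S * S)
      ((kx a.1 == ky a.2) && (kx b.1 == ky b.2))%:R * w a b *
      (db (g + (p a.1 - q a.2)) * db (g + (p b.1 - q b.2))))); last first.
    move=> g; rewrite e1 expr2 big_distrlr; apply: eq_bigr => a _.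
    by apply: eq_bigr => b _; rewrite -mulnb natrM /w /=; ring.
  rewrite exchange_zsum; apply: eq_bigr => a _; rewrite exchange_zsum.
  apply: eq_bigr => b _; rewrite zsumZ; congr (_ * _).
  by rewrite zsum_dbox2 //; have := hp a.1; have := hq a.2; have := hp b.1; have := hq b.2; lia.
(* The exchange rests on [(p x - q y) - (p x' - q y') = (p x + q y') - (p x' + q y)], with
   [a = (x, y')] and [b = (x', y)]. *)
pose F z (a : S * S) := mu a.1 * mu a.2 * db (z + (p a.1 + q a.2)).
have e3 : \sum_(a : S * S) \sum_(b : S * S) ((kx a.1 == ky a.2) && (kx b.1 == ky b.2))%:R *
    w a b * tent2 L ((p a.1 - q a.2) - (p b.1 - q b.2)) =
  zsum W (fun z => \sum_(a : S * S) \sum_(b : S * S)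
     ((kx a.1 == ky b.2) && (kx b.1 == ky a.2))%:R * (F z a * F z b)).
  rewrite exchange_zsum.
  under [RHS]eq_bigr => a _ do rewrite exchange_zsum.
  pose G x y x' y' : R := ((kx x == ky y) && (kx x' == ky y'))%:R * (mu x * mu y * (mu x' * mu y'))
    * tent2 L (p x - q y - (p x' - q y')).
  transitivity (\sum_x \sum_y \sum_x' \sum_y' G x y x' y').
    rewrite [RHS]pair_big /=; apply: eq_bigr => a _; rewrite [RHS]pair_big /=.
    by apply: eq_bigr => b _.
  transitivity (\sum_x \sum_y' \sum_x' \sum_y G x y x' y').
    apply: eq_bigr => x _.
    under eq_bigr => y _ do rewrite exchange_big.
    rewrite exchange_big.
    by apply: eq_bigr => y' _; exact: exchange_big.
  rewrite [LHS]pair_big /=; apply: eq_bigr => a _; rewrite [LHS]pair_big /=.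
  apply: eq_bigr => b _; rewrite (eq_zsum _ (G := fun z =>
    ((kx a.1 == ky b.2) && (kx b.1 == ky a.2))%:R * (mu a.1 * mu b.2 * (mu b.1 * mu a.2)) *
      (db (z + (p a.1 + q a.2)) * db (z + (p b.1 + q b.2))))); last first.
    by move=> z; rewrite /F; ring.
  rewrite zsumZ /G; congr (_ * _); rewrite zsum_dbox2.
  - by congr (tent2 L _); ring.
  - by have := hp a.1; have := hq a.2; have := hp b.1; have := hq b.2; lia.
  - by have := hp a.1; have := hq a.2; have := hp b.1; have := hq b.2; lia.
rewrite e2 e3.
apply: le_trans (_ : zsum W (fun z => \sum_(a : S * S) \sum_(b : S * S)
     ((kx a.1 == kx b.1) && (ky a.2 == ky b.2))%:R * (F z a * F z b)) <= _).
  by apply: ler_zsum => z; apply: key_swap_le.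
rewrite exchange_zsum; apply: ler_sum => a _; rewrite exchange_zsum; apply: ler_sum => b _.
rewrite (eq_zsum _ (G := fun z => ((kx a.1 == kx b.1) && (ky a.2 == ky b.2))%:R *
    ((mu a.1 * mu a.2) * (mu b.1 * mu b.2)) *
      (db (z + (p a.1 + q a.2)) * db (z + (p b.1 + q b.2))))); last first.
  by move=> z; rewrite /F; ring.
rewrite zsumZ zsum_dbox2.
- rewrite (_ : p a.1 + q a.2 - (p b.1 + q b.2) = p a.1 - p b.1 + (q a.2 - q b.2)) //; ring.
- by have := hp a.1; have := hq a.2; have := hp b.1; have := hq b.2; lia.
- by have := hp a.1; have := hq a.2; have := hp b.1; have := hq b.2; lia.
Qed.

End Correlation.

Ltac nneg := repeat first
  [ assumption | exact: ler0n | exact: ler01 | (apply: ltW; assumption)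
  | (rewrite subr_ge0; apply: ltW; assumption) | apply: exprn_ge0
  | (rewrite invr_ge0) | apply: mulr_ge0 ].

Section GeometricSums.
Context {R : realFieldType}.

Lemma sum_geo_le (x : R) n : 0 <= x -> x < 1 -> \sum_(i < n) x ^+ i <= (1 - x)^-1.
Proof.
move=> x0 x1; rewrite -[leRHS]mul1r ler_pdivlMr ?subr_gt0 // mulrC.
have -> : (1 - x) * (\sum_(i < n) x ^+ i) = 1 - x ^+ n.
  by rewrite -opprB mulNr -subrX1 opprB.
by rewrite gerBl exprn_ge0.
Qed.

Lemma sum_geo_gt1_le (x : R) n : 1 < x -> \sum_(i < n.+1) x ^+ i <= x / (x - 1) * x ^+ n.
Proof.
move=> x1; rewrite mulrAC ler_pdivlMr ?subr_gt0 // mulrC -subrX1 exprS.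
by rewrite gerBl.
Qed.

(* Pigeonhole: the weights [(1 - q) * q ^+ j] have total mass at most [1]. *)
Lemma sum_expn_le (q : R) (n J : nat) (a : nat -> R) : 0 < q -> q < 1 ->
  (forall j, 0 <= a j) ->
  (\sum_(j < J) a j) ^+ n <= \sum_(j < J) (a j / ((1 - q) * q ^+ j)) ^+ n + (J == 0)%:R.
Proof.
move=> q0 q1 a0; case: J => [|J]; first by rewrite !big_ord0 add0r /= exprn_ile1.
rewrite /= addr0; pose w j := (1 - q) * q ^+ j.
have w0 j : 0 < w j by rewrite mulr_gt0 ?exprn_gt0 ?subr_gt0.
set T := \sum_(j < J.+1) a j.
have T0 : 0 <= T by apply: sumr_ge0.
have [[j hj]|hno] := pselect (exists j : 'I_J.+1, w j * T <= a j).
  rewrite (bigD1 j) //=; apply: le_trans (_ : (a j / w j) ^+ n <= _).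
    apply: lerXn2r; rewrite ?nnegrE //; first by rewrite divr_ge0 // ltW.
    by rewrite ler_pdivlMr // mulrC.
  by rewrite lerDl; apply: sumr_ge0 => i _; rewrite exprn_ge0 // divr_ge0 //; exact: ltW (w0 i).
exfalso; have : T < \sum_(j < J.+1) w j * T.
  rewrite {1}/T; apply: ltr_sum; first by apply/hasP; exists ord0; rewrite // mem_index_enum.
  by move=> j _; rewrite ltNge; apply/negP => h; apply: hno; exists j.
rewrite -mulr_suml -mulr_sumr; apply/negP; rewrite -leNgt ler_piMl //.
have := sum_geo_le J.+1 (ltW q0) q1.
by rewrite -(ler_pM2l (x := 1 - q)) ?subr_gt0 // divff // gt_eqF // subr_gt0.
Qed.

(** [l] is the dyadic scale of [M], or [0] when [M] is large. It trades the factor [M ^- 2] of the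
    oscillation bound for [4 ^ l]. *)
Lemma dyadic_scale (j : nat) (M : R) : (2 ^+ j)^-1 <= M ->
  exists2 l, (l <= j)%N & (M <= 2 / 2 ^+ l \/ l = 0) /\ 1 <= 4 ^+ l * M ^+ 2.
Proof.
elim: j => [|j IH] hM.
  exists 0 => //; split; first by right.
  by rewrite expr0 mul1r expr2 -[1]mulr1 ler_pM //; move: hM; rewrite expr0 invr1.
have [/IH[l lj h]|hlt] := lerP (2 ^+ j)^-1 M; first by exists l => //; exact: leqW.
have p2 : 0 < 2 ^+ j :> R by rewrite exprn_gt0.
exists j.+1 => //; split.
  by left; apply: ltW; apply: lt_le_trans hlt _; rewrite exprS invfM mulrA divff // mul1r.
have -> : 4 ^+ j.+1 * M ^+ 2 = (2 ^+ j.+1 * M) ^+ 2.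
  by rewrite exprMn -exprM mulnC exprM; congr (_ ^+ _ * _); rewrite expr2; ring.
have h1 : 1 <= 2 ^+ j.+1 * M by rewrite mulrC -ler_pdivrMr ?exprn_gt0 // mul1r.
by rewrite expr2 -[leLHS]mulr1 ler_pM.
Qed.

End GeometricSums.

(** * The mass of matched pairs: [L^2] bound, sup bound and summation over the scales *)

Section Correlations.
Context {R : realType} {S : finType} (mu u v : S -> R) (kx ky : S -> int) (n : int -> int).
Context (J : nat) (A K : R).

Let eps : R := (2 ^+ J)^-1.
(** The step [1 / H] of the factors and offsets is [eps ^ 3], much finer than [eps]: this gives
    [(2 ^ j) ^ 3 <= H] at every scale, as [osc_bound] demands. In units of [1 / H], the length
    [2 ^- j] is [L j]. *)
Let H := (2 ^ (3 * J))%N.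
Let L j := (2 ^ (3 * J - j))%N.

(** With logarithmic keys and slopes: the mass of the pairs in a common strip of width about [eps]
    whose distance is [O(2 ^- l)]. The constant [8] is what the bounds [4 M] and [M <= 2 / 2 ^ l] of
    [osc_pair] require. *)
Definition close_mass (w : S -> R) (k : S -> int) (l : nat) : R :=
  \sum_x \sum_x' (k x == k x')%:R * (`|w x - w x'| <= 8 / 2 ^+ l)%R%:R * (mu x * mu x').

Hypothesis J_gt0 : (0 < J)%N.
Hypothesis mu_ge0 : forall x, 0 <= mu x.
Hypothesis u_le2 : forall x, `|u x| <= 2.
Hypothesis v_le2 : forall x, `|v x| <= 2.
Hypothesis A_gt : 2^-1 < A.
Hypothesis A_lt : A < 1.
Hypothesis K_gt0 : 0 < K.
Hypothesis NX : forall l, (l <= J)%N -> close_mass u kx l <= K * eps * A ^+ l.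
Hypothesis NY : forall l, (l <= J)%N -> close_mass v ky l <= K * eps * A ^+ l.

(** Both positions are in units of [1 / H]: the slope [u] multiplied by the factor [m / H], and the
    slope [v]. *)
Definition pos_x (m : int) (x : S) : int := Num.floor (m%:~R * u x).
Definition pos_y (y : S) : int := Num.floor (H%:R * v y).

(* Mass of the pairs matched at scale [2 ^- j] by a chart transition: [m / H] is the factor of the
   affine map of the slopes, [g / H] its offset, and [n m] the translation of the keys. *)
Definition Lam (j : nat) (m g : int) : R :=
  corr mu (fun x => kx x + n m) ky (L j) (pos_x m) pos_y g.

Let A0 : 0 < A. Proof. by apply: lt_trans A_gt; rewrite invr_gt0. Qed.
Let H_gt0 : (0 < H)%N. Proof. by rewrite expn_gt0. Qed.
Let L_gt0 j : (0 < L j)%N. Proof. by rewrite expn_gt0. Qed.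
Let HLD j : (j <= J)%N -> H = (L j * 2 ^ j)%N.
Proof. by move=> jJ; rewrite -expnD subnK //; lia. Qed.
Let HD3 j : (j <= J)%N -> ((2 ^ j) ^ 3 <= H)%N.
Proof. by move=> jJ; rewrite -expnM leq_exp2l // mulnC leq_mul2l. Qed.

Lemma floor_diff (a b : R) : `|(Num.floor a - Num.floor b)%:~R - (a - b)| <= 1.
Proof.
have := floor_le a; have := floorD1_gt a; have := floor_le b; have := floorD1_gt b.
by rewrite rmorphB !rmorphD /= ler_norml => *; apply/andP; split; lra.
Qed.

Lemma floor_abs_le (a : R) (B : nat) : `|a| <= B%:R -> `|Num.floor a| <= B%:Z.
Proof.
rewrite ler_norml => /andP[h1 h2].
have h3 : - B%:Z <= Num.floor a by rewrite floor_ge_int rmorphN /=.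
have h4 : Num.floor a <= B%:Z.
  by rewrite -(ler_int R); apply: le_trans (floor_le _) _.
by rewrite ler_norml h3 h4.
Qed.

Lemma pos_bound m x y : hat H m != 0 :> R ->
  `|pos_x m x| <= (3 * H)%N%:Z /\ `|pos_y y| <= (3 * H)%N%:Z.
Proof.
move=> /(hat_supp H_gt0)[h1 h2].
have H0 : 0 < H%:R :> R by rewrite ltr0n.
split; apply: floor_abs_le; rewrite normrM natrM.
  apply: le_trans (_ : (3 / 2 * H%:R) * 2 <= _); last by lra.
  by apply: ler_pM => //; rewrite ger0_norm; lra.
rewrite normr_nat mulrC; apply: ler_pM => //.
by apply: le_trans (v_le2 _) _; lra.
Qed.

(** [osc_bound] is applied with [P = u x - u x'] and [Q] close to [H * (v y - v y')]. Either [Q] is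
    so large that every term vanishes, or [|v y - v y'| <= 4 M] with [M = max (2 ^- j) |P|]. In the
    latter case both differences are at most [8 / 2 ^ l] for the dyadic scale [l] of [M], and the
    single term [l] of the sum suffices. *)
Lemma osc_pair (j : nat) (x x' y y' : S) : (j <= J)%N ->
  `|zsum (8 * H) (fun m => hat H m *
      tent2 (L j) (pos_x m x - pos_x m x' + (pos_y y - pos_y y')) : R)|
  <= 4000 * (H%:R ^+ 2 / 8 ^+ j) * \sum_(l < j.+1) 4 ^+ l *
     ((`|u x - u x'| <= 8 / 2 ^+ l)%R%:R * (`|v y - v y'| <= 8 / 2 ^+ l)%R%:R).
Proof.
move=> jJ; set P := u x - u x'; set V := v y - v y'.
pose M := Num.max (2 ^ j)%N%:R^-1 `|P|.
pose Q : R := (pos_y y - pos_y y')%:~R.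
pose z m := pos_x m x - pos_x m x' + (pos_y y - pos_y y').
have H0 : 0 < H%:R :> R by rewrite ltr0n.
have p2 : 0 < 2 ^+ j :> R by rewrite exprn_gt0.
have hz m : `|(z m)%:~R - (m%:~R * P + Q)| <= 1.
  rewrite /z rmorphD /= -/Q.
  have -> (a b : R) : a + Q - (b + Q) = a - b by ring.
  by rewrite /P mulrBr; exact: floor_diff.
have P4 : `|P| <= 4.
  by apply: le_trans (ler_normB _ _) _; have := u_le2 x; have := u_le2 x'; lra.
have V4 : `|V| <= 4.
  by apply: le_trans (ler_normB _ _) _; have := v_le2 y; have := v_le2 y'; lra.
have eM : (2 ^ j)%N%:R^-1 = (2 ^+ j)^-1 :> R by rewrite natrX.
have M1 : (2 ^+ j)^-1 <= M by rewrite /M le_max eM lexx.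
have M2 : `|P| <= M by rewrite /M le_max lexx orbT.
have rhs0 : 0 <= 4000 * (H%:R ^+ 2 / 8 ^+ j) :> R.
  by rewrite mulr_ge0 ?ler0n ?divr_ge0 ?exprn_ge0.
have sum0 : 0 <= \sum_(l < j.+1) 4 ^+ l *
     ((`|P| <= 8 / 2 ^+ l)%R%:R * (`|V| <= 8 / 2 ^+ l)%R%:R) :> R.
  by apply: sumr_ge0 => l _; rewrite !mulr_ge0 ?exprn_ge0.
have eL : (L j)%:R = H%:R / 2 ^+ j :> R.
  by rewrite (HLD jJ) natrM natrX mulfK // gt_eqF.
case: (lerP (2 * (L j)%:R + 1 + 3 / 2 * H%:R * `|P|) `|Q|) => hQ.
  rewrite /zsum big1 ?normr0; first by rewrite mulr_ge0.
  by move=> i _; exact: hat_tent2_eq0 hz hQ.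
apply: le_trans (osc_bound (L_gt0 j) _ (HLD jJ) (HD3 jJ) P4 hz (erefl M)) _.
  by rewrite expn_gt0.
have M0 : 0 < M by apply: lt_le_trans M1; rewrite invr_gt0.
rewrite -mulrA ler_pM2l ?ltr0n // natrX -exprM mulnC exprM.
rewrite (_ : 2 ^+ 3 = 8 :> R); last by ring.
have e8 : 0 < 8 ^+ j :> R by rewrite exprn_gt0.
rewrite invfM mulrA ler_pM2l; last by rewrite divr_gt0 // exprn_gt0.
have [l lj [h1 h2]] := dyadic_scale M1.
have hV : `|V| <= 4 * M.
  have hQ1 : `|Q - H%:R * V| <= 1 by rewrite /Q /V mulrBr; exact: floor_diff.
  have hHV : H%:R * `|V| <= 2 * (L j)%:R + 2 + 3 / 2 * H%:R * `|P|.
    have -> : H%:R * `|V| = `|H%:R * V| by rewrite normrM normr_nat.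
    have := ler_normB Q (Q - H%:R * V).
    have -> : Q - (Q - H%:R * V) = H%:R * V by ring.
    lra.
  rewrite -(ler_pM2l H0); apply: le_trans hHV _.
  have t1 : H%:R * `|P| <= H%:R * M by rewrite ler_pM2l.
  have t2 : (L j)%:R <= H%:R * M by rewrite eL ler_pM2l.
  have t3 : 4 <= H%:R * M.
    apply: le_trans (_ : H%:R / 2 ^+ j <= _); last by rewrite ler_pM2l.
    have j2 : (2 <= 3 * J - j)%N by move: J_gt0 jJ; clear; lia.
    by rewrite -eL /L -[leLHS]/((2 ^ 2)%N%:R) ler_nat leq_exp2l.
  lra.
have hPV : (`|P| <= 8 / 2 ^+ l) && (`|V| <= 8 / 2 ^+ l).
  case: h1 => [h1|->]; last first.
    by rewrite expr0 divr1 (le_trans P4) ?(le_trans V4) // ler_nat.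
  have q2 : 0 < (2 ^+ l)^-1 :> R by rewrite invr_gt0 exprn_gt0.
  apply/andP; split.
    by apply: le_trans (le_trans M2 h1) _; rewrite ler_pM2r // ler_nat.
  by apply: le_trans hV _; apply: le_trans (ler_wpM2l (ler0n _ 4) h1) _; rewrite mulrA -natrM.
rewrite (bigD1 (Ordinal (lj : (l < j.+1)%N))) //=.
move/andP: hPV => [-> ->]; rewrite !mulr1.
apply: le_trans (_ : 4 ^+ l <= _).
  by rewrite -[leLHS]mul1r ler_pdivrMr ?exprn_gt0.
rewrite lerDl; apply: sumr_ge0 => i _.
by rewrite !mulr_ge0 ?exprn_ge0.
Qed.

(** For each proximity scale [l] the quadruples factor into a pair [x, x'] and a pair [y, y'], which
    gives a product of two [close_mass]. As [4 A ^ 2 > 1], the sum of [(4 A ^ 2) ^ l] is dominated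
    by [l = j], and [(4 A ^ 2) ^ j / 8 ^ j = (A ^ 2 / 2) ^ j]. *)
Lemma Lam_sqr_le j : (j <= J)%N ->
  zsum (8 * H) (fun m => hat H m *
    zsum (16 * H) (fun g => (Lam j m g - Lam j m (g - (L j)%:Z)) ^+ 2))
  <= 4000 * (4 * A ^+ 2 / (4 * A ^+ 2 - 1)) *
     (K ^+ 2 * eps ^+ 2 * H%:R ^+ 2 * (A ^+ 2 / 2) ^+ j).
Proof.
move=> jJ.
pose same (a b : S * S) := (kx a.1 == kx b.1) && (ky a.2 == ky b.2).
pose w (a b : S * S) := (mu a.1 * mu a.2) * (mu b.1 * mu b.2).
have w0 a b : 0 <= w a b by rewrite !mulr_ge0.
pose t m (a b : S * S) : R :=
  tent2 (L j) (pos_x m a.1 - pos_x m b.1 + (pos_y a.2 - pos_y b.2)).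
have h1 : zsum (8 * H) (fun m => hat H m *
    zsum (16 * H) (fun g => (Lam j m g - Lam j m (g - (L j)%:Z)) ^+ 2))
  <= \sum_(a : S * S) \sum_(b : S * S) (same a b)%:R * w a b *
       `|zsum (8 * H) (fun m => hat H m * t m a b)|.
  apply: le_trans (_ : zsum (8 * H) (fun m => hat H m *
     (\sum_(a : S * S) \sum_(b : S * S) (same a b)%:R * w a b * t m a b)) <= _).
    apply: ler_zsum => m.
    have [->|hm] := eqVneq (hat H m : R) 0; first by rewrite !mul0r.
    apply: ler_wpM2l; first exact: hat_ge0.
    (* The translation [n m] moves the keys of [x] and [x'] alike and drops out. Only [tent2] and
       the weight [hat] still depend on [m], so the average over [m] can be taken inside. *)
    have -> : \sum_(a : S * S) \sum_(b : S * S) (same a b)%:R * w a b * t m a b =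
      \sum_(a : S * S) \sum_(b : S * S)
        ((kx a.1 + n m == kx b.1 + n m) && (ky a.2 == ky b.2))%:R *
         ((mu a.1 * mu a.2) * (mu b.1 * mu b.2)) * t m a b.
      apply: eq_bigr => a _; apply: eq_bigr => b _.
      by rewrite (inj_eq (addIr _)).
    apply: (@corr_sqr_le _ _ _ _ _ _ _ (3 * H)) => [x|y|].
    - by have [] := pos_bound x x hm.
    - by have [] := pos_bound y y hm.
    - by have := HLD jJ; have : (0 < 2 ^ j)%N by [rewrite expn_gt0]; nia.
  rewrite (eq_zsum _ (G := fun m => \sum_(a : S * S) \sum_(b : S * S)
     (same a b)%:R * w a b * (hat H m * t m a b))); last first.
    move=> m; rewrite mulr_sumr; apply: eq_bigr => a _; rewrite mulr_sumr.
    by apply: eq_bigr => b _; ring.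
  rewrite exchange_zsum; apply: ler_sum => a _; rewrite exchange_zsum.
  apply: ler_sum => b _; rewrite zsumZ; apply: ler_wpM2l; last exact: ler_norm.
  by rewrite mulr_ge0.
apply: le_trans h1 _.
pose X : R := 4000 * (H%:R ^+ 2 / 8 ^+ j).
have X0 : 0 <= X by rewrite mulr_ge0 ?ler0n ?divr_ge0 ?exprn_ge0.
pose ci (f : S -> R) l x x' : R := (`|f x - f x'| <= 8 / 2 ^+ l)%R%:R.
apply: le_trans (_ : \sum_(a : S * S) \sum_(b : S * S) (same a b)%:R * w a b *
   (X * \sum_(l < j.+1) 4 ^+ l * (ci u l a.1 b.1 * ci v l a.2 b.2)) <= _).
  apply: ler_sum => a _; apply: ler_sum => b _; apply: ler_wpM2l.
    by rewrite mulr_ge0.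
  exact: osc_pair.
have -> : \sum_(a : S * S) \sum_(b : S * S) (same a b)%:R * w a b *
   (X * \sum_(l < j.+1) 4 ^+ l * (ci u l a.1 b.1 * ci v l a.2 b.2)) =
   X * \sum_(l < j.+1) 4 ^+ l * (close_mass u kx l * close_mass v ky l).
  rewrite mulr_sumr.
  transitivity (\sum_(a : S * S) \sum_(b : S * S) \sum_(l < j.+1)
      X * (4 ^+ l * (((kx a.1 == kx b.1)%:R * ci u l a.1 b.1 * (mu a.1 * mu b.1)) *
         ((ky a.2 == ky b.2)%:R * ci v l a.2 b.2 * (mu a.2 * mu b.2))))).
    apply: eq_bigr => a _; apply: eq_bigr => b _; rewrite !mulr_sumr.
    by apply: eq_bigr => l _; rewrite /same /w -mulnb natrM; ring.
  under eq_bigr => a _ do rewrite exchange_big.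
  rewrite exchange_big; apply: eq_bigr => l _.
  under eq_bigr => a _ do rewrite -mulr_sumr.
  rewrite -mulr_sumr; congr (_ * _).
  under eq_bigr => a _ do rewrite -mulr_sumr.
  rewrite -mulr_sumr; congr (_ * _).
  rewrite /close_mass [RHS]big_distrlr [RHS]pair_big /=; apply: eq_bigr => a _.
  by rewrite [RHS]big_distrlr [RHS]pair_big /=; apply: eq_bigr => b _.
apply: le_trans (_ : X * \sum_(l < j.+1) (K * eps) ^+ 2 * (4 * A ^+ 2) ^+ l <= _).
  apply: ler_wpM2l => //; apply: ler_sum => l _.
  have lJ : (l <= J)%N by apply: leq_trans jJ; rewrite -ltnS.
  have -> : (K * eps) ^+ 2 * (4 * A ^+ 2) ^+ l =
      4 ^+ l * ((K * eps * A ^+ l) * (K * eps * A ^+ l)).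
    by rewrite [(4 * _) ^+ l]exprMn -exprM (mulnC 2%N) exprM; ring.
  apply: ler_wpM2l; first exact: exprn_ge0.
  have cm0 f k : 0 <= close_mass f k l.
    by do 2! apply: sumr_ge0 => ? _; rewrite !mulr_ge0.
  by apply: ler_pM => //; [exact: NX|exact: NY].
rewrite -mulr_sumr.
have x1 : 1 < 4 * A ^+ 2.
  have : 2^-1 * 2^-1 < A * A by apply: ltr_pM => //; rewrite invr_ge0.
  rewrite -invfM expr2 => h.
  have : (2 * 2)^-1 * 4 < A * A * 4 :> R by rewrite ltr_pM2r.
  by lra.
have := sum_geo_gt1_le j x1; set G := \sum_(i < _) _ => hG.
have KE : 0 <= (K * eps) ^+ 2 by exact: sqr_ge0.
have := ler_wpM2l X0 (ler_wpM2l KE hG).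
move/le_trans; apply; rewrite le_eqVlt; apply/orP; left; apply/eqP.
rewrite /X exprMn [(4 * _ ) ^+ j]exprMn [(_ / 2) ^+ j]exprMn [2^-1 ^+ j]exprVn.
have -> : 8 ^+ j = 4 ^+ j * 2 ^+ j :> R by rewrite -exprMn; congr (_ ^+ _); ring.
have p4 : 4 ^+ j != 0 :> R by rewrite expf_neq0 // pnatr_eq0.
have p2 : 2 ^+ j != 0 :> R by rewrite expf_neq0 // pnatr_eq0.
have x2 : 4 * A ^+ 2 - 1 != 0 by rewrite subr_eq0 gt_eqF.
move: eps (4 ^+ j) (2 ^+ j) ((A ^+ 2) ^+ j) (A ^+ 2) p4 p2 x2 => e a b c d p4 p2 x2.
by field; rewrite p4 p2 x2.
Qed.

(** Cut the positions into cells of length [L j]. A match puts the cell of [x] at that of [y] or at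
    the next one. In either case [key_sum_le], applied to the key together with the cell, leaves
    pairs on one side that share both, and these are counted by [close_mass] at scale [j]. *)
Lemma Lam_le j m g : (j <= J)%N -> hat H m != 0 :> R -> Lam j m g <= 2 * (K * eps * A ^+ j).
Proof.
move=> jJ /(hat_supp H_gt0)[hm1 hm2].
have H0 : 0 < H%:R :> R by rewrite ltr0n.
have eL : (L j)%:R = H%:R / 2 ^+ j :> R.
  by rewrite (HLD jJ) natrM natrX mulfK // gt_eqF // exprn_gt0.
have L0 : (0 : int) < (L j)%:Z by have := L_gt0 j; lia.
have L1 : 1 <= (L j)%:R :> R by rewrite ler1n.
pose ax x : int := ((g + pos_x m x) %/ (L j)%:Z)%Z.
pose by_ y : int := (pos_y y %/ (L j)%:Z)%Z.
have key (e : int) : (\sum_x \sum_y ((kx x + n m, ax x) == (ky y,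
  by_ y + e))%:R * (mu x * mu y)) *+ 2
    <= (K * eps * A ^+ j) *+ 2.
  apply: le_trans (key_sum_le (fun x => (kx x + n m, ax x)) (fun y => (ky y, by_ y + e)) mu mu) _.
  rewrite mulr2n; apply: lerD.
    apply: le_trans (NX jJ); apply: ler_sum => x _; apply: ler_sum => x' _.
    apply: ler_wpM2r; first by rewrite mulr_ge0.
    rewrite -natrM mulnb ler_nat xpair_eqE (inj_eq (addIr _)).
    case: eqP => //= _; case: eqP => //= hax.
    suff -> : `|u x - u x'| <= 8 / 2 ^+ j by [].
    have hp : `|pos_x m x - pos_x m x'| < (L j)%:Z.
      have d1 := divz_eq (g + pos_x m x) (L j)%:Z; have d2 := divz_eq (g + pos_x m x') (L j)%:Z.
      rewrite -/(ax x) hax in d1; rewrite -/(ax x') in d2.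
      have r1 := ltz_pmod (g + pos_x m x) L0; have r2 := ltz_pmod (g + pos_x m x') L0.
      have r3 := modz_ge0 (g + pos_x m x) (lt0r_neq0 L0).
      have r4 := modz_ge0 (g + pos_x m x') (lt0r_neq0 L0).
      by move: d1 d2 r1 r2 r3 r4; clear; lia.
    have hf := floor_diff (m%:~R * u x) (m%:~R * u x').
    have hpR : `|(pos_x m x - pos_x m x')%:~R| <= (L j)%:R :> R.
      by rewrite -intr_norm -[(L j)%:R]/((L j)%:Z%:~R) ler_int ltW.
    have : `|m%:~R * u x - m%:~R * u x'| <= (L j)%:R + 1.
      have := ler_normB (pos_x m x - pos_x m x')%:~R ((pos_x m x - pos_x m x')%:~R
        - (m%:~R * u x - m%:~R * u x')).
      have -> (a b : R) : a - (a - b) = b by ring.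
      rewrite /pos_x in hf hpR *; lra.
    rewrite -mulrBr normrM => h.
    have : H%:R / 2 * `|u x - u x'| <= 2 * (L j)%:R.
      apply: le_trans (_ : `|m%:~R| * `|u x - u x'| <= _); last by lra.
      by apply: ler_wpM2r => //; rewrite ger0_norm; lra.
    have -> : 2 * (L j)%:R = H%:R / 2 * (4 / 2 ^+ j) :> R by rewrite eL; field;
      rewrite gt_eqF // exprn_gt0.
    rewrite ler_pM2l; last by lra.
    have : 0 < (2 ^+ j)^-1 :> R by rewrite invr_gt0 exprn_gt0.
    lra.
  apply: le_trans (NY jJ); apply: ler_sum => y _; apply: ler_sum => y' _.
  apply: ler_wpM2r; first by rewrite mulr_ge0.
  rewrite -natrM mulnb ler_nat xpair_eqE (inj_eq (addIr _)).
  case: eqP => //= _; case: eqP => //= hby.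
  suff -> : `|v y - v y'| <= 8 / 2 ^+ j by [].
  have hp : `|pos_y y - pos_y y'| < (L j)%:Z.
    have d1 := divz_eq (pos_y y) (L j)%:Z; have d2 := divz_eq (pos_y y') (L j)%:Z.
    rewrite -/(by_ y) hby in d1; rewrite -/(by_ y') in d2.
    have r1 := ltz_pmod (pos_y y) L0; have r2 := ltz_pmod (pos_y y') L0.
    have r3 := modz_ge0 (pos_y y) (lt0r_neq0 L0).
    have r4 := modz_ge0 (pos_y y') (lt0r_neq0 L0).
    by move: d1 d2 r1 r2 r3 r4; clear; lia.
  have hf := floor_diff (H%:R * v y) (H%:R * v y').
  have hpR : `|(pos_y y - pos_y y')%:~R| <= (L j)%:R :> R.
    by rewrite -intr_norm -[(L j)%:R]/((L j)%:Z%:~R) ler_int ltW.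
  have : `|H%:R * v y - H%:R * v y'| <= (L j)%:R + 1.
    have := ler_normB (pos_y y - pos_y y')%:~R ((pos_y y - pos_y y')%:~R - (H%:R * v y
      - H%:R * v y')).
    have -> (a b : R) : a - (a - b) = b by ring.
    rewrite /pos_y in hf hpR *; lra.
  rewrite -mulrBr normrM normr_nat => h.
  have : H%:R * `|v y - v y'| <= H%:R * (2 / 2 ^+ j).
    apply: le_trans h _; rewrite (_ : H%:R * _ = 2 * (L j)%:R) ?eL; last by ring.
    by move: L1; rewrite eL; lra.
  rewrite ler_pM2l //.
  have : 0 < (2 ^+ j)^-1 :> R by rewrite invr_gt0 exprn_gt0.
  lra.
have k0 := key 0; have k1 := key 1.
rewrite ler_pMn2r // in k0; rewrite ler_pMn2r // in k1.
apply: le_trans (_ : (\sum_x \sum_y ((kx x + n m, ax x) == (ky y, by_ y + 0))%:R * (mu x * mu y)) +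
  (\sum_x \sum_y ((kx x + n m, ax x) == (ky y, by_ y + 1))%:R * (mu x * mu y)) <= _); last by lra.
rewrite -big_split; apply: ler_sum => x _; rewrite -big_split; apply: ler_sum => y _ /=.
rewrite -mulrDl mulrAC; apply: ler_wpM2r; first by rewrite mulr_ge0.
rewrite /box -natrM -natrD ler_nat !xpair_eqE.
case: eqP => //= _; rewrite mul1n.
case: (boolP (_ && _)) => //= /andP[b1 b2].
have d1 := divz_eq (g + pos_x m x) (L j)%:Z; have d2 := divz_eq (pos_y y) (L j)%:Z.
rewrite -/(ax x) in d1; rewrite -/(by_ y) in d2.
have r1 := ltz_pmod (g + pos_x m x) L0; have r2 := ltz_pmod (pos_y y) L0.
have r3 := modz_ge0 (g + pos_x m x) (lt0r_neq0 L0).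
have r4 := modz_ge0 (pos_y y) (lt0r_neq0 L0).
have : ax x = by_ y + 0 \/ ax x = by_ y + 1.
  move: d1 d2 r1 r2 r3 r4 b1 b2 L0; clear.
  set a := ax x; set b := by_ y; set l := (L j)%:Z; set p := pos_x m x; set q := pos_y y.
  set s := (_ %% _)%Z; set r := (q %% _)%Z => *.
  have h1 : b * l < (a + 1) * l by lia.
  have h2 : a * l < (b + 2) * l by lia.
  rewrite ltr_pM2r // in h1; rewrite ltr_pM2r // in h2; lia.
by case=> ->; rewrite eqxx ?addn1 ?leq_addl //.
Qed.

Lemma box_double (l : nat) z : box (2 * l) z = box l z + box l (z - l%:Z) :> R.
Proof. by rewrite /box -natrD; congr (_%:R); lia. Qed.

Lemma Lam_double j m g : (j < J)%N ->
  Lam j m g = Lam j.+1 m g + Lam j.+1 m (g - (L j.+1)%:Z).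
Proof.
move=> jJ; rewrite /Lam /corr.
have -> : L j = (2 * L j.+1)%N.
  by rewrite /L -expnS; congr expn; move: jJ; clear; lia.
rewrite -big_split; apply: eq_bigr => x _; rewrite -big_split; apply: eq_bigr => y _ /=.
by rewrite box_double mulrDr addrAC.
Qed.

(** A Haar-type expansion: [Lam j] splits into its two halves at scale [j + 1], so the densities
    [2 ^ (J + j) * Lam j] at consecutive scales differ by a difference of the two halves. *)
Definition diff_lam (m g : int) (j : nat) : R :=
  if j is i.+1 then 2 ^+ (J + i) * (Lam j m g - Lam j m (g - (L j)%:Z))
  else 2 ^+ J * Lam 0 m g.

Lemma sum_diff_lam m g : 2 ^+ (J + J) * Lam J m g = \sum_(j < J.+1) diff_lam m g j.
Proof.
have h i : (i <= J)%N -> 2 ^+ (J + i) * Lam i m g = \sum_(j < i.+1) diff_lam m g j.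
  elim: i => [|i IH] iJ; first by rewrite big_ord1 /= addn0.
  rewrite big_ord_recr /= -IH ?(ltnW iJ) // (Lam_double m g iJ) -mulrDr addnS exprS.
  by rewrite -mulrA mulrCA; congr (_ * _); ring.
exact: h.
Qed.

Lemma diff_lam_le m g j : (j <= J)%N -> hat H m != 0 :> R ->
  `|diff_lam m g j| <= 2 * K * (2 * A) ^+ j.
Proof.
move=> jJ hm; have L0 i g' : 0 <= Lam i m g' by exact: corr_ge0.
have p2 i : 0 < 2 ^+ i :> R by rewrite exprn_gt0.
case: j jJ => [|i] iJ /=.
  rewrite ger0_norm ?(mulr_ge0 (ltW (p2 J))) // expr0 mulr1.
  have := Lam_le g iJ hm; rewrite expr0 mulr1 /eps.
  move=> /(ler_wpM2l (ltW (p2 J))).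
  suff -> : 2 ^+ J * (2 * (K / 2 ^+ J)) = 2 * K by [].
  by field; rewrite gt_eqF.
have h1 := Lam_le g iJ hm; have h2 := Lam_le (g - (L i.+1)%:Z) iJ hm.
have h3 := L0 i.+1 g; have h4 := L0 i.+1 (g - (L i.+1)%:Z).
rewrite normrM [`|2 ^+ _|](ger0_norm (ltW (p2 _))).
apply: le_trans (_ : 2 ^+ (J + i) * (2 * (K * eps * A ^+ i.+1)) <= _).
  by rewrite ler_pM2l // ler_norml; apply/andP; split; lra.
rewrite /eps exprD [(2 * A) ^+ _]exprMn.
have -> : 2 ^+ J * 2 ^+ i * (2 * (K * 2 ^- J * A ^+ i.+1)) = K * (2 ^+ i.+1 * A ^+ i.+1).
  by rewrite exprS [2 ^+ i.+1]exprS; field; rewrite gt_eqF.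
apply: ler_wpM2r; first by nneg.
by move: K_gt0; lra.
Qed.

(** Here [k.+2] is the number of points. The weights [(1 - q) * q ^ j] separate the scales by
    pigeonhole; at each positive scale [k] factors are bounded by [diff_lam_le] and two by
    [Lam_sqr_le], so the series is geometric of ratio [2 ^ (k + 1) * A ^ (k + 2) / q ^ (k + 2)]. *)
Lemma Lam_pow_le (k : nat) (q : R) : 0 < q -> q < 1 ->
  2 ^+ k.+1 * A ^+ k.+2 < q ^+ k.+2 ->
  zsum (8 * H) (fun m => hat H m * zsum (16 * H) (fun g => Lam J m g ^+ k.+2)) <=
  (512 * (2 / (1 - q)) ^+ k.+2 + 1000 * (4 * A ^+ 2 / (4 * A ^+ 2 - 1)) * 2 ^+ k
     / (1 - q) ^+ k.+2 / (1 - 2 ^+ k.+1 * A ^+ k.+2 / q ^+ k.+2))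
  * (K ^+ k.+2 * H%:R ^+ 2 * (eps ^+ 2) ^+ k.+2).
Proof.
move=> q0 q1 hq.
pose w j := (1 - q) * q ^+ j.
have w0 j : 0 < w j by rewrite mulr_gt0 ?exprn_gt0 ?subr_gt0.
have p2 i : 0 < 2 ^+ i :> R by rewrite exprn_gt0.
have e0 : 0 < eps by rewrite invr_gt0.
have L0 j m g : 0 <= Lam j m g by exact: corr_ge0.
have H0 : 0 < H%:R :> R by rewrite ltr0n.
pose Z j := zsum (8 * H) (fun m => hat H m *
   zsum (16 * H) (fun g => (`|diff_lam m g j| / w j) ^+ k.+2)).
have hpt m g : Lam J m g ^+ k.+2 <= (eps ^+ 2) ^+ k.+2 *
    \sum_(j < J.+1) (`|diff_lam m g j| / w j) ^+ k.+2.
  have -> : Lam J m g = eps ^+ 2 * (2 ^+ (J + J) * Lam J m g).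
    by rewrite /eps exprD; field; rewrite gt_eqF.
  rewrite exprMn ler_pM2l ?exprn_gt0 //.
  have := sum_expn_le k.+2 J.+1 q0 q1 (fun j => normr_ge0 (diff_lam m g j)).
  rewrite /= addr0; apply: le_trans; apply: lerXn2r; rewrite ?nnegrE.
  - by rewrite mulr_ge0 // ltW.
  - exact: sumr_ge0.
  by rewrite sum_diff_lam; apply: ler_sum => j _; exact: ler_norm.
have h1 : zsum (8 * H) (fun m => hat H m * zsum (16 * H) (fun g => Lam J m g ^+ k.+2)) <=
    (eps ^+ 2) ^+ k.+2 * \sum_(j < J.+1) Z j.
  have -> : \sum_(j < J.+1) Z j = zsum (8 * H) (fun m => \sum_(j < J.+1) hat H m *
     zsum (16 * H) (fun g => (`|diff_lam m g j| / w j) ^+ k.+2)) by rewrite exchange_zsum.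
  rewrite -zsumZ.
  apply: ler_zsum => m; rewrite -mulr_sumr mulrCA; apply: ler_wpM2l; first exact: hat_ge0.
  by rewrite -exchange_zsum -zsumZ; apply: ler_zsum => g; exact: hpt.
apply: le_trans h1 _.
set th := 2 ^+ k.+1 * A ^+ k.+2 / q ^+ k.+2.
have th0 : 0 <= th by rewrite /th; nneg.
have th1 : th < 1 by rewrite ltr_pdivrMr ?exprn_gt0 // mul1r.
set cA := 4 * A ^+ 2 / (4 * A ^+ 2 - 1).
have cA0 : 0 <= cA.
  have : 2^-1 * 2^-1 < A * A by apply: ltr_pM => //; rewrite invr_ge0.
  rewrite -invfM => h.
  have h2 : (2 * 2)^-1 * 4 < A * A * 4 :> R by rewrite ltr_pM2r.
  by rewrite /cA expr2 divr_ge0 //; [have := mulr_gt0 A0 A0|]; lra.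
(* Scale [0] carries no increment: the sup bound is summed over the [16 H * 32 H] pairs [(m, g)] in
   the windows. *)
have Z0 : Z 0 <= 512 * (2 / (1 - q)) ^+ k.+2 * (K ^+ k.+2 * H%:R ^+ 2).
  apply: le_trans (_ : zsum (8 * H) (fun=> zsum (16 * H) (fun=> (2 * K / (1 - q)) ^+ k.+2)) <= _).
    apply: ler_zsum => m; have [->|hm] := eqVneq (hat H m : R) 0.
      by rewrite mul0r; apply: zsum_ge0 => z; nneg.
    apply: le_trans (ler_piMl _ (hat_le1 _ _)) _.
      by apply: zsum_ge0 => g; rewrite exprn_ge0 // divr_ge0 // ltW.
    apply: ler_zsum => g; apply: lerXn2r; rewrite ?nnegrE.
    - by rewrite divr_ge0 // ltW.
    - by nneg.
    rewrite /w expr0 mulr1 ler_pM2r ?invr_gt0 ?subr_gt0 //.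
    by have := diff_lam_le g (leq0n J) hm; rewrite expr0 mulr1.
  rewrite !zsum_cst -!mul2n !natrM (_ : 2 * K / (1 - q) = 2 / (1 - q) * K); last by rewrite mulrAC.
  rewrite [(_ * K) ^+ _]exprMn le_eqVlt; apply/orP; left; apply/eqP.
  by move: ((2 / (1 - q)) ^+ k.+2) (K ^+ k.+2) (H%:R : R) => a b c; ring.
(* The constant is [4000 / 4]: the increment at scale [i.+1] is normalized by [2 ^ (J + i)], which
   is squared. *)
have ZS i : (i < J)%N -> Z i.+1 <= 1000 * cA * 2 ^+ k / (1 - q) ^+ k.+2 *
     (K ^+ k.+2 * H%:R ^+ 2) * th ^+ i.+1.
  move=> iJ; set j := i.+1.
  apply: le_trans (_ : zsum (8 * H) (fun m => hat H m * zsum (16 * H) (fun g =>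
     ((2 * K * (2 * A) ^+ j) ^+ k * (2 ^+ (J + i)) ^+ 2 / w j ^+ k.+2) *
       (Lam j m g - Lam j m (g - (L j)%:Z)) ^+ 2)) <= _).
    apply: ler_zsum => m; have [->|hm] := eqVneq (hat H m : R) 0; first by rewrite !mul0r.
    apply: ler_wpM2l; first exact: hat_ge0.
    apply: ler_zsum => g.
    set X := 2 * K * (2 * A) ^+ j; set E := 2 ^+ (J + i); set T := Lam j m g - _.
    have e : `|diff_lam m g j| ^+ 2 = E ^+ 2 * T ^+ 2.
      by rewrite real_normK ?num_real // -exprMn.
    have -> : (`|diff_lam m g j| / w j) ^+ k.+2 =
        `|diff_lam m g j| ^+ k * (E ^+ 2 * T ^+ 2) / w j ^+ k.+2.
      by rewrite expr_div_n -e -exprD addn2.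
    have -> (a b c d : R) : a * b / c * d = a * (b * d) / c by ring.
    have w1 : 0 <= (w j ^+ k.+2)^-1 by rewrite invr_ge0 exprn_ge0 // ltW.
    apply: ler_wpM2r => //; apply: ler_wpM2r; first by rewrite mulr_ge0 // exprn_even_ge0.
    apply: lerXn2r; rewrite ?nnegrE //; first by rewrite /X; nneg.
    exact: diff_lam_le.
  rewrite (eq_zsum _ (G := fun m =>
    ((2 * K * (2 * A) ^+ j) ^+ k * (2 ^+ (J + i)) ^+ 2 / w j ^+ k.+2) *
     (hat H m * zsum (16 * H) (fun g => (Lam j m g - Lam j m (g - (L j)%:Z)) ^+ 2)))); last first.
    by move=> m; rewrite zsumZ mulrCA.
  rewrite zsumZ.
  apply: le_trans (_ : ((2 * K * (2 * A) ^+ j) ^+ k * (2 ^+ (J + i)) ^+ 2 / w j ^+ k.+2) *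
     (4000 * cA * (K ^+ 2 * eps ^+ 2 * H%:R ^+ 2 * (A ^+ 2 / 2) ^+ j)) <= _).
    apply: ler_wpM2l; last by have := Lam_sqr_le iJ.
    by rewrite /w; nneg.
  rewrite le_eqVlt; apply/orP; left; apply/eqP.
  rewrite /th /w /eps /j exprD.
  rewrite [(2 * K * _) ^+ k]exprMn [(2 * K) ^+ k]exprMn -exprM [(2 * A) ^+ _]exprMn.
  rewrite [((1 - q) * _) ^+ _]exprMn -[(q ^+ _) ^+ _]exprM.
  rewrite [(A ^+ 2 / 2) ^+ _]exprMn [2^-1 ^+ _]exprVn -[(A ^+ 2) ^+ _]exprM.
  rewrite [(_ * _ / _) ^+ i.+1]exprMn [(2 ^+ k.+1 * _) ^+ i.+1]exprMn -!exprM exprVn -exprM.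
  rewrite [q ^- k.+2 ^+ _]exprVn -[(q ^+ k.+2) ^+ _]exprM [2 ^+ (J * 2)]exprM.
  have -> : (K ^+ k.+2 = K ^+ k * K ^+ 2) by rewrite -exprD addn2.
  have -> : (i.+1 * k.+2 = k.+2 * i.+1)%N by rewrite mulnC.
  have -> : A ^+ (k.+2 * i.+1) = A ^+ (i.+1 * k) * A ^+ (2 * i.+1).
    by rewrite -exprD (mulnC _ k) -mulnDl addn2.
  have -> : (2 : R) ^+ (k.+1 * i.+1) = 2 ^+ (i.+1 * k) * (2 ^+ i * 2).
    by rewrite -exprSr -exprD (mulnC _ k) mulSn addnC.
  rewrite [2 ^+ i.+1]exprS.
  have n1 : (1 - q) ^+ k.+2 != 0 by rewrite expf_neq0 // subr_eq0 gt_eqF.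
  have n2 : q ^+ (k.+2 * i.+1) != 0 by rewrite expf_neq0 // gt_eqF.
  have n3 : (2 : R) ^+ J != 0 by rewrite gt_eqF.
  have n4 : (2 : R) ^+ i != 0 by rewrite gt_eqF.
  move: (2 ^+ (i.+1 * k)) (A ^+ (i.+1 * k)) (A ^+ (2 * i.+1)) (q ^+ (k.+2 * i.+1)) n2
    ((1 - q) ^+ k.+2) n1 (2 ^+ J) n3 (2 ^+ i) n4 (2 ^+ k) (K ^+ k) => a b c d n2 e n1 f n3 g n4 h l.
  by field; rewrite n1 n2 n3 n4.
set B := K ^+ k.+2 * H%:R ^+ 2 in Z0 ZS *.
have B0 : 0 <= B by rewrite /B; nneg.
rewrite [leRHS]mulrA [leRHS]mulrC ler_pM2l ?exprn_gt0 //.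
rewrite big_ord_recl mulrDl; apply: lerD => //.
set c1 := 1000 * cA * 2 ^+ k / (1 - q) ^+ k.+2 in ZS *.
have c10 : 0 <= c1 by rewrite /c1; nneg.
apply: le_trans (_ : \sum_(i < J) c1 * B * (th * th ^+ i) <= _).
  by apply: ler_sum => i _; rewrite -exprS; exact: ZS.
rewrite -mulr_sumr -mulr_sumr [leRHS]mulrAC; apply: ler_wpM2l; first exact: mulr_ge0.
have := sum_geo_le J th0 th1; apply: le_trans.
apply: ler_piMl; last exact: ltW th1.
by apply: sumr_ge0 => i _; nneg.
Qed.

End Correlations.

(** * Directions and charts *)

Section Counting.
Context {R : realType}.

Lemma zsum_near_le (W : nat) (c rho : R) : 0 <= rho ->
  zsum W (fun m => (`|m%:~R - c| <= rho)%R%:R) <= 2 * rho + 2.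
Proof.
move=> rho0; pose lo := Num.floor (c - rho); pose hi := Num.floor (c + rho) + 1.
have lohi : lo <= hi.
  rewrite /lo /hi (le_trans (y := Num.floor (c + rho))) ?lerDl //.
  by apply: le_floor; rewrite lerD2l; lra.
apply: le_trans (_ : (hi - lo)%:~R <= _).
  apply: le_trans (zsum_itv_le W lohi); apply: ler_zsum => m.
  case: (lerP `|m%:~R - c| rho) => hm //=.
  move: hm; rewrite ler_norml => /andP[h2 h3].
  suff : (lo <= m) && (m < hi) by move=> ->.
  apply/andP; split.
    by rewrite /lo -(ler_int R); apply: le_trans (floor_le _) _; lra.
  by rewrite /hi ltzD1 floor_ge_int; lra.
have := floorD1_gt (c - rho); have := floor_le (c + rho).
by rewrite /hi /lo rmorphB !rmorphD /=; lra.
Qed.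

Lemma zsum_near_ge (W : nat) (c rho : R) : 1 <= rho -> `|c| + rho + 1 <= W%:R ->
  rho <= zsum W (fun m => (`|m%:~R - c| <= rho)%R%:R).
Proof.
move=> rho1; rewrite -lerBrDr -lerBrDr ler_norml => /andP[hc1 hc2].
pose lo := Num.ceil (c - rho); pose hi := Num.floor (c + rho) + 1.
have c1 := ceil_ge (c - rho); have c2 := ceilB1_lt (c - rho).
have f1 := floor_le (c + rho); have f2 := floorD1_gt (c + rho).
rewrite -/lo rmorphB /= in c1 c2; rewrite rmorphD /= in f2.
have hi2 : hi%:~R = (Num.floor (c + rho))%:~R + 1 :> R by rewrite /hi rmorphD.
apply: le_trans (_ : (hi - lo)%:~R <= _); first by rewrite rmorphB /= hi2; lra.
rewrite -(@zsum_itv R W).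
- apply: ler_zsum => m; case: (boolP (_ && _)) => //= /andP[h1 h2].
  suff -> : `|m%:~R - c| <= rho by [].
  have h3 : lo%:~R <= m%:~R :> R by rewrite ler_int.
  have h4 : m%:~R <= (Num.floor (c + rho))%:~R :> R by rewrite ler_int -ltzD1.
  by rewrite ler_norml; apply/andP; split; lra.
- by rewrite -(ler_int R) rmorphN /=; rewrite -[(W%:Z)%:~R]/(W%:R : R); lra.
- by rewrite -(ler_int R) hi2; lra.
- by rewrite -(ler_int R) hi2 -[(W%:Z)%:~R]/(W%:R : R); lra.
Qed.

Lemma ord_sum_near_le (n : nat) (c rho : R) : 0 <= rho ->
  \sum_(a < n) (`|a%:R - c| <= rho)%R%:R <= 2 * rho + 2.
Proof.
move=> rho0; apply: le_trans (zsum_near_le n c rho0).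
rewrite /zsum (@big_cat_nat _ _ _ n) //=; last by rewrite -addnn leq_addr.
apply: le_trans (_ : \sum_(n <= i < n.*2) (`|(i%:Z - n%:Z)%:~R - c| <= rho)%R%:R <= _).
  rewrite -addnn -[X in index_iota X _]add0n big_addn addnK big_mkord le_eqVlt; apply/orP; left;
    apply/eqP.
  by apply: eq_bigr => i _; rewrite PoszD addrK.
by rewrite lerDr; apply: sumr_ge0.
Qed.

Lemma ln_diff_le (p q : R) : 0 < p -> 0 < q -> ln p - ln q <= (p - q) / q.
Proof.
move=> p0 q0; rewrite -ln_div ?posrE //.
have -> : p / q = 1 + (p - q) / q by field; rewrite gt_eqF.
by apply: le_ln1Dx; rewrite mulrBl divff ?gt_eqF // ltrBrDr addrC subrr divr_gt0.
Qed.

Lemma ln_near (p q b z : R) : 0 < b -> b <= p -> b <= q -> `|p - q| <= z * b ->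
  `|ln p - ln q| <= z.
Proof.
move=> b0 bp bq; have p0 := lt_le_trans b0 bp; have q0 := lt_le_trans b0 bq.
move=> h; have z0 : 0 <= z by rewrite -(pmulr_lge0 _ b0) (le_trans _ h).
move: h; rewrite ler_norml => /andP[h1 h2].
have h3 : z * b <= z * q by apply: ler_wpM2l.
have h4 : z * b <= z * p by apply: ler_wpM2l.
rewrite ler_norml lerNl opprB; apply/andP; split.
  by apply: le_trans (ln_diff_le q0 p0) _; rewrite ler_pdivrMr //; lra.
by apply: le_trans (ln_diff_le p0 q0) _; rewrite ler_pdivrMr //; lra.
Qed.

Lemma diff_le_of_ln (p q e : R) : 0 < p -> 0 < q -> ln p - ln q <= e -> p - q <= e * p.
Proof.
move=> p0 q0 h; have := ln_diff_le q0 p0.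
rewrite ler_pdivlMr // => h2.
have : (ln p - ln q) * p <= e * p by rewrite ler_pM2r.
by lra.
Qed.

Lemma sum_inj_le (I J : finType) (f : I -> J) (F : J -> R) :
  injective f -> (forall j, 0 <= F j) -> \sum_i F (f i) <= \sum_j F j.
Proof.
move=> finj F0; rewrite -(big_imset F (h := f) (A := predT)) /=; last by move=> x y _ _;
  exact: finj.
rewrite big_mkcond; apply: ler_sum => j _; case: ifP => // _.
Qed.

End Counting.

(** * Strips in a direction, and the few directions in which they carry too much mass *)

Section Directions.
Context {R : realType} {S : finType} (X Y mu : S -> R).
Context (J : nat) (R0 CF a : R) (e : nat).

Definition ell (t : R) x := X x + t * Y x.
Definition slope (t : R) x := Y x / ell t x.
Definition lkey (t : R) x := Num.floor (2 ^+ J * ln (ell t x)).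
(** For points of the sector [|Y| <= X], the range [|t| <= 1/2] keeps [ell] comparable to [X]. *)
Definition dir (n i : nat) : R := i%:R / n%:R - 2^-1.
Definition dist x x' := Num.max `|X x - X x'| `|Y x - Y x'|.

Let eps : R := (2 ^+ J)^-1.

Hypothesis mu_ge0 : forall x, 0 <= mu x.
Hypothesis mass_le1 : \sum_x mu x <= 1.
Hypothesis X_gt0 : forall x, 0 < X x.
Hypothesis YX : forall x, `|Y x| <= X x.
Hypothesis XR0 : forall x, X x <= R0.
Hypothesis R0_ge1 : 1 <= R0.
Hypothesis R0_le : 18 * R0 <= 2 ^+ e.
Hypothesis a_gt0 : 0 < a.
Hypothesis a_lt : a < 2^-1.
Hypothesis CF_ge0 : 0 <= CF.
Hypothesis ball : forall i x, (i <= J)%N ->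
  \sum_x' (dist x x' <= (2 ^+ i)^-1)%R%:R * mu x' <= CF * a ^+ i.

Lemma dist_ge0 x x' : 0 <= dist x x'.
Proof. by rewrite /dist le_max normr_ge0. Qed.

Lemma dir_le n i : (i < n)%N -> `|dir n i| <= 2^-1.
Proof.
move=> ni; have n0 : 0 < n%:R :> R by rewrite ltr0n; apply: leq_ltn_trans ni.
have h1 : 0 <= i%:R / n%:R :> R by rewrite divr_ge0.
have h2 : i%:R / n%:R <= 1 :> R by rewrite ler_pdivrMr // mul1r ler_nat ltnW.
by rewrite /dir ler_norml; apply/andP; split; lra.
Qed.

Lemma ell_ge t x : `|t| <= 2^-1 -> X x / 2 <= ell t x.
Proof.
move=> ht; have : `|t * Y x| <= 2^-1 * X x by rewrite normrM; apply: ler_pM.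
by rewrite /ell ler_norml => /andP[]; lra.
Qed.

Lemma ell_gt0 t x : `|t| <= 2^-1 -> 0 < ell t x.
Proof. by move=> ht; apply: lt_le_trans (ell_ge x ht); rewrite divr_gt0. Qed.

Lemma ell_le t x : `|t| <= 2^-1 -> ell t x <= 3 / 2 * R0.
Proof.
move=> ht; have : `|t * Y x| <= 2^-1 * X x by rewrite normrM; apply: ler_pM.
by rewrite /ell ler_norml => /andP[]; have := XR0 x; lra.
Qed.

Lemma slope_le2 t x : `|t| <= 2^-1 -> `|slope t x| <= 2.
Proof.
move=> ht; have l0 := ell_gt0 x ht.
rewrite /slope normrM normfV (gtr0_norm l0) ler_pdivrMr //.
by apply: le_trans (YX x) _; have := ell_ge x ht; lra.
Qed.

Lemma ball_scaled i x : (i <= J)%N ->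
  \sum_x' (dist x x' <= 2 ^+ e / 2 ^+ i)%R%:R * mu x' <= (CF + 1) / a ^+ e * a ^+ i.
Proof.
move=> iJ; have ae : 0 < a ^+ e by rewrite exprn_gt0.
have ai : 0 < a ^+ i by rewrite exprn_gt0.
have a1 : a <= 1 by move: a_lt; lra.
rewrite mulrAC ler_pdivlMr // .
case: (leqP e i) => ei.
  have := ball x (leq_trans (leq_subr e i) iJ).
  have -> : (2 ^+ (i - e))^-1 = 2 ^+ e / 2 ^+ i :> R.
    rewrite -{2}(subnK ei) exprD; field.
    by rewrite !expf_neq0 // pnatr_eq0.
  have -> : (CF + 1) * a ^+ i = (CF + 1) * a ^+ (i - e) * a ^+ e.
    by rewrite -mulrA -exprD subnK.
  rewrite ler_pM2r // => /le_trans; apply.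
  by rewrite ler_pM2r ?exprn_gt0 // lerDl.
(* For [i < e] the radius exceeds [1] and the ball hypothesis does not reach it; the total mass is
   used, whence the [+ 1] in the constant. *)
apply: le_trans (_ : 1 * a ^+ e <= _).
  rewrite ler_pM2r //; apply: le_trans mass_le1; apply: ler_sum => x' _.
  by rewrite -[leRHS]mul1r; apply: ler_wpM2r => //; rewrite lern1 leq_b1.
rewrite mul1r; apply: le_trans (_ : a ^+ i <= _).
  by apply: ler_wiXn2l => //; [exact: ltW|exact: ltnW].
by apply: ler_peMl; [exact: ltW|rewrite lerDr].
Qed.

(** Transversality. When [d > 4 E] and [|d1|] dominates, [|t| <= 1/2] excludes every direction; when
    [|d2| = d] dominates, [t] lies within [E / d] of one point. The hypothesis [d <= n E] absorbs
    the additive error of counting. *)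
Lemma count_dir (n : nat) (d1 d2 d E : R) : (0 < n)%N -> 0 < E ->
  d = Num.max `|d1| `|d2| -> d <= n%:R * E ->
  \sum_(i < n) (`|d1 + dir n i * d2| <= E)%R%:R <= 4 * n%:R * E / Num.max d (4 * E).
Proof.
move=> n0 E0 hd dnE; have n0' : 0 < n%:R :> R by rewrite ltr0n.
have nE : 0 < n%:R * E by rewrite mulr_gt0.
have hle1 : `|d1| <= d by rewrite hd le_max lexx.
have hle2 : `|d2| <= d by rewrite hd le_max lexx orbT.
case: (leP d (4 * E)) => hdE.
  have -> : 4 * n%:R * E / (4 * E) = n%:R by field; rewrite gt_eqF.
  apply: le_trans (_ : \sum_(i < n) 1 <= _).
    by apply: ler_sum => i _; rewrite lern1 leq_b1.
  by rewrite sumr_const card_ord.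
have d0 : 0 < d by apply: lt_trans hdE; rewrite mulr_gt0.
case: (leP `|d2| `|d1|) => h12.
  have ed : d = `|d1| by rewrite hd; apply/max_idPl.
  rewrite big1 ?divr_ge0 ?mulr_ge0 ?ltW // => i _.
  have : `|dir n i * d2| <= 2^-1 * `|d1|.
    by rewrite normrM; apply: ler_pM => //; apply: dir_le.
  have := ler_normB (d1 + dir n i * d2) (dir n i * d2).
  rewrite addrK -ed => h1 h2.
  have : E < `|d1 + dir n i * d2| by lra.
  by rewrite ltNge => /negPf ->.
have ed : d = `|d2| by rewrite hd; apply/max_idPr/ltW.
have d20 : d2 != 0 by rewrite -normr_gt0 -ed.
apply: le_trans (_ : \sum_(i < n) (`|i%:R - (2^-1 - d1 / d2) * n%:R| <= n%:R * E / d)%R%:R <= _).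
  apply: ler_sum => i _; rewrite ler_nat.
  have -> : i%:R - (2^-1 - d1 / d2) * n%:R = (d1 + dir n i * d2) * n%:R / d2.
    by rewrite /dir; field; rewrite d20 gt_eqF.
  rewrite normrM normfV -ed ler_pM2r ?invr_gt0 // normrM normr_nat [n%:R * E]mulrC.
  by rewrite ler_pM2r.
apply: le_trans (ord_sum_near_le _ _ _) _; first by rewrite divr_ge0 // ltW.
rewrite ler_pdivlMr // mulrDl mulrA divfK ?gt_eqF //; lra.
Qed.

(** A common key fixes [ell] up to [O(eps)]; once [ell] is fixed, the slope determines the point. *)
Lemma pair_near (t : R) x x' j : (j <= J)%N -> `|t| <= 2^-1 ->
  lkey t x == lkey t x' -> `|slope t x - slope t x'| <= 8 / 2 ^+ j ->
  `|ell t x - ell t x'| <= 3 * R0 * eps /\ dist x x' <= 18 * R0 / 2 ^+ j.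
Proof.
move=> jJ ht /eqP hk hs.
have l0 := ell_gt0 x ht; have l0' := ell_gt0 x' ht.
have lR := ell_le x ht; have lR' := ell_le x' ht.
have p2 : 0 < 2 ^+ J :> R by rewrite exprn_gt0.
have e0 : 0 < eps by rewrite invr_gt0.
have ej : eps <= (2 ^+ j)^-1.
  by rewrite lef_pV2 ?posrE ?exprn_gt0 // ler_eXn2l // ltr1n.
have hln : `|ln (ell t x) - ln (ell t x')| <= eps.
  have := floor_diff (2 ^+ J * ln (ell t x)) (2 ^+ J * ln (ell t x')).
  rewrite -/(lkey t x) hk subrr sub0r normrN -mulrBr normrM (gtr0_norm p2) => h.
  by rewrite /eps -[leRHS]mul1r ler_pdivlMr // mulrC.
move: hln; rewrite ler_norml => /andP[hln1 hln2].
have h1 := diff_le_of_ln l0 l0' hln2.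
have h2 : ell t x' - ell t x <= eps * ell t x' by apply: diff_le_of_ln => //; lra.
have t1 : eps * ell t x <= eps * (3 / 2 * R0) by rewrite ler_pM2l.
have t2 : eps * ell t x' <= eps * (3 / 2 * R0) by rewrite ler_pM2l.
have R00 : 0 <= R0 by move: R0_ge1; lra.
have eR : 0 <= eps * R0 by rewrite mulr_ge0 // ltW.
have hl : `|ell t x - ell t x'| <= 3 * R0 * eps.
  by rewrite ler_norml; apply/andP; split; lra.
split => //.
set dl := (2 ^+ j)^-1 in ej hs *.
have dl0 : 0 < dl by rewrite invr_gt0 exprn_gt0.
have eRd : eps * R0 <= dl * R0 by rewrite ler_wpM2r.
have hY : `|Y x - Y x'| <= 18 * R0 * dl.
  have -> : Y x - Y x' = slope t x * (ell t x - ell t x') + ell t x' * (slope t x - slope t x').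
    by rewrite /slope; field; rewrite !gt_eqF.
  apply: le_trans (ler_normD _ _) _; rewrite (normrM (slope _ _)) (normrM (ell _ _)).
  have s1 : `|slope t x| * `|ell t x - ell t x'| <= 2 * (3 * R0 * eps).
    by apply: ler_pM => //; exact: slope_le2.
  have s2 : `|ell t x'| * `|slope t x - slope t x'| <= (3 / 2 * R0) * (8 * dl).
    by apply: ler_pM => //; rewrite gtr0_norm.
  by lra.
rewrite /dist ge_max hY andbT.
have -> : X x - X x' = (ell t x - ell t x') - t * (Y x - Y x') by rewrite /ell; ring.
apply: le_trans (ler_normB _ _) _; rewrite normrM.
have : `|t| * `|Y x - Y x'| <= 2^-1 * (18 * R0 * dl) by apply: ler_pM.
by lra.
Qed.

(** The weight [1 / d] produced by [count_dir] becomes a dyadic sum of indicators, to which the ball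
    bound applies. The induction descends to the finest scale that still contains [d]. *)
Lemma inv_dist_le j (d : R) : (j <= J)%N -> 0 <= d -> d <= 18 * R0 / 2 ^+ j ->
  (Num.max d (12 * R0 * eps))^-1 <= (9 * R0)^-1 *
    \sum_(j <= i < J.+1) (d <= 18 * R0 / 2 ^+ i)%R%:R * 2 ^+ i.
Proof.
have R00 : 0 < R0 by move: R0_ge1; lra.
have p2 i : 0 < 2 ^+ i :> R by rewrite exprn_gt0.
move=> jJ d0; have [m hm] : exists m, J = (j + m)%N by exists (J - j)%N; rewrite subnKC.
elim: m j jJ hm => [|m IH] j jJ hm hd.
  have ej : j = J by rewrite hm addn0.
  rewrite ej big_nat1; rewrite ej in hd; rewrite hd mul1r.
  have M0 : 12 * R0 * eps <= Num.max d (12 * R0 * eps) by rewrite le_max lexx orbT.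
  have q0 : 0 < 12 * R0 * eps by rewrite !mulr_gt0 ?invr_gt0.
  apply: le_trans (_ : (12 * R0 * eps)^-1 <= _).
    by rewrite lef_pV2 // posrE //; apply: lt_le_trans M0.
  rewrite /eps invfM invrK ler_pM2r // lef_pV2 ?posrE ?mulr_gt0 // ler_pM2r // ler_nat //.
case: (lerP d (18 * R0 / 2 ^+ j.+1)) => hd1.
  have jJ1 : (j.+1 <= J)%N by rewrite hm addnS ltnS leq_addr.
  have hm1 : J = (j.+1 + m)%N by rewrite hm addnS.
  apply: le_trans (IH _ jJ1 hm1 hd1) _; rewrite ler_pM2l ?invr_gt0 ?mulr_gt0 //.
  by rewrite [leRHS]big_ltn ?ltnS // lerDr mulr_ge0 // ltW.
rewrite big_ltn ?ltnS // hd mul1r.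
have d1 : 9 * R0 / 2 ^+ j < d.
  by apply: le_lt_trans hd1; rewrite exprS invfM mulrA;
    have : 0 < R0 / 2 ^+ j by [rewrite divr_gt0]; lra.
have M0 : d <= Num.max d (12 * R0 * eps) by rewrite le_max lexx.
have d0' : 0 < d by apply: le_lt_trans d1; rewrite divr_ge0 ?mulr_ge0 // ltW.
apply: le_trans (_ : (9 * R0 / 2 ^+ j)^-1 <= _).
  rewrite lef_pV2 ?posrE; first by apply: le_trans M0; exact: ltW.
    by apply: lt_le_trans M0.
  by rewrite divr_gt0 // mulr_gt0.
rewrite invfM invrK ler_pM2l ?invr_gt0 ?mulr_gt0 // lerDl.
by apply: sumr_ge0 => i _; rewrite mulr_ge0 // ltW.
Qed.

(** A Marstrand-type projection argument. By [pair_near] and [count_dir], a pair at distance [d]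
    shares its strip in [O(1 / d)] directions, with a cutoff at [eps]. What remains is an energy
    over distances [O(2 ^- j)]: the sum of [2 ^ i * a ^ i] over [i >= j], which converges since
    [2 a < 1]. *)
Lemma sum_close_mass_le (n K1 j : nat) : (0 < K1)%N -> n = (K1 * 2 ^ J)%N -> (j <= J)%N ->
  \sum_(i < n) close_mass mu (slope (dir n i)) (lkey (dir n i)) j <=
  2 * K1%:R * ((CF + 1) / a ^+ e) * ((2 * a) ^+ j / (1 - 2 * a)).
Proof.
move=> K10 hn jJ; have n0 : (0 < n)%N by rewrite hn muln_gt0 K10 expn_gt0.
have R00 : 0 < R0 by move: R0_ge1; lra.
have p2 i : 0 < 2 ^+ i :> R by rewrite exprn_gt0.
pose E := 3 * R0 * eps.
have E0 : 0 < E by rewrite !mulr_gt0 ?invr_gt0.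
have nE : n%:R * E = 3 * R0 * K1%:R.
  by rewrite /E hn natrM natrX /eps; field; rewrite gt_eqF.
have K1' : 1 <= K1%:R :> R by rewrite ler1n.
have dR x x' : dist x x' <= 2 * R0.
  rewrite /dist ge_max; have := XR0 x; have := XR0 x'; have := X_gt0 x; have := X_gt0 x'.
  have := YX x; have := YX x'; rewrite !ler_norml => /andP[? ?] /andP[? ?] *.
  by apply/andP; split; apply/andP; split; lra.
apply: le_trans (_ : \sum_x \sum_x' (mu x * mu x') * (2 * K1%:R *
   \sum_(j <= i < J.+1) (dist x x' <= 18 * R0 / 2 ^+ i)%R%:R * 2 ^+ i) <= _).
  rewrite exchange_big; apply: ler_sum => x _; rewrite exchange_big; apply: ler_sum => x' _.
  rewrite -mulr_suml mulrC; apply: ler_wpM2l; first by rewrite mulr_ge0.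
  case: (lerP (dist x x') (18 * R0 / 2 ^+ j)) => hd; last first.
    rewrite big1; first by rewrite !mulr_ge0 //; apply: sumr_ge0 => i _; rewrite mulr_ge0 // ltW.
    move=> i _; rewrite -natrM mulnb; case: (boolP (_ && _)) => //= /andP[h1 h2].
    by have [_] := pair_near jJ (dir_le (ltn_ord i)) h1 h2; rewrite leNgt hd.
  apply: le_trans (_ : \sum_(i < n) (`|(X x - X x') + dir n i * (Y x - Y x')| <= E)%R%:R <= _).
    apply: ler_sum => i _; rewrite -natrM mulnb ler_nat.
    case: (boolP (_ && _)) => //= /andP[h1 h2].
    have [h3 _] := pair_near jJ (dir_le (ltn_ord i)) h1 h2.
    suff -> : `|(X x - X x') + dir n i * (Y x - Y x')| <= E by [].
    by move: h3; rewrite /ell /E; congr (`|_| <= _); ring.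
  apply: le_trans (count_dir n0 E0 (erefl _) _) _.
    rewrite nE; apply: le_trans (dR x x') _.
    by have := ler_wpM2l (ltW R00) K1'; lra.
  rewrite -/(dist x x') -(mulrA 4) nE.
  have -> : 4 * E = 12 * R0 * eps by rewrite /E; ring.
  have := inv_dist_le jJ (dist_ge0 x x') hd; set s := \sum_(_ <= _ < _) _ => hs.
  have q0 : 0 <= 4 * (3 * R0 * K1%:R) by rewrite !mulr_ge0 // ltW.
  apply: le_trans (ler_wpM2l q0 hs) _.
  have s0 : 0 <= s by apply: sumr_ge0 => i _; rewrite mulr_ge0 // ltW.
  have -> : 4 * (3 * R0 * K1%:R) * ((9 * R0)^-1 * s) = 4 / 3 * (K1%:R * s).
    by field; rewrite gt_eqF.
  by have : 0 <= K1%:R * s by [rewrite mulr_ge0]; lra.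
have -> : \sum_x \sum_x' (mu x * mu x') * (2 * K1%:R *
   \sum_(j <= i < J.+1) (dist x x' <= 18 * R0 / 2 ^+ i)%R%:R * 2 ^+ i) =
   2 * K1%:R * \sum_(j <= i < J.+1) 2 ^+ i *
     \sum_x mu x * \sum_x' (dist x x' <= 18 * R0 / 2 ^+ i)%R%:R * mu x'.
  rewrite mulr_sumr.
  transitivity (\sum_x \sum_x' \sum_(j <= i < J.+1) 2 * K1%:R * (2 ^+ i *
    (mu x * ((dist x x' <= 18 * R0 / 2 ^+ i)%R%:R * mu x')))).
    apply: eq_bigr => x _; apply: eq_bigr => x' _; rewrite !mulr_sumr.
    by apply: eq_bigr => i _; ring.
  under eq_bigr => x _ do rewrite exchange_big.
  rewrite exchange_big; apply: eq_bigr => i _ /=; rewrite !mulr_sumr.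
  by apply: eq_bigr => x _; rewrite !mulr_sumr.
rewrite -[leRHS]mulrA; apply: ler_wpM2l; first by rewrite mulr_ge0.
set C := (CF + 1) / a ^+ e.
have C0 : 0 <= C.
  by rewrite divr_ge0 ?exprn_ge0 ?(ltW a_gt0) // addr_ge0 // CF_ge0.
have a2 : 0 < 1 - 2 * a by move: a_lt; lra.
apply: le_trans (_ : \sum_(j <= i < J.+1) C * (2 * a) ^+ i <= _).
  rewrite big_nat_cond [leRHS]big_nat_cond; apply: ler_sum => i /andP[/andP[_ iJ] _].
  rewrite exprMn mulrCA ler_pM2l //.
  apply: le_trans (_ : \sum_x mu x * (C * a ^+ i) <= _).
    apply: ler_sum => x _; apply: ler_wpM2l => //.
    apply: le_trans (ball_scaled x iJ); apply: ler_sum => x' _; apply: ler_wpM2r => //.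
    rewrite ler_nat; case: (lerP (dist x x') (18 * R0 / 2 ^+ i)) => //= h.
    suff -> : dist x x' <= 2 ^+ e / 2 ^+ i by [].
    by apply: le_trans h _; rewrite ler_pM2r // invr_gt0.
  by rewrite -mulr_suml ler_piMl // mulr_ge0 // exprn_ge0 // ltW.
rewrite -mulr_sumr; apply: ler_wpM2l => //.
rewrite -{1}(add0n j) big_addn big_mkord.
under eq_bigr => i _ do rewrite exprD.
rewrite -mulr_suml mulrC; apply: ler_wpM2l.
  by rewrite exprn_ge0 // mulr_ge0 // ltW.
by apply: sum_geo_le; [rewrite mulr_ge0 // ltW|lra].
Qed.

Context (A K : R).
Hypothesis A_gt : 2 * a < A.
Hypothesis A_gt2 : 2^-1 < A.
Hypothesis A_lt1 : A < 1.
Hypothesis K_ge : 32 * ((CF + 1) / a ^+ e / (1 - 2 * a) / (1 - 2 * a / A)) <= K.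
Hypothesis K_gt0 : 0 < K.

Definition good_dir n i : bool :=
  [forall j : 'I_J.+1, close_mass mu (slope (dir n i)) (lkey (dir n i)) j <= K * eps * A ^+ j].

(** Markov's inequality and a union bound over the scales; [2 a < A] makes the sum of
    [(2 a / A) ^ j] bounded. The factor [32] in [K_ge] turns the constant [2] of [sum_close_mass_le]
    into the proportion [1/16]. *)
Lemma bad_dir_count (n K1 : nat) : (0 < K1)%N -> n = (K1 * 2 ^ J)%N ->
  \sum_(i < n) (~~ good_dir n i)%:R <= n%:R / 16 :> R.
Proof.
move=> K10 hn; have p2 : 0 < 2 ^+ J :> R by rewrite exprn_gt0.
have A0 : 0 < A by move: A_gt2; lra.
have e0 : 0 < eps by rewrite invr_gt0.
have a2 : 0 < 1 - 2 * a by move: a_lt; lra.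
have th1 : 2 * a / A < 1 by rewrite ltr_pdivrMr // mul1r.
have th0 : 0 <= 2 * a / A by rewrite divr_ge0 ?mulr_ge0 ?ltW.
have K_ge' := K_ge; set C := (CF + 1) / a ^+ e in K_ge'.
have C0 : 0 <= C by rewrite divr_ge0 ?exprn_ge0 ?(ltW a_gt0) // addr_ge0.
have cm0 i j : 0 <= close_mass mu (slope (dir n i)) (lkey (dir n i)) j.
  by do 2! apply: sumr_ge0 => ? _; rewrite !mulr_ge0.
have h1 : \sum_(i < n) (~~ good_dir n i)%:R * (K * eps) <=
    \sum_(j < J.+1) (A ^+ j)^-1 *
      \sum_(i < n) close_mass mu (slope (dir n i)) (lkey (dir n i)) j.
  under [leRHS]eq_bigr => j _ do rewrite mulr_sumr.
  rewrite exchange_big; apply: ler_sum => i _.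
  have t0 (j : 'I_J.+1) : 0 <= (A ^+ j)^-1 * close_mass mu (slope (dir n i)) (lkey (dir n i)) j.
    by rewrite mulr_ge0 // invr_ge0 exprn_ge0 // ltW.
  case: (boolP (good_dir n i)) => [_|/forallPn[j hj]]; first by rewrite mul0r; apply: sumr_ge0.
  rewrite mul1r (bigD1 j) //= -[leLHS]addr0; apply: lerD; last exact: sumr_ge0.
  by rewrite [leRHS]mulrC ler_pdivlMr ?exprn_gt0 // ltW // ltNge.
have h2 : \sum_(j < J.+1) (A ^+ j)^-1 *
      \sum_(i < n) close_mass mu (slope (dir n i)) (lkey (dir n i)) j <=
   2 * K1%:R * (C / (1 - 2 * a) / (1 - 2 * a / A)).
  apply: le_trans (_ : \sum_(j < J.+1) 2 * K1%:R * (C / (1 - 2 * a)) * (2 * a / A) ^+ j <= _).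
    apply: ler_sum => j _.
    have jJ : (j <= J)%N by rewrite -ltnS.
    have := sum_close_mass_le K10 hn jJ; rewrite -/C => h.
    have Aj : 0 < A ^+ j by rewrite exprn_gt0.
    rewrite expr_div_n mulrC ler_pdivrMr //; apply: le_trans h _.
    rewrite le_eqVlt; apply/orP; left; apply/eqP.
    by move: (A ^+ j) Aj ((2 * a) ^+ j) => u u0 w; field; rewrite !gt_eqF.
  rewrite -mulr_sumr [leRHS]mulrA; apply: ler_wpM2l; last exact: sum_geo_le.
  by rewrite mulr_ge0 // divr_ge0 // ltW.
have n0 : 0 <= n%:R :> R by [].
rewrite -(ler_pM2r (x := K * eps)) ?mulr_gt0 // mulr_suml; apply: le_trans h1 _.
apply: le_trans h2 _.
have -> : n%:R / 16 * (K * eps) = K1%:R * (K / 16).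
  by rewrite hn natrM natrX /eps; field; rewrite gt_eqF.
have := ler_wpM2l (ler0n R K1) K_ge'; lra.
Qed.

Lemma good_dirP n i j : good_dir n i -> (j <= J)%N ->
  close_mass mu (slope (dir n i)) (lkey (dir n i)) j <= K * eps * A ^+ j.
Proof. by move=> /forallP h jJ; exact: (h (Ordinal (jJ : (j < J.+1)%N))). Qed.

Let H := (2 ^ (3 * J))%N.
Let L := (2 ^ (3 * J - J))%N.

(** A chart transition multiplying [ell] by [al] multiplies slopes by [al ^- 2], which is
    approximated by [m / H]. The logarithm of [ell] therefore moves by [ln al], close to
    [- ln (m / H) / 2]. *)
Definition key_shift (m : int) : int := Num.floor (- (2 ^+ J / 2) * ln (m%:~R / H%:R) : R).

End Directions.

(** * Unimodular matrices close to the identity, seen in the charts *)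

Section KernelEstimates.
Context {R : realType}.

(** Pulling the functional [X + t Y] back by the matrix gives [ca + t cc] times [X + t0 Y], where
    [t0] is the quotient bounded here. The bound keeps the partner direction inside
    [[- 1/2, 1/2]]. *)
Lemma mobius_bounds (ca cb cc cd t : R) :
  `|ca - 1| <= 100^-1 -> `|cb| <= 100^-1 -> `|cc| <= 100^-1 -> `|cd - 1| <= 100^-1 ->
  `|t| <= 3 / 10 ->
  [/\ 98 / 100 <= ca + t * cc, ca + t * cc <= 102 / 100 &
      `|(cb + t * cd) / (ca + t * cc)| <= 33 / 100].
Proof.
move=> ha hb hc hd ht.
have tc : `|t * cc| <= 3 / 10 * 100^-1 by rewrite normrM; apply: ler_pM.
have td : `|t * cd| <= 3 / 10 * (101 / 100).
  by rewrite normrM; apply: ler_pM => //; move: hd; clear;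
    rewrite !ler_norml => /andP[? ?]; apply/andP; split; lra.
have [al1 al2] : 98 / 100 <= ca + t * cc /\ ca + t * cc <= 102 / 100.
  by move: tc ha; clear; rewrite !ler_norml => /andP[? ?] /andP[? ?]; split; lra.
have al0 : 0 < ca + t * cc by move: al1; clear; lra.
split=> //; rewrite normrM normfV (gtr0_norm al0) ler_pdivrMr //.
by apply: le_trans (ler_normD _ _) _; move: hb td al1; clear; lra.
Qed.

(* [x] is seen in the chart of direction [t'], [y] in the chart of direction [t],
   and the unimodular matrix [[ca, cb], [cc, cd]] maps [x] close to [y]; in these
   charts it acts as [(l, u) |-> (al * l, cc / al + u / al ^+ 2)]. *)
Lemma chart_action (ca cb cc cd t t' r0 z eps xX xY yX yY s : R) :
  `|ca - 1| <= 100^-1 -> `|cb| <= 100^-1 -> `|cc| <= 100^-1 -> `|cd - 1| <= 100^-1 ->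
  ca * cd - cb * cc = 1 -> `|t| <= 3 / 10 -> `|t'| <= 2^-1 ->
  0 < eps -> eps <= 8^-1 -> 0 < r0 -> r0 <= xX -> r0 <= yX -> `|xY| <= xX -> `|yY| <= yX ->
  z * xX <= r0 * eps / 2000 -> 0 <= z ->
  let al := ca + t * cc in
  `|t' - (cb + t * cd) / al| <= z ->
  `|ca * xX + cb * xY - yX| <= r0 * eps / 2000 ->
  `|cc * xX + cd * xY - yY| <= r0 * eps / 2000 ->
  `|s - al ^- 2| <= eps / 100 ->
  `|ln (yX + t * yY) - ln (xX + t' * xY) + ln s / 2| <= eps / 40 /\
  `|s * (xY / (xX + t' * xY)) + cc / al - yY / (yX + t * yY)| <= eps / 30.
Proof.
move=> ha hb hc hd hdet ht ht' e0 e1 r00 hx hy hxY hyY hz z0 al htt h1 h2 hm.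
have re := mulr_gt0 r00 e0.
have [al1 al2 ht0] := mobius_bounds ha hb hc hd ht; rewrite -/al in al1 al2 ht0 htt.
have al0 : 0 < al by move: al1; clear; lra.
pose t0 := (cb + t * cd) / al; rewrite -/t0 in ht0 htt.
have xX0 : 0 < xX by exact: lt_le_trans hx.
have yX0 : 0 < yX by exact: lt_le_trans hy.
pose L0 := xX + t0 * xY.
have hL0 : 2 / 3 * xX <= L0.
  have : `|t0 * xY| <= 33 / 100 * xX by rewrite normrM; apply: ler_pM.
  by rewrite /L0 ler_norml => /andP[+ _]; move: xX0; clear; lra.
have L00 : 0 < L0 by move: hL0 xX0; clear; lra.
have aL : (ca * xX + cb * xY) + t * (cc * xX + cd * xY) = al * L0.
  by rewrite /L0 /t0 /al; field; rewrite gt_eqF.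
pose ly := yX + t * yY; pose lx := xX + t' * xY.
pose e := ly - al * L0.
have he : `|e| <= r0 * eps / 1500.
  have -> : e = - (ca * xX + cb * xY - yX) - t * (cc * xX + cd * xY - yY).
    by rewrite /e -aL /ly; ring.
  apply: le_trans (ler_normB _ _) _; rewrite normrN normrM.
  have : `|t| * `|cc * xX + cd * xY - yY| <= 3 / 10 * (r0 * eps / 2000) by apply: ler_pM.
  by move: h1 re; clear; lra.
have hdt : `|(t' - t0) * xY| <= r0 * eps / 2000.
  by apply: le_trans hz; rewrite normrM; apply: ler_pM.
have elx : lx = L0 + (t' - t0) * xY by rewrite /lx /L0; ring.
have hly : r0 / 2 <= ly.
  have : `|t * yY| <= 3 / 10 * yX by rewrite normrM; apply: ler_pM.
  by rewrite /ly ler_norml => /andP[+ _]; move: hy yX0; clear; lra.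
have hlx : xX / 2 <= lx.
  have : `|t' * xY| <= 2^-1 * xX by rewrite normrM; apply: ler_pM.
  by rewrite /lx ler_norml => /andP[+ _]; clear; lra.
have hlx2 : r0 / 2 <= lx by move: hlx hx; clear; lra.
have ly0 : 0 < ly by move: hly r00; clear; lra.
have lx0 : 0 < lx by move: hlx2 r00; clear; lra.
have alx : r0 / 4 <= al * lx.
  have : 98 / 100 * (r0 / 2) <= al * lx by apply: ler_pM => //; rewrite divr_ge0 // ltW.
  by move: r00; clear; lra.
have r04 : 0 < r0 / 4 by rewrite divr_gt0.
have hlog1 : `|ln ly - ln (al * lx)| <= eps / 100.
  apply: (@ln_near _ _ _ (r0 / 4)) => //; first by move: hly r00; clear; lra.
  have -> : ly - al * lx = e - al * ((t' - t0) * xY) by rewrite elx /e; ring.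
  apply: le_trans (ler_normB _ _) _; rewrite [`|al * _|]normrM (gtr0_norm al0).
  have : al * `|(t' - t0) * xY| <= 102 / 100 * (r0 * eps / 2000) by apply: ler_pM => //; exact: ltW.
  by move: he re; clear; lra.
have al20 : 0 < al ^+ 2 by rewrite exprn_gt0.
have [al21 al22] : 96 / 100 <= al ^+ 2 /\ al ^+ 2 <= 105 / 100.
  have b1 : 98 / 100 * (98 / 100) <= al * al by apply: ler_pM.
  have b2 : al * al <= 102 / 100 * (102 / 100) by apply: ler_pM => //; exact: ltW.
  by rewrite expr2; move: b1 b2; clear; split; lra.
have hsal : `|(s - al ^- 2) * al ^+ 2| <= eps / 100 * (105 / 100).
  by rewrite normrM; apply: ler_pM => //; rewrite gtr0_norm.
have esal : s * al ^+ 2 = 1 + (s - al ^- 2) * al ^+ 2 by field; rewrite !gt_eqF.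
have hsal2 : 2^-1 <= s * al ^+ 2.
  by rewrite esal; move: hsal e1; clear; rewrite ler_norml => /andP[+ _]; lra.
have s0 : 0 < s.
  by rewrite -(pmulr_lgt0 _ al20); move: hsal2; clear; lra.
have hlog2 : `|ln (s * al ^+ 2) - ln 1| <= eps / 40.
  apply: (@ln_near _ _ _ 2^-1) => //; first by clear; lra.
  by rewrite {1}esal addrAC subrr add0r; move: hsal e0; clear; lra.
rewrite ln1 subr0 lnM ?posrE // lnXn // in hlog2.
rewrite lnM ?posrE // in hlog1.
split.
  have -> : ln ly - ln lx + ln s / 2 = (ln ly - (ln al + ln lx)) + (ln s + ln al *+ 2) / 2.
    by rewrite mulr2n; field.
  apply: le_trans (ler_normD _ _) _; rewrite [`|_ / 2|]normrM [`|2^-1|]ger0_norm //.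
  by move: hlog1 hlog2 e0; clear; lra.
pose U := xY / L0; pose G := cc * xX + cd * xY; pose W := cc / al + U / al ^+ 2.
(* Unimodularity enters here: it turns the fractional linear action on slopes into the affine map
   [U |-> cc / al + U / al ^ 2]. *)
have ecd : cd = cc * t0 + al^-1.
  have -> : cc * t0 + al^-1 = (cc * (cb + t * cd) + (ca * cd - cb * cc)) / al.
    by rewrite hdet /t0; field; rewrite gt_eqF.
  by rewrite /al; field; rewrite gt_eqF.
have GW : G = W * (al * L0).
  by rewrite /G /W /U {1}ecd /L0; field; rewrite -/L0 !gt_eqF.
have hU : `|U| <= 3 / 2.
  rewrite /U normrM normfV (gtr0_norm L00) ler_pdivrMr //.
  by move: hxY hL0; clear; lra.
have ai2 : al ^- 2 <= 100 / 96.
  rewrite (_ : 100 / 96 = (96 / 100)^-1); last by field.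
  by rewrite lef_pV2 ?posrE //; clear; lra.
have ai20 : 0 < al ^- 2 by rewrite invr_gt0.
have hW : `|W| <= 2.
  apply: le_trans (ler_normD _ _) _;
    rewrite (normrM cc) (normrM U) !normfV (gtr0_norm al0) (gtr0_norm al20).
  have w1 : `|cc| / al <= 2 / 100 by rewrite ler_pdivrMr //; move: hc al1; clear; lra.
  have w2 : `|U| * al ^- 2 <= 3 / 2 * (100 / 96) by apply: ler_pM => //; exact: ltW.
  by move: w1 w2; clear; lra.
have hv : `|yY / ly - W| <= eps / 150.
  have -> : yY / ly - W = (- (G - yY) - W * e) / ly.
    by rewrite {1}GW /e; field; rewrite !gt_eqF.
  rewrite normrM normfV (gtr0_norm ly0) ler_pdivrMr //.
  apply: le_trans (ler_normB _ _) _; rewrite normrN [`|W * e|]normrM.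
  have w1 : `|W| * `|e| <= 2 * (r0 * eps / 1500) by apply: ler_pM.
  have w2 : eps / 150 * (r0 / 2) <= eps / 150 * ly by rewrite ler_pM2l ?divr_gt0 ?ltr0n.
  by move: w1 w2 h2 re; rewrite -/G; clear; lra.
have hux : `|xY / lx| <= 2.
  by rewrite normrM normfV (gtr0_norm lx0) ler_pdivrMr //; move: hlx hxY; clear; lra.
have hu : `|s * (xY / lx) - U / al ^+ 2| <= eps / 40.
  have -> : s * (xY / lx) - U / al ^+ 2 =
     (s - al ^- 2) * (xY / lx) - al ^- 2 * (U * ((t' - t0) * xY) / lx).
    have eU : U * L0 = xY by rewrite /U divfK // gt_eqF.
    have -> : xY / lx = U - U * ((t' - t0) * xY) / lx.
      rewrite -{1}eU (_ : L0 = lx - (t' - t0) * xY); last by rewrite elx addrK.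
      by field; rewrite gt_eqF.
    by ring.
  apply: le_trans (ler_normB _ _) _; rewrite normrM [`|al ^- 2 * _|]normrM (gtr0_norm ai20).
  have w1 : `|s - al ^- 2| * `|xY / lx| <= eps / 100 * 2 by apply: ler_pM.
  have w2 : `|U * ((t' - t0) * xY) / lx| <= 3 / 2 * (eps / 1000).
    rewrite normrM normfV (gtr0_norm lx0) ler_pdivrMr // [`|U * _|]normrM.
    have w3 : `|U| * `|(t' - t0) * xY| <= 3 / 2 * (r0 * eps / 2000) by apply: ler_pM.
    have w4 : eps / 1000 * (r0 / 2) <= eps / 1000 * lx by rewrite ler_pM2l ?divr_gt0 ?ltr0n.
    by move: w3 w4; clear; lra.
  have w5 : al ^- 2 * `|U * ((t' - t0) * xY) / lx| <= 100 / 96 * (3 / 2 * (eps / 1000)).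
    by apply: ler_pM => //; exact: ltW.
  by move: w1 w5 e0; clear; lra.
have -> : s * (xY / lx) + cc / al - yY / ly = (s * (xY / lx) - U / al ^+ 2) - (yY / ly - W).
  by rewrite /W; ring.
by apply: le_trans (ler_normB _ _) _; move: hu hv e0; clear; lra.
Qed.

Lemma floor_three (tA tB tC : R) : `|tA - tB - tC| <= 1 / 2 ->
  -1 <= Num.floor tA - Num.floor tB - Num.floor tC <= 2.
Proof.
have f1 := floor_le tA; have f2 := floorD1_gt tA.
have f3 := floor_le tB; have f4 := floorD1_gt tB.
have f5 := floor_le tC; have f6 := floorD1_gt tC.
rewrite !rmorphD /= in f2 f4 f6.
rewrite ler_norml => /andP[q1 q2].
have i1 : (-2)%:~R < (Num.floor tA - Num.floor tB - Num.floor tC)%:~R :> R.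
  by rewrite !rmorphB /= rmorphN /=; lra.
have i2 : (Num.floor tA - Num.floor tB - Num.floor tC)%:~R < 3%:~R :> R.
  by rewrite !rmorphB /= ; lra.
rewrite ltr_int in i1; rewrite ltr_int in i2; move: i1 i2.
by set q := _ - Num.floor tC; clear; lia.
Qed.

End KernelEstimates.

Section KernelBounds.
Context {R : realType}.

Lemma floor_offset_range (g : int) (x y E : R) (L : nat) : L%:R = E -> 256 <= E ->
  `|g%:~R + x - y - E / 2| <= E / 20 -> 0 <= g + (Num.floor x - Num.floor y) < L%:Z.
Proof.
move=> LE E256; rewrite ler_norml => /andP[b1 b2].
have f1 := floor_le x; have f2 := floorD1_gt x.
have f3 := floor_le y; have f4 := floorD1_gt y.
rewrite !rmorphD /= in f2 f4.
apply/andP; split; [rewrite -(ler_int R)|rewrite -(ltr_int R) -[L%:Z%:~R]/(L%:R : R) LE].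
  by rewrite !rmorphD rmorphN /=; move: E256 b1 f1 f2 f3 f4; clear; lra.
by rewrite !rmorphD rmorphN /=; move: E256 b2 f1 f2 f3 f4; clear; lra.
Qed.

Lemma hat_ge_half (H : nat) (m : int) (y e : R) : `|m%:~R / H%:R - y| <= e / 100 -> 0 < e ->
  e <= 16^-1 -> 100 / 105 <= y -> y <= 100 / 96 -> 2^-1 <= hat H m :> R.
Proof.
move=> hm e0 e1 y1 y2; rewrite /hat le_max; apply/orP; right.
have : `|m%:~R / H%:R - 1| <= 1 / 10 :> R.
  move: hm; rewrite !ler_norml => /andP[u1 u2]; apply/andP.
  by split; move: u1 u2 e0 e1 y1 y2; clear; lra.
by move: (`|_ - 1|) => z; clear; lra.
Qed.

Lemma sqr_near_one (x : R) : 98 / 100 <= x -> x <= 102 / 100 ->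
  100 / 105 <= x ^- 2 /\ x ^- 2 <= 100 / 96.
Proof.
move=> x1 x2; have x0 : 0 < x by move: x1; clear; lra.
have x20 : 0 < x ^+ 2 by rewrite exprn_gt0.
have b1 : 98 / 100 * (98 / 100) <= x * x by apply: ler_pM; rewrite // divr_ge0 ?ler0n.
have b2 : x * x <= 102 / 100 * (102 / 100) by apply: ler_pM => //; exact: ltW.
rewrite (_ : 100 / 105 = (105 / 100)^-1); last by field.
rewrite (_ : 100 / 96 = (96 / 100)^-1); last by field.
have p n m : 0 < n.+1%:R / m.+1%:R :> R by rewrite divr_gt0 ?ltr0n.
rewrite !lef_pV2 ?posrE //; try exact: (p _ 99%N).
by rewrite expr2; split; move: b1 b2; clear; lra.
Qed.

Lemma norm_half_le1 (e c b : R) : 0 < e -> e <= 16^-1 -> `|c| <= 100^-1 -> 98 / 100 <= b ->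
  `|e / 2 + c / b| <= 1.
Proof.
move=> e0 e1 c0 b1; have b0 : 0 < b by move: b1; clear; lra.
apply: le_trans (ler_normD _ _) _; rewrite (normrM c) normfV (gtr0_norm b0).
have : `|c| / b <= 2 / 100 by rewrite ler_pdivrMr //; move: c0 b1; clear; lra.
rewrite [`|e / 2|]ger0_norm; last by rewrite divr_ge0 // ltW.
by move: (`|c| / b) e1 => z; clear; lra.
Qed.

Lemma distr_nat_ge1 (i j : nat) : i != j -> 1 <= `|i%:R - j%:R| :> R.
Proof.
wlog ij : i j / (i < j)%N => [h|_].
  by rewrite neq_ltn => /orP[] ij; [|rewrite distrC]; apply: h; rewrite // ltn_eqF.
by rewrite distrC ger0_norm ?subr_ge0 ?ler_nat 1?ltnW // lerBrDl natr1 ler_nat.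
Qed.

Lemma distr_itv_le1 (x y : R) (f : nat) : f%:R <= x < f.+1%:R -> f%:R <= y < f.+1%:R ->
  `|x - y| <= 1.
Proof. by rewrite -(natr1 f) ler_norml => /andP[h1 h2] /andP[h3 h4]; apply/andP; split; lra. Qed.

End KernelBounds.

Section Kernels.
Context {R : realType} {S : finType} (X Y mu : S -> R) (J n : nat).

Let eps : R := (2 ^+ J)^-1.
Let H := (2 ^ (3 * J))%N.
Let L := (2 ^ (3 * J - J))%N.

Definition close_pair (ca cb cc cd rho : R) (p : S * S) : Prop :=
  `|ca * X p.1 + cb * Y p.1 - X p.2| <= rho /\
  `|cc * X p.1 + cd * Y p.1 - Y p.2| <= rho.

(* [p.1] lies in the chart of direction [i'], [p.2] in the chart of direction
   [i]; rounding the logarithms makes their keys differ from [key_shift m] by one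
   of four integers. *)
Definition hit (i i' : nat) (m g : int) (p : S * S) : R :=
  \sum_(c < 4) (lkey X Y J (dir n i') p.1 + (@key_shift R J m + (c%:Z - 1))
      == lkey X Y J (dir n i) p.2)%:R *
    box L (g + (pos_x (slope X Y (dir n i')) m p.1 - pos_y (slope X Y (dir n i)) J p.2)).

Lemma hit_ge0 i i' m g p : 0 <= hit i i' m g p.
Proof. by apply: sumr_ge0 => c _; rewrite mulr_ge0. Qed.

Context (r0 R0 : R).
Hypothesis J4 : (4 <= J)%N.
Hypothesis n_gt0 : (0 < n)%N.
Hypothesis r0_gt0 : 0 < r0.
Hypothesis X_ge : forall x, r0 <= X x.
Hypothesis X_le : forall x, X x <= R0.
Hypothesis YX : forall x, `|Y x| <= X x.
Hypothesis nR0 : R0 / n%:R <= r0 * eps / 2000.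

Variables (ca cb cc cd : R).
Hypothesis ca1 : `|ca - 1| <= 100^-1.
Hypothesis cb0 : `|cb| <= 100^-1.
Hypothesis cc0 : `|cc| <= 100^-1.
Hypothesis cd1 : `|cd - 1| <= 100^-1.
Hypothesis det1 : ca * cd - cb * cc = 1.

Let al i := ca + dir n i * cc.
Let t0 i := (cb + dir n i * cd) / al i.

Let eps_gt0 : 0 < eps. Proof. by rewrite invr_gt0 exprn_gt0. Qed.
Let H_gt0 : 0 < H%:R :> R. Proof. by rewrite ltr0n expn_gt0. Qed.
Let eps_le : eps <= 16^-1.
Proof.
rewrite /eps lef_pV2 ?posrE ?exprn_gt0 ?ltr0n // (_ : 16 = 2 ^+ 4); last by ring.
by rewrite ler_eXn2l // ltr1n.
Qed.
Let L_eps : L%:R = H%:R * eps.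
Proof.
rewrite /L /H /eps !natrX -[in RHS](subnK (_ : (J <= 3 * J)%N)) ?leq_pmull //.
by rewrite exprD mulfK // gt_eqF // exprn_gt0.
Qed.
Let Heps_ge : 256 <= H%:R * eps.
Proof.
rewrite -L_eps (_ : 256 = (2 ^ 8)%N%:R) // ler_nat /L leq_exp2l //.
by move: J4; clear; lia.
Qed.

(** Every [(m, g)] near the true factor and offset detects the pair. The shift [eps / 2] in the
    offset aims at the middle of the box, whose length is [L = H * eps], so that all errors stay
    inside. *)
Lemma hit_ge1 i i' m g p : (i' < n)%N -> `|dir n i| <= 3 / 10 :> R ->
  `|dir n i' - t0 i| <= n%:R^-1 ->
  `|m%:~R / H%:R - al i ^- 2| <= eps / 100 ->
  `|g%:~R / H%:R - (eps / 2 + cc / al i)| <= eps / 100 ->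
  close_pair ca cb cc cd (r0 * eps / 2000) p ->
  1 <= hit i i' m g p.
Proof.
case: p => x y hi' hi hdir hm hg [/= h1 h2].
have hdir' : `|dir n i'| <= 2^-1 :> R by exact: dir_le.
have n0 : 0 < n%:R :> R by rewrite ltr0n.
have hz : n%:R^-1 * X x <= r0 * eps / 2000.
  by apply: le_trans nR0; rewrite mulrC ler_pM2r // invr_gt0.
have z0 : 0 <= n%:R^-1 :> R by rewrite invr_ge0.
have eps8 : eps <= 8^-1 by apply: le_trans eps_le _; rewrite lef_pV2 ?posrE ?ltr0n // ler_nat.
have [hlog hsl] := chart_action ca1 cb0 cc0 cd1 det1 hi hdir' eps_gt0 eps8 r0_gt0
  (X_ge x) (X_ge y) (YX x) (YX y) hz z0 hdir h1 h2 hm.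
rewrite -/(ell X Y (dir n i) y) -/(ell X Y (dir n i') x) in hlog hsl.
rewrite -/(slope X Y (dir n i) y) -/(slope X Y (dir n i') x) in hsl.
have p2 : 0 < 2 ^+ J :> R by rewrite exprn_gt0.
have hkey : -1 <= lkey X Y J (dir n i) y - lkey X Y J (dir n i') x - @key_shift R J m <= 2.
  apply: floor_three.
  have -> (u v w : R) : 2 ^+ J * u - 2 ^+ J * v - (- (2 ^+ J / 2) * w) =
     2 ^+ J * (u - v + w / 2) by field.
  rewrite normrM (gtr0_norm p2) mulrC -ler_pdivlMr //; apply: le_trans hlog _.
  by rewrite -/eps; move: eps_gt0; lra.
have hbox : (0 <= g + (pos_x (slope X Y (dir n i')) m x - pos_y (slope X Y (dir n i)) J y) < L%:Z).
  pose u := slope X Y (dir n i') x; pose v := slope X Y (dir n i) y.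
  pose B := g%:~R + m%:~R * u - H%:R * v.
  have hB : `|B - H%:R * eps / 2| <= H%:R * eps / 20.
    have -> : B - H%:R * eps / 2 = H%:R * ((g%:~R / H%:R - (eps / 2 + cc / al i)) +
       (m%:~R / H%:R * u + cc / al i - v)) by rewrite /B; move: (cc / al i) => w; field;
         rewrite gt_eqF.
    rewrite normrM (gtr0_norm H_gt0) -[leRHS]mulrA ler_pM2l //.
    apply: le_trans (ler_normD _ _) _; rewrite -/u -/v -/(al i) in hsl.
    by move: hg hsl eps_gt0; lra.
  exact: floor_offset_range L_eps Heps_ge hB.
pose c := `|(lkey X Y J (dir n i) y - lkey X Y J (dir n i') x - @key_shift R J m + 1)%R|%N.
have c4 : (c < 4)%N by rewrite /c; move: hkey; set q := _ - @key_shift R J m; clear; lia.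
rewrite /hit (bigD1 (Ordinal c4)) //= /box hbox mulr1.
have -> : lkey X Y J (dir n i') x + (@key_shift R J m + (c%:Z - 1)) == lkey X Y J (dir n i) y.
  apply/eqP; rewrite /c; move: hkey.
  set q1 := lkey _ _ _ (dir n i) _; set q2 := lkey _ _ _ _ _; set q3 := key_shift _ _; clear; lia.
by rewrite lerDl; apply: sumr_ge0 => j _; rewrite mulr_ge0.
Qed.

(** The admissible [m] and [g] depend on the matrix and on [i] but not on the pair of points, so all
    [N] pairs are hit simultaneously. Each of the two parameters has at least [H * eps / 100]
    values, and [hat] is at least [1/2] there. *)
Lemma hit_sum_ge (N i i' : nat) (f : 'I_N -> S * S) : (i' < n)%N ->
  `|dir n i| <= 3 / 10 :> R -> `|dir n i' - t0 i| <= n%:R^-1 ->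
  (forall c, close_pair ca cb cc cd (r0 * eps / 2000) (f c)) ->
  (H%:R * eps / 100) ^+ 2 / 2 <=
  zsum (8 * H) (fun m => hat H m * zsum (16 * H) (fun g => \prod_(c < N) hit i i' m g (f c))).
Proof.
move=> hi' hi hdir hf.
set rho := H%:R * eps / 100.
have rho1 : 1 <= rho by rewrite /rho; move: Heps_ge; lra.
have [al1 al2 ht0] := mobius_bounds ca1 cb0 cc0 cd1 hi; rewrite -/(al i) in al1 al2 ht0.
have al0 : 0 < al i by move: al1; lra.
have [ai2 ai1] := sqr_near_one al1 al2.
have hH : 1 <= H%:R :> R by rewrite ler1n expn_gt0.
have hHe : H%:R * eps <= H%:R * 16^-1 by rewrite ler_pM2l.
pose c1 := H%:R * al i ^- 2; pose c2 := H%:R * (eps / 2 + cc / al i).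
have hc1 : rho <= zsum (8 * H) (fun m => (`|m%:~R - c1| <= rho)%R%:R).
  apply: zsum_near_ge => //; rewrite natrM /c1 normrM (gtr0_norm H_gt0) ger0_norm; last by lra.
  have := ler_wpM2l (ltW H_gt0) ai1.
  by rewrite /rho; lra.
have hc2 : rho <= zsum (16 * H) (fun m => (`|m%:~R - c2| <= rho)%R%:R).
  apply: zsum_near_ge => //; rewrite natrM /c2 normrM (gtr0_norm H_gt0).
  have := norm_half_le1 eps_gt0 eps_le cc0 al1.
  move/(ler_wpM2l (ltW H_gt0)).
  by rewrite /rho; lra.
have rho0 : 0 <= rho by exact: le_trans rho1.
apply: le_trans (_ : zsum (8 * H) (fun m => (`|m%:~R - c1| <= rho)%R%:R) * (rho / 2) <= _).
  by rewrite expr2 -mulrA; apply: ler_wpM2r => //; rewrite divr_ge0.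
rewrite mulrC -zsumZ; apply: ler_zsum => m.
have hpos : 0 <= hat H m * zsum (16 * H) (fun g => \prod_(c < N) hit i i' m g (f c)).
  rewrite mulr_ge0 ?hat_ge0 //; apply: zsum_ge0 => g; apply: prodr_ge0 => c _.
  exact: hit_ge0.
case: (lerP `|m%:~R - c1| rho) => hm /=; last by rewrite mulr0.
rewrite mulr1.
have hm' : `|m%:~R / H%:R - al i ^- 2| <= eps / 100.
  rewrite -(ler_pM2l H_gt0); apply: le_trans (_ : rho <= _); last by rewrite /rho mulrA.
  apply: le_trans hm; rewrite -{1}(gtr0_norm H_gt0) -normrM /c1 mulrBr mulrCA divff ?mulr1 //.
  by rewrite gt_eqF.
have hhat : 2^-1 <= hat H m :> R := hat_ge_half hm' eps_gt0 eps_le ai2 ai1.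
rewrite mulrC; apply: ler_pM => //.
apply: le_trans hc2 _; apply: ler_zsum => g.
case: (lerP `|g%:~R - c2| rho) => hg /=; last first.
  by apply: prodr_ge0 => c _; exact: hit_ge0.
have hg' : `|g%:~R / H%:R - (eps / 2 + cc / al i)| <= eps / 100.
  rewrite -(ler_pM2l H_gt0); apply: le_trans (_ : rho <= _); last by rewrite /rho mulrA.
  apply: le_trans hg; rewrite -{1}(gtr0_norm H_gt0) -normrM /c2 mulrBr mulrCA divff ?mulr1 //.
  by rewrite gt_eqF.
have -> : true%:R = \prod_(c < N) 1 :> R by rewrite big1.
by apply: ler_prod => c _; rewrite ler01 /=; exact: hit_ge1.
Qed.

(** Each of [n / 4] directions gets as partner the grid direction just below its image [t0]. Both
    choices are injective, so the bad directions spoil at most [n / 16] pairs on either side. *)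
Lemma dir_count (good : nat -> bool) (n2 : nat) : n = (8 * n2)%N ->
  \sum_(i < n) (~~ good i)%:R <= n%:R / 16 :> R ->
  n%:R / 8 <= \sum_(i < n) \sum_(i' < n) (good i && good i' && (`|dir n i| <= 3 / 10 :> R)
     && (`|dir n i' - t0 i| <= n%:R^-1))%:R :> R.
Proof.
move=> hn hbad; have n0 : 0 < n%:R :> R by rewrite ltr0n.
have n20 : 0 < n2%:R :> R by rewrite ltr0n; move: n_gt0; rewrite hn muln_gt0.
have hnr : n%:R = 8 * n2%:R :> R by rewrite hn natrM.
(* Every second direction in the middle half is taken: images then differ by at least
   [(2 / n) / 1.02 ^ 2 > 1 / n], which forces distinct partners. *)
have gP (i : 'I_(2 * n2)) : (2 * (n2 + i) < n)%N by have := ltn_ord i; rewrite hn; clear; lia.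
pose gi i : 'I_n := Ordinal (gP i).
have hdir i : `|dir n (gi i)| <= 3 / 10 :> R.
  have -> : dir n (gi i) = (i%:R - n2%:R) / (4 * n2%:R) :> R.
    by rewrite /dir /= hnr natrM natrD; field; rewrite gt_eqF.
  have hi : i%:R <= 2 * n2%:R :> R by rewrite -natrM ler_nat ltnW.
  rewrite normrM normfV [`|4 * _|]ger0_norm; last by rewrite mulr_ge0 // ltW.
  rewrite ler_pdivrMr ?mulr_gt0 //.
  by have i0 := ler0n R i; rewrite ler_norml; apply/andP; split; lra.
pose fn i := Num.truncn ((t0 (gi i) + 2^-1) * n%:R).
have ht0 i : `|t0 (gi i)| <= 33 / 100.
  by have [] := mobius_bounds ca1 cb0 cc0 cd1 (hdir i).
have hfn i : (fn i)%:R <= (t0 (gi i) + 2^-1) * n%:R < (fn i).+1%:R.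
  apply: truncn_itv; rewrite mulr_ge0 ?ltW //.
  by have := ht0 i; rewrite ler_norml => /andP[]; lra.
have fP i : (fn i < n)%N.
  have /andP[h1 _] := hfn i; rewrite -(ltr_nat R); apply: le_lt_trans h1 _.
  by rewrite gtr_pMl //; have := ht0 i; rewrite ler_norml => /andP[]; lra.
pose fi i : 'I_n := Ordinal (fP i).
have hfi i : `|dir n (fi i) - t0 (gi i)| <= n%:R^-1.
  have /andP[h1 h2] := hfn i.
  have -> : dir n (fi i) - t0 (gi i) = ((fn i)%:R - (t0 (gi i) + 2^-1) * n%:R) / n%:R.
    by rewrite /dir /=; field; rewrite gt_eqF.
  rewrite normrM normfV (gtr0_norm n0) ler_piMl ?invr_ge0 ?(ltW n0) //.
  by rewrite -(natr1 (fn i)) in h2; rewrite ler_norml; apply/andP; split; lra.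
have fi_inj : injective fi.
  move=> i j /(congr1 (fun x : 'I_n => val x)) /= hij.
  apply/eqP; apply: contraT => ij.
  have [a1 a2 _] := mobius_bounds ca1 cb0 cc0 cd1 (hdir i).
  have [b1 b2 _] := mobius_bounds ca1 cb0 cc0 cd1 (hdir j).
  rewrite -/(al _) in a1 a2; rewrite -/(al _) in b1 b2.
  have ai0 : 0 < al (gi i) by lra.
  have aj0 : 0 < al (gi j) by lra.
  have e1 : (t0 (gi i) - t0 (gi j)) * (al (gi i) * al (gi j)) = dir n (gi i) - dir n (gi j).
    rewrite /t0 mulrBl mulrA divfK ?gt_eqF // [al _ * al _]mulrC mulrA divfK ?gt_eqF //.
    rewrite /al; set ti := dir n _; set tj := dir n _.
    by rewrite -[RHS]mulr1 -det1; ring.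
  have h5 : `|(t0 (gi i) - t0 (gi j)) * n%:R| <= 1.
    have := hfn i; rewrite hij => /distr_itv_le1/(_ (hfn j)).
    by rewrite -mulrBl opprD addrACA subrr addr0.
  have h6 : `|al (gi i) * al (gi j)| <= 102 / 100 * (102 / 100).
    by rewrite ger0_norm; [apply: ler_pM => //; exact: ltW|rewrite mulr_ge0 // ltW].
  have h7 : `|(dir n (gi i) - dir n (gi j)) * n%:R| <= 1 * (102 / 100 * (102 / 100)) :> R.
    by rewrite -e1 mulrAC normrM; apply: ler_pM.
  have h8 : (dir n (gi i) - dir n (gi j)) * n%:R = 2 * (i%:R - j%:R) :> R.
    by rewrite /dir /= !natrM !natrD; field; rewrite gt_eqF.
  have h9 := @distr_nat_ge1 R i j ij.
  by move: h7; rewrite h8 normrM [`|2|]ger0_norm //; lra.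
have gi_inj : injective gi.
  move=> i j /(congr1 (fun x : 'I_n => val x)) /= hij.
  by apply: val_inj => /=; move: hij; clear; lia.
pose F (p : 'I_n * 'I_n) : R := (good p.1 && good p.2 && (`|dir n p.1| <= 3 / 10 :> R)
     && (`|dir n p.2 - t0 p.1| <= n%:R^-1))%:R.
rewrite pair_big /=.
have pinj : injective (fun i => (gi i, fi i)) by move=> i j [/eqP]; move=> h _; apply: gi_inj;
  exact/eqP.
apply: le_trans (sum_inj_le (F := F) pinj _); last by move=> p; rewrite /F.
have b1 := le_trans (sum_inj_le (F := fun i : 'I_n => (~~ good i)%:R : R) gi_inj (fun _ =>
  ler0n _ _)) hbad.
have b2 := le_trans (sum_inj_le (F := fun i : 'I_n => (~~ good i)%:R : R) fi_inj (fun _ =>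
  ler0n _ _)) hbad.
apply: le_trans (_ : \sum_(i < 2 * n2) (1 - (~~ good (gi i))%:R - (~~ good (fi i))%:R) <= _).
  rewrite !sumrB sumr_const card_ord natrM.
  by move: b1 b2; rewrite hnr; lra.
apply: ler_sum => i _; rewrite /F /= hdir hfi !andbT.
by case: (good _); case: (good _) => /=; lra.
Qed.

End Kernels.

(** * The mass of the pairs of configurations related by a common matrix *)

Section PairCount.
Context {R : realType}.

Definition close_conf {S : finType} (X Y : S -> R) (rho : R) N (f : 'I_N -> S * S) : Prop :=
  exists ca cb cc cd : R, [/\ [/\ `|ca - 1| <= 100^-1, `|cb| <= 100^-1,
    `|cc| <= 100^-1 & `|cd - 1| <= 100^-1], ca * cd - cb * cc = 1 &
    forall c, close_pair X Y ca cb cc cd rho (f c)].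

Lemma sum4_expn_le (F : 'I_4 -> R) N : (forall i, 0 <= F i) ->
  (\sum_i F i) ^+ N <= 4 ^+ N * \sum_i F i ^+ N.
Proof.
move=> F0.
have [i0 hi0] : exists i0, forall i, F i <= F i0.
  have : forall (T : finType) (G : T -> R) (x : T), exists i0, forall i, G i <= G i0.
    move=> T G x; exists [arg max_(i > x) G i]%O => i.
    by case: arg_maxP => // j _; apply.
  by move=> /(_ _ F ord0).
apply: le_trans (_ : (4 * F i0) ^+ N <= _).
  apply: lerXn2r; rewrite ?nnegrE ?mulr_ge0 ?sumr_ge0 //.
  apply: le_trans (_ : \sum_(i < 4) F i0 <= _); first exact: ler_sum.
  by rewrite sumr_const card_ord mulr_natl.
rewrite exprMn; apply: ler_wpM2l; first exact: exprn_ge0.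
rewrite (bigD1 i0) //= lerDl; apply: sumr_ge0 => i _; exact: exprn_ge0.
Qed.

(* [k.+2] points; the exponent [2 * k + 1] is the dimension of the flat. *)
Lemma pair_count_le (k e : nat) (r0 R0 CF a A q : R) :
  0 < r0 -> 1 <= R0 -> 18 * R0 <= 2 ^+ e -> 0 <= CF -> 0 < a -> a < 2^-1 ->
  2 * a < A -> 2^-1 < A -> A < 1 -> 0 < q -> q < 1 -> 2 ^+ k.+1 * A ^+ k.+2 < q ^+ k.+2 ->
  exists2 C : R, 0 < C & forall (J : nat) (S : finType) (X Y mu : S -> R), (4 <= J)%N ->
    (forall x, 0 <= mu x) -> \sum_x mu x <= 1 ->
    (forall x, r0 <= X x) -> (forall x, X x <= R0) -> (forall x, `|Y x| <= X x) ->
    (forall i x, (i <= J)%N ->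
      \sum_x' (dist X Y x x' <= (2 ^+ i)^-1)%R%:R * mu x' <= CF * a ^+ i) ->
    \sum_(f : {ffun 'I_k.+2 -> S * S}) (\prod_c (mu (f c).1 * mu (f c).2)) *
       (`[< close_conf X Y (r0 * (2 ^+ J)^-1 / 2000) f >])%:R
    <= C * (2 ^+ J)^-1 ^+ (2 * k + 1).
Proof.
move=> r00 R01 R0e CF0 a0 a12 aA A12 A1 q0 q1 hq.
have A0 : 0 < A by move: A12; lra.
have a2 : 0 < 1 - 2 * a by move: a12; lra.
have th1 : 2 * a / A < 1 by rewrite ltr_pdivrMr // mul1r.
pose K := 32 * ((CF + 1) / a ^+ e / (1 - 2 * a) / (1 - 2 * a / A)) + 1.
have K0' : 0 <= 32 * ((CF + 1) / a ^+ e / (1 - 2 * a) / (1 - 2 * a / A)).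
  rewrite !mulr_ge0 ?invr_ge0 ?exprn_ge0 ?ler0n //; [by rewrite addr_ge0|exact: ltW|exact: ltW|].
  by rewrite subr_ge0 ltW.
have K0 : 0 < K by rewrite /K; move: K0'; lra.
pose cst := 512 * (2 / (1 - q)) ^+ k.+2 + 1000 * (4 * A ^+ 2 / (4 * A ^+ 2 - 1)) * 2 ^+ k
     / (1 - q) ^+ k.+2 / (1 - 2 ^+ k.+1 * A ^+ k.+2 / q ^+ k.+2).
(* With [n = 8 * K2 * 2 ^ J] directions this gives [R0 / n <= r0 * eps / 2000], the angular
   precision of [chart_action]; the factor [8] serves [dir_count]. *)
pose K2 := (Num.bound (250 * R0 / r0)).
have hK2 : 250 * R0 / r0 < K2%:R.
  by apply: archi_boundP; rewrite divr_ge0 ?mulr_ge0 ?ler0n ?(ltW r00) //; lra.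
have K20 : (0 < K2)%N.
  by rewrite -(ltr_nat R); apply: le_lt_trans hK2;
    rewrite divr_ge0 ?mulr_ge0 ?ler0n ?(ltW r00) //; lra.
pose c0 := 16 * 10000 * (4 * 4 ^+ k.+2 * (`|cst| + 1) * K ^+ k.+2) * (8 * K2%:R) : R.
have K2r : 0 < K2%:R :> R by rewrite ltr0n.
have c00 : 0 < c0.
  rewrite /c0; apply: mulr_gt0; last by rewrite mulr_gt0 // ltr0n.
  apply: mulr_gt0; first by rewrite -natrM ltr0n.
  by apply: mulr_gt0; [apply: mulr_gt0; [apply: mulr_gt0|]|];
    rewrite ?ltr0n ?exprn_gt0 ?ltr0n // ltr_wpDl.
exists c0 => // J S X Y mu J4 mu0 mass Xge Xle YX ball.
set eps := (2 ^+ J)^-1.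
pose H := (2 ^ (3 * J))%N; pose n := (8 * K2 * 2 ^ J)%N.
have p2 : 0 < 2 ^+ J :> R by rewrite exprn_gt0.
have eps0 : 0 < eps by rewrite invr_gt0.
have n0 : (0 < n)%N by rewrite !muln_gt0 K20 expn_gt0.
have K1 : (0 < 8 * K2)%N by rewrite muln_gt0.
have H0 : 0 < H%:R :> R by rewrite ltr0n expn_gt0.
have n0r : 0 < n%:R :> R by rewrite ltr0n.
have nE : n%:R = 8 * K2%:R / eps :> R by rewrite /n !natrM natrX /eps invrK.
have X0 x : 0 < X x by exact: lt_le_trans (Xge x).
have nR0 : R0 / n%:R <= r0 * eps / 2000.
  have -> : R0 / n%:R = R0 / (8 * K2%:R) * eps by rewrite nE; field; rewrite !gt_eqF.
  rewrite [leRHS]mulrAC ler_pM2r // ler_pdivrMr; last by rewrite mulr_gt0 ?ltr0n.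
  have -> : r0 / 2000 * (8 * K2%:R) = K2%:R * r0 / 250 by field.
  by rewrite ler_pdivlMr // mulrC -ler_pdivrMr // ltW.
pose good i := good_dir X Y mu J A K n i.
have K_ge : 32 * ((CF + 1) / a ^+ e / (1 - 2 * a) / (1 - 2 * a / A)) <= K by rewrite lerDl.
have hbad := bad_dir_count mu0 mass X0 YX Xle R01 R0e a0 a12 CF0 ball aA A12 K_ge K0 K1 (erefl n).
pose w (f : {ffun 'I_k.+2 -> S * S}) := \prod_c (mu (f c).1 * mu (f c).2).
have w0 f : 0 <= w f by apply: prodr_ge0 => c _; rewrite mulr_ge0.
pose Z i i' := zsum (8 * H) (fun m => hat H m * zsum (16 * H) (fun g =>
   (\sum_p (mu p.1 * mu p.2) * hit X Y J n i i' m g p) ^+ k.+2)).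
pose rho := (H%:R * eps / 100) ^+ 2 / 2.
have rho0 : 0 < rho by rewrite divr_gt0 // exprn_gt0 // divr_gt0 ?ltr0n // mulr_gt0.
set P := \sum_f _.
(* Expanding the power of the sum over pairs of points gives a sum over pairs of configurations. A
   close one is counted by [n / 8] pairs of directions, and by weight at least [rho] in [(m, g)] for
   each of them. *)
have low : P * (n%:R / 8 * rho) <= \sum_(i < n) \sum_(i' < n) (good i && good i')%:R * Z i i'.
  have eZ : \sum_(i < n) \sum_(i' < n) (good i && good i')%:R * Z i i' =
    \sum_(f : {ffun 'I_k.+2 -> S * S}) w f * \sum_(i < n) \sum_(i' < n) (good i && good i')%:R *
      zsum (8 * H) (fun m => hat H m * zsum (16 * H) (fun g => \prod_c hit X Y J n i i' m g (f c))).
    under [RHS]eq_bigr => f _ do (rewrite mulr_sumr; under eq_bigr => i _ do rewrite mulr_sumr).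
    rewrite [RHS]exchange_big; apply: eq_bigr => i _; rewrite [RHS]exchange_big; apply: eq_bigr =>
      i' _ /=.
    under [RHS]eq_bigr => f _ do rewrite mulrCA.
    rewrite -mulr_sumr; congr (_ * _).
    under [RHS]eq_bigr => f _ do rewrite -zsumZ.
    rewrite -exchange_zsum; apply: eq_zsum => m.
    under [RHS]eq_bigr => f _ do rewrite mulrCA -zsumZ.
    rewrite -mulr_sumr; congr (_ * _); rewrite -exchange_zsum; apply: eq_zsum => g.
    rewrite -[LHS](_ : \prod_(c < k.+2) \sum_p (mu p.1 * mu p.2) * hit X Y J n i i' m g p = _);
      last first.
      by rewrite prodr_const card_ord.
    by rewrite bigA_distr_bigA; apply: eq_bigr => f _; rewrite big_split.
  rewrite eZ /P mulr_suml; apply: ler_sum => f _; rewrite -mulrA; apply: ler_wpM2l; first exact: w0.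
  have inner0 (i i' : 'I_n) : 0 <= zsum (8 * H) (fun m => hat H m *
      zsum (16 * H) (fun g => \prod_c hit X Y J n i i' m g (f c))) :> R.
    apply: zsum_ge0 => m; rewrite mulr_ge0 ?hat_ge0 //; apply: zsum_ge0 => g.
    by apply: prodr_ge0 => c _; exact: hit_ge0.
  case: asboolP => [[ca [cb [cc [cd [[h1 h2 h3 h4] hdet hf]]]]]|_]; last first.
    by rewrite mul0r; do 2! apply: sumr_ge0 => ? _; rewrite mulr_ge0.
  rewrite mul1r.
  have hn8 : n = (8 * (K2 * 2 ^ J))%N by rewrite /n mulnA.
  have cnt := dir_count n0 h1 h2 h3 h4 hdet hn8 hbad.
  apply: le_trans (ler_wpM2r (ltW rho0) cnt) _.
  rewrite mulr_suml; apply: ler_sum => i _; rewrite mulr_suml; apply: ler_sum => i' _.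
  case: (boolP (good i && good i')) => hg /=; last first.
    by rewrite !mul0r.
  rewrite mul1r.
  case: (lerP `|dir n i| (3 / 10 : R)) => hd /=; last by rewrite mul0r.
  case: (lerP `|dir n i' - (cb + dir n i * cd) / (ca + dir n i * cc)| n%:R^-1) => hd' /=;
    last by rewrite mul0r.
  rewrite mul1r; exact: (hit_sum_ge J4 n0 r00 Xge Xle YX nR0 h1 h2 h3 h4 hdet).
(* Each of the four rounding shifts in [hit] is a separate key translation to which [Lam_pow_le]
   applies. *)
have up (i i' : 'I_n) : good i -> good i' -> Z i i' <=
    4 * 4 ^+ k.+2 * (`|cst| * (K ^+ k.+2 * H%:R ^+ 2 * (eps ^+ 2) ^+ k.+2)).
  move=> gi gi'.
  have di : `|dir n i| <= 2^-1 :> R by exact: dir_le.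
  have di' : `|dir n i'| <= 2^-1 :> R by exact: dir_le.
  pose Lm (c : 'I_4) m g := Lam mu (slope X Y (dir n i')) (slope X Y (dir n i))
    (lkey X Y J (dir n i')) (lkey X Y J (dir n i)) (fun m => @key_shift R J m + (c%:Z - 1)) J J m g.
  have Lm0 c m g : 0 <= Lm c m g by exact: corr_ge0.
  have e1 m g : \sum_p (mu p.1 * mu p.2) * hit X Y J n i i' m g p = \sum_(c < 4) Lm c m g.
    rewrite /hit; under eq_bigr => p _ do rewrite mulr_sumr.
    rewrite exchange_big; apply: eq_bigr => c _; rewrite /Lm /Lam /corr pair_big /=.
    by apply: eq_bigr => p _; ring.
  apply: le_trans (_ : \sum_(c < 4) 4 ^+ k.+2 * zsum (8 * H) (fun m => hat H m *
     zsum (16 * H) (fun g => Lm c m g ^+ k.+2)) <= _).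
    rewrite -mulr_sumr -exchange_zsum -zsumZ; apply: ler_zsum => m.
    rewrite -mulr_sumr mulrCA; apply: ler_wpM2l; first exact: hat_ge0.
    rewrite -exchange_zsum -zsumZ; apply: ler_zsum => g; rewrite e1.
    exact: sum4_expn_le.
  apply: le_trans (_ : \sum_(c < 4) 4 ^+ k.+2 * (`|cst| * (K ^+ k.+2 * H%:R ^+ 2 * (eps ^+ 2) ^+
    k.+2)) <= _).
    apply: ler_sum => c _; apply: ler_wpM2l; first exact: exprn_ge0.
    have J0 : (0 < J)%N by exact: leq_trans J4.
    have := @Lam_pow_le R S mu (slope X Y (dir n i')) (slope X Y (dir n i))
      (lkey X Y J (dir n i')) (lkey X Y J (dir n i)) (fun m => @key_shift R J m + (c%:Z - 1))
      J A K J0 mu0 (fun x => slope_le2 X0 YX x di') (fun x => slope_le2 X0 YX x di) A12 A1 K0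
      (fun l => good_dirP gi') (fun l => good_dirP gi) k q q0 q1 hq.
    move/le_trans; apply; apply: ler_wpM2r; last exact: ler_norm.
    by nneg.
  by rewrite sumr_const card_ord -[X in X <= _]mulr_natl mulrA.
have up2 : \sum_(i < n) \sum_(i' < n) (good i && good i')%:R * Z i i' <=
   n%:R ^+ 2 * (4 * 4 ^+ k.+2 * (`|cst| * (K ^+ k.+2 * H%:R ^+ 2 * (eps ^+ 2) ^+ k.+2))).
  set B := 4 * 4 ^+ k.+2 * _ in up *.
  have B0 : 0 <= B.
    by rewrite /B; repeat first [exact: normr_ge0 | progress nneg].
  apply: le_trans (_ : \sum_(i < n) \sum_(i' < n) B <= _).
    apply: ler_sum => i _; apply: ler_sum => i' _.
    case: (boolP (good i && good i')) => [/andP[g1 g2]|_]; last by rewrite mul0r.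
    by rewrite mul1r; exact: up.
  by rewrite !sumr_const !card_ord -mulrnA mulnn -natrX mulr_natl.
(* The upper bound is of order [n ^ 2 * H ^ 2 * eps ^ (2 k + 4)] and the multiplicity of order
   [n * H ^ 2 * eps ^ 2]; with [n] of order [1 / eps] their quotient is [eps ^ (2 k + 1)]. *)
have fin := le_trans low up2.
rewrite -(ler_pM2r (x := n%:R / 8 * rho)); last by rewrite mulr_gt0 // divr_gt0.
apply: le_trans fin _.
have -> : eps ^+ (2 * k + 1) = eps ^+ (2 * k) * eps by rewrite addn1 exprSr.
have -> : (eps ^+ 2) ^+ k.+2 = eps ^+ (2 * k) * eps ^+ 4.
  by rewrite -exprM -exprD; congr (_ ^+ _); clear; lia.
rewrite /c0 /rho nE.
have e2k : 0 <= eps ^+ (2 * k) by rewrite exprn_ge0 // ltW.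
have kk : 0 <= K ^+ k.+2 by rewrite exprn_ge0 // ltW.
have ff : 0 <= (4 : R) ^+ k.+2 by rewrite exprn_ge0.
move: (eps ^+ (2 * k)) e2k (K ^+ k.+2) kk (4 ^+ k.+2) ff => u u0 v v0 z z0.
rewrite -subr_ge0.
have -> : 16 * 10000 * (4 * z * (`|cst| + 1) * v) * (8 * K2%:R) * (u * eps) *
   (8 * K2%:R / eps / 8 * ((H%:R * eps / 100) ^+ 2 / 2)) -
   (8 * K2%:R / eps) ^+ 2 * (4 * z * (`|cst| * (v * H%:R ^+ 2 * (u * eps ^+ 4)))) =
   4 * z * v * u * (8 * K2%:R) ^+ 2 * H%:R ^+ 2 * eps ^+ 2.
  by field; rewrite gt_eqF.
by rewrite !mulr_ge0 ?exprn_ge0 ?mulr_ge0 ?ler0n ?(ltW eps0).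
Qed.

End PairCount.

(** * From pairs of configurations to area types *)

Section Sector.
Context {R : realType} {S : finType}.
Implicit Types (X Y mu : S -> R).

Definition ball_bound X Y mu (CF a : R) N := forall j u v, (j <= N)%N ->
  \sum_x (Num.max `|X x - u| `|Y x - v| <= (2 ^+ j)^-1)%R%:R * mu x <= CF * a ^+ j.

(** The strip is covered by [O(B * 2 ^ i)] balls of radius [2 ^- i] centred on the line [Y = t X].
    For [2 a < 1] the resulting bound tends to [0], which provides pairs of points spanning a
    definite area. *)
Lemma strip_mass X Y mu (CF a B t : R) N i : (forall x, 0 <= mu x) -> ball_bound X Y mu CF a N ->
  (i <= N)%N -> (forall x, 0 <= X x) -> (forall x, X x <= B) -> `|t| <= 1 -> 0 <= B ->
    0 <= CF * a ^+ i ->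
  \sum_x (`|Y x - t * X x| <= (2 ^+ i.+1)^-1)%R%:R * mu x <=
    2 * (Num.bound B)%:R * 2 ^+ i * (CF * a ^+ i).
Proof.
move=> mu0 ball iN X0 XB t1 B0 cf0.
have p0 : 0 < 2 ^+ i.+1 :> R by rewrite exprn_gt0.
pose L := (Num.bound B * 2 ^ i.+1)%N.
apply: le_trans (_ : \sum_(c < L) \sum_x (Num.max `|X x - c%:R / 2 ^+ i.+1| `|Y x
  - t * (c%:R / 2 ^+ i.+1)| <= (2 ^+ i)^-1)%R%:R * mu x <= _); last first.
  apply: le_trans (_ : \sum_(c < L) CF * a ^+ i <= _).
    by apply: ler_sum => c _; exact: ball.
  by rewrite sumr_const card_ord -[X in X <= _]mulr_natl /L natrM natrX exprS; rewrite le_eqVlt;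
    apply/orP; left; apply/eqP; ring.
rewrite exchange_big; apply: ler_sum => x _; rewrite -mulr_suml; apply: ler_wpM2r => //.
case: (boolP (`|Y x - t * X x| <= _)) => [h|_]; last by apply: sumr_ge0 => c _; rewrite ler0n.
have f0 : 0 <= X x * 2 ^+ i.+1 by rewrite mulr_ge0 // ltW.
have /andP[g1 g2] := Num.Theory.truncn_itv f0; set c := Num.truncn _ in g1 g2.
have cL : (c < L)%N.
  rewrite -(ltr_nat R); apply: le_lt_trans g1 _; rewrite /L natrM natrX ltr_pM2r //.
  by apply: le_lt_trans (XB x) _; exact: archi_boundP.
rewrite (bigD1 (Ordinal cL)) //= -[X in X <= _]addr0; apply: lerD; last by apply: sumr_ge0 => ? _;
  rewrite ler0n.
suff -> : (Num.max `|X x - c%:R / 2 ^+ i.+1| `|Y x - t * (c%:R / 2 ^+ i.+1)| <= (2 ^+ i)^-1) by [].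
have e2 : (2 ^+ i)^-1 = (2 ^+ i.+1)^-1 + (2 ^+ i.+1)^-1 :> R.
  by rewrite exprS; field; rewrite gt_eqF // exprn_gt0.
have h1 : `|X x - c%:R / 2 ^+ i.+1| <= (2 ^+ i.+1)^-1.
  rewrite -(ler_pM2r p0) mulVf ?gt_eqF // -[X in _ * X]gtr0_norm // -normrM mulrBl divfK ?gt_eqF //.
  by rewrite ger0_norm ?subr_ge0 // lerBlDl natr1 ltW.
rewrite ge_max e2; apply/andP; split.
  by apply: le_trans h1 _; rewrite lerDl invr_ge0 ltW.
have -> : Y x - t * (c%:R / 2 ^+ i.+1) = (Y x - t * X x) + t * (X x - c%:R / 2 ^+ i.+1) by ring.
apply: le_trans (ler_normD _ _) _; apply: lerD h _; rewrite normrM.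
by apply: le_trans h1; rewrite ler_piMl.
Qed.

Lemma max_norm_le (x y r : R) : (Num.max `|x| `|y| <= r) = (`|x| <= r) && (`|y| <= r).
Proof. exact: ge_max. Qed.

(* One of the four quarter-turns puts at least an eighth of the mass into the sector [|Y| <= X];
   points outside are moved to [(1, 0)] with mass zero. *)
Lemma good_sector X Y mu (CF a B : R) N i0 i1 : (forall x, 0 <= mu x) -> \sum_x mu x = 1 ->
  ball_bound X Y mu CF a N -> (i0 <= N)%N -> (i1 <= N)%N -> CF * a ^+ i0 <= 2^-1 -> 0 <= CF ->
    0 <= a ->
  1 <= B -> (forall x, `|X x| <= B) -> (forall x, `|Y x| <= B) ->
  2 * (Num.bound B)%:R * 2 ^+ i1 * (CF * a ^+ i1) <= 16^-1 ->
  exists X' Y' mu' : S -> R, [/\ [/\ forall x, 0 <= mu' x,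
    \sum_x mu' x <= 1 & ball_bound X' Y' mu' CF a N],
    [/\ forall x, (2 ^+ i0)^-1 <= X' x, forall x, X' x <= B & forall x, `|Y' x| <= X' x],
    forall x x', mu' x != 0 -> mu' x' != 0 -> X' x * Y' x' - Y' x * X' x' = X x * Y x' - Y x * X x',
    8^-1 <= \sum_x mu' x &
    forall x, 16^-1 <= \sum_x' ((2 ^+ i0)^-1 / 2 ^+ i1.+1 <= `|X' x * Y' x'
      - Y' x * X' x'|)%R%:R * mu' x'].
Proof.
move=> mu0 mass ball i0N i1N cf CF0 a0 B1 XB YB strip.
pose r0 : R := (2 ^+ i0)^-1.
have r00 : 0 < r0 by rewrite invr_gt0 exprn_gt0.
pose sec al be x := (r0 <= al * X x + be * Y x) && (`|al * Y x - be * X x| <= al * X x + be * Y x).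
(* The two equations leave only the quarter-turns, which preserve sup-norm balls. The four sectors
   and the ball of radius [2 ^- i0], of mass at most [1/2], cover all points, so one sector has mass
   at least [1/8]. *)
have [al [be [h1 h2 h8]]] : exists al be, [/\ al ^+ 2 + be ^+ 2 = 1, `|al| + `|be| = 1 &
    8^-1 <= \sum_x (sec al be x)%:R * mu x].
  apply: contrapT => none.
  have lt al be : al ^+ 2 + be ^+ 2 = 1 -> `|al| + `|be| = 1 ->
    \sum_x (sec al be x)%:R * mu x < 8^-1.
    by move=> e1 e2; rewrite ltNge; apply/negP => le; apply: none; exists al, be.
  have l1 : \sum_x (sec 1 0 x)%:R * mu x < 8^-1 by apply: lt;
    rewrite ?normr1 ?normr0 ?expr0n ?expr1n ?addr0.
  have l2 : \sum_x (sec (-1) 0 x)%:R * mu x < 8^-1.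
    by apply: lt; rewrite ?normrN1 ?normr0 ?expr0n ?sqrrN ?expr1n ?addr0.
  have l3 : \sum_x (sec 0 1 x)%:R * mu x < 8^-1 by apply: lt;
    rewrite ?normr1 ?normr0 ?expr0n ?expr1n ?add0r.
  have l4 : \sum_x (sec 0 (-1) x)%:R * mu x < 8^-1.
    by apply: lt; rewrite ?normrN1 ?normr0 ?expr0n ?sqrrN ?expr1n ?add0r.
  have := le_trans (ball i0 0 0 i0N) cf.
  have : 1 <= \sum_x (sec 1 0 x)%:R * mu x + \sum_x (sec (-1) 0 x)%:R * mu x
    + \sum_x (sec 0 1 x)%:R * mu x
     + \sum_x (sec 0 (-1) x)%:R * mu x
     + \sum_x (Num.max `|X x - 0| `|Y x - 0| <= (2 ^+ i0)^-1)%R%:R * mu x.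
    rewrite -!big_split -[leLHS]mass; apply: ler_sum => x _ /=; rewrite -!mulrDl;
      apply: ler_peMl => //.
    rewrite -!natrD ler1n -/r0 max_norm_le !subr0 /sec !mul1r !mul0r !mulN1r !addr0 !add0r ?subr0
      ?add0r !normrN.
    rewrite !addn_gt0 !lt0b.
    case: (lerP (`|X x|) r0) => hx; case: (lerP (`|Y x|) r0) => hy; rewrite ?orbT //=;
    case: (lerP `|Y x| `|X x|) => hxy; case: (ler0P (X x)) => x0; case: (ler0P (Y x)) => y0;
    move: hx hy hxy; rewrite ?(ler0_norm x0) ?(gtr0_norm x0) ?(ler0_norm y0) ?(gtr0_norm y0) =>
      hx hy hxy;
    apply/negPn/negP; rewrite !negb_or !negb_and -!ltNge -!andbA; move: hx hy hxy x0 y0; clear;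
      try lra.
  by move: l1 l2 l3 l4; clear; lra.
pose s x := sec al be x.
pose X' x := if s x then al * X x + be * Y x else 1.
pose Y' x := if s x then al * Y x - be * X x else 0.
pose mu' x := (s x)%:R * mu x.
have r01 : r0 <= 1 by rewrite invf_le1 ?exprn_gt0 // exprn_ege1 // ler1n.
have mu'0 x : 0 <= mu' x by rewrite mulr_ge0 ?ler0n.
have X'r x : r0 <= X' x by rewrite /X'; case: ifP => // /andP[].
have X'0 x : 0 < X' x by exact: lt_le_trans (X'r x).
have Y'X x : `|Y' x| <= X' x by rewrite /Y' /X'; case: ifP => [/andP[]//|_]; rewrite normr0.
have X'B x : X' x <= B.
  rewrite /X'; case: ifP => // _; apply: le_trans (ler_norm _) _.
  apply: le_trans (ler_normD _ _) _; rewrite !normrM.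
  apply: le_trans (_ : `|al| * B + `|be| * B <= _); first by apply: lerD; apply: ler_wpM2l.
  by rewrite -mulrDl h2 mul1r.
have ball' : ball_bound X' Y' mu' CF a N.
  move=> j u v jN; apply: le_trans (ball j (al * u - be * v) (al * v + be * u) jN).
  apply: ler_sum => x _; rewrite /mu' /X' /Y'; case: (s x); last first.
    by rewrite mul0r mulr0 mulr_ge0 ?ler0n.
  rewrite mul1r ler_wpM2r // !max_norm_le ler_nat.
  case: (boolP (_ && _)) => // /andP[g1 g2].
  suff -> : (`|X x - (al * u - be * v)| <= (2 ^+ j)^-1) && (`|Y x - (al * v + be * u)| <=
    (2 ^+ j)^-1) by [].
  have b (p q : R) : `|p| + `|q| = 1 -> forall d e, `|d| <= (2 ^+ j)^-1 -> `|e| <= (2 ^+ j)^-1 ->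
      `|p * d + q * e| <= (2 ^+ j)^-1.
    move=> pq d e hd he; apply: le_trans (ler_normD _ _) _; rewrite !normrM.
    apply: le_trans (_ : `|p| * (2 ^+ j)^-1 + `|q| * (2 ^+ j)^-1 <= _); first by apply: lerD;
      apply: ler_wpM2l.
    by rewrite -mulrDl pq mul1r.
  have E1 : X x - (al * u - be * v) = al * (al * X x + be * Y x - u) + (- be) * (al * Y x
    - be * X x - v).
    by rewrite -[X in X - _ = _]mul1r -h1; ring.
  have E2 : Y x - (al * v + be * u) = be * (al * X x + be * Y x - u) + al * (al * Y x - be * X x
    - v).
    by rewrite -[X in X - _ = _]mul1r -h1; ring.
  by rewrite E1 E2 !b ?normrN // addrC.
exists X', Y', mu'; split; [split=> //|split=> //| |exact: h8|].
- by rewrite -mass; apply: ler_sum => x _; rewrite ler_piMl // lern1 leq_b1.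
- move=> x x'; rewrite /mu' /X' /Y'; case: (s x); last by rewrite mul0r eqxx.
  case: (s x') => [_ _|_]; last by rewrite mul0r eqxx.
  by rewrite -[RHS]mul1r -h1; ring.
(* A small area with [x] puts [x'] in a strip around the line through the origin and [x]; the strip
   has mass at most [1/16], out of at least [1/8]. *)
move=> x; rewrite -/r0.
pose t := Y' x / X' x.
have t1 : `|t| <= 1 by rewrite normrM normfV (gtr0_norm (X'0 x)) ler_pdivrMr // mul1r.
have st := strip_mass mu'0 ball' i1N (fun x => ltW (X'0 x)) X'B t1 (le_trans ler01 B1)
   (mulr_ge0 CF0 (exprn_ge0 _ a0)).
have {}st := le_trans st strip.
have {}h8 : 8^-1 <= \sum_x mu' x by [].
suff : \sum_x' mu' x' <= \sum_x' (r0 / 2 ^+ i1.+1 <= `|X' x * Y' x' - Y' x * X' x'|)%R%:R * mu' x' +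
  \sum_x' (`|Y' x' - t * X' x'| <= (2 ^+ i1.+1)^-1)%R%:R * mu' x'.
  by move: h8 st; clear; lra.
rewrite -big_split; apply: ler_sum => x' _ /=; rewrite -mulrDl; apply: ler_peMl => //.
rewrite -natrD ler1n addn_gt0 !lt0b; case: lerP => //= h.
rewrite -(ler_pM2l (X'0 x)) -[X in X * `|_|]gtr0_norm // -normrM.
have -> : X' x * (Y' x' - t * X' x') = X' x * Y' x' - Y' x * X' x'.
  by rewrite /t; field; rewrite gt_eqF.
apply: le_trans (ltW h) _; apply: ler_wpM2r => //.
Qed.

End Sector.

Section FrameChange.
Context {R : realType}.

Lemma norm_div_le (x a B r : R) : 0 < r -> r <= `|a| -> `|x| <= B -> `|x / a| <= B / r.
Proof.
move=> r0 ra xB; have a0 : 0 < `|a| by exact: lt_le_trans ra.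
rewrite normrM normfV ler_pdivrMr // mulrAC ler_pdivlMr //.
by apply: ler_pM => //; rewrite ltW.
Qed.

Lemma norm_mul_le (x y B C : R) : `|x| <= B -> `|y| <= C -> `|x * y| <= B * C.
Proof. by move=> *; rewrite normrM; exact: ler_pM. Qed.

(* Compose the normalizer of one configuration with the inverse normalizer of the other. *)
Lemma frame_change (I : Type) (i0 i1 : I) (U V U' V' : I -> R) (B r d e : R) :
  let a := U i0 * V i1 - V i0 * U i1 in let a' := U' i0 * V' i1 - V' i0 * U' i1 in
  0 < r -> r <= `|a| -> r <= `|a'| -> `|a - a'| <= e ->
  (forall i, [/\ `|U i| <= B, `|V i| <= B, `|U' i| <= B & `|V' i| <= B]) ->
  [/\ `|U' i0 - U i0| <= d, `|V' i0 - V i0| <= d, `|U' i1 - U i1| <= d & `|V' i1 - V i1| <= d] ->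
  2 * (B / r * d) + B * (B / r * (e / r)) <= 100^-1 ->
  (forall i, `|(U i * V i1 - V i * U i1) / a - (U' i * V' i1 - V' i * U' i1) / a'| <= e) ->
  (forall i, `|(U i0 * V i - V i0 * U i) - (U' i0 * V' i - V' i0 * U' i)| <= e) ->
  exists ca cb cc cd : R, [/\ [/\ `|ca - 1| <= 100^-1, `|cb| <= 100^-1,
    `|cc| <= 100^-1 & `|cd - 1| <= 100^-1], ca * cd - cb * cc = 1 &
    forall i, `|ca * U i + cb * V i - U' i| <= e * B + e * (B / r) /\
      `|cc * U i + cd * V i - V' i| <= e * B + e * (B / r)].
Proof.
move=> a a' r0 ra ra' aa UB [dU0 dV0 dU1 dV1] small h1 h2.
have a0 : a != 0 by rewrite -normr_gt0; exact: lt_le_trans ra.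
have a'0 : a' != 0 by rewrite -normr_gt0; exact: lt_le_trans ra'.
exists (V i1 / a * U' i0 - V i0 / a' * U' i1), (U i0 / a' * U' i1 - U i1 / a * U' i0),
  (V i1 / a * V' i0 - V i0 / a' * V' i1), (U i0 / a' * V' i1 - U i1 / a * V' i0).
have near (p q w w0 z z0 : R) : `|p| <= B -> `|q| <= B -> `|z| <= B ->
    `|w - w0| <= d -> `|z - z0| <= d ->
      `|p / a * w - q / a' * z - (p / a * w0 - q / a * z0)| <= 100^-1.
  move=> pB qB zB wd zd; apply: le_trans small.
  have -> : p / a * w - q / a' * z - (p / a * w0 - q / a * z0) =
     p / a * (w - w0) + (- q / a * (z - z0) + - q * (z / a' * ((a - a') / a))).
    by field; rewrite a0 a'0.
  have q'B : `|- q| <= B by rewrite normrN.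
  have -> : 2 * (B / r * d) = B / r * d + B / r * d by ring.
  rewrite -[leRHS]addrA.
  apply: le_trans (ler_normD _ _) _; apply: lerD; first by apply: norm_mul_le => //;
    exact: norm_div_le.
  apply: le_trans (ler_normD _ _) _; apply: lerD; first by apply: norm_mul_le => //;
    exact: norm_div_le.
  by do 2! (apply: norm_mul_le; rewrite ?norm_div_le //).
have [U0 V0 U0' V0'] := UB i0; have [U1 V1 U1' V1'] := UB i1.
split; [split| |move=> i].
- have E : 1 = V i1 / a * U i0 - V i0 / a * U i1 by rewrite -(divff a0) {1}/a; field.
  by rewrite [X in `|_ - X|]E; exact: near.
- have := near (U i1) (U i0) (U' i0) (U i0) (U' i1) (U i1) U1 U0 U1' dU0 dU1.
  have -> : U i1 / a * U i0 - U i0 / a * U i1 = 0 by ring.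
  by rewrite subr0 distrC.
- have := near (V i1) (V i0) (V' i0) (V i0) (V' i1) (V i1) V1 V0 V1' dV0 dV1.
  have -> : V i1 / a * V i0 - V i0 / a * V i1 = 0 by ring.
  by rewrite subr0.
- have := near (U i1) (U i0) (V' i0) (V i0) (V' i1) (V i1) U1 U0 V1' dV0 dV1.
  have -> : U i1 / a * V i0 - U i0 / a * V i1 = - 1 by rewrite -(divff a0) {3}/a; field.
  by move=> h; rewrite -normrN; apply: le_trans h; rewrite le_eqVlt; apply/orP; left; apply/eqP;
    congr `|_|; ring.
- have -> : (V i1 / a * U' i0 - V i0 / a' * U' i1) * (U i0 / a' * V' i1 - U i1 / a * V' i0) -
   (U i0 / a' * U' i1 - U i1 / a * U' i0) * (V i1 / a * V' i0 - V i0 / a' * V' i1) =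
   (U i0 * V i1 - V i0 * U i1) / a * ((U' i0 * V' i1 - V' i0 * U' i1) / a').
    by field; rewrite a0 a'0.
  by rewrite -/a -/a' !divff // mulr1.
have [Ui Vi Ui' Vi'] := UB i.
split.
- have -> : (V i1 / a * U' i0 - V i0 / a' * U' i1) * U i + (U i0 / a' * U' i1
  - U i1 / a * U' i0) * V i - U' i =
   ((U i * V i1 - V i * U i1) / a - (U' i * V' i1 - V' i * U' i1) / a') * U' i0 +
   ((U i0 * V i - V i0 * U i) - (U' i0 * V' i - V' i0 * U' i)) * (U' i1 / a').
    rewrite [X in _ - X = _](_ : U' i = U' i * ((U' i0 * V' i1 - V' i0 * U' i1) / a')).
      by field; rewrite a0 a'0.
    by rewrite -/a' divff // mulr1.
  apply: le_trans (ler_normD _ _) _; apply: lerD; apply: norm_mul_le => //; exact: norm_div_le.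
- have -> : (V i1 / a * V' i0 - V i0 / a' * V' i1) * U i + (U i0 / a' * V' i1
  - U i1 / a * V' i0) * V i - V' i =
   ((U i * V i1 - V i * U i1) / a - (U' i * V' i1 - V' i * U' i1) / a') * V' i0 +
   ((U i0 * V i - V i0 * U i) - (U' i0 * V' i - V' i0 * U' i)) * (V' i1 / a').
    rewrite [X in _ - X = _](_ : V' i = V' i * ((U' i0 * V' i1 - V' i0 * U' i1) / a')).
      by field; rewrite a0 a'0.
    by rewrite -/a' divff // mulr1.
  apply: le_trans (ler_normD _ _) _; apply: lerD; apply: norm_mul_le => //; exact: norm_div_le.
Qed.

(** Sorting configurations by the cells of their first two points costs a factor independent of [J],
    and makes the matrix of [frame_change] close to the identity. *)
Lemma finite_cells (B d : R) : 0 < B -> 0 < d -> exists (M : nat) (c : R -> 'I_M.+1),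
  forall x y, `|x| <= B -> `|y| <= B -> c x = c y -> `|x - y| <= d.
Proof.
move=> B0 d0; pose M := Num.bound (2 * B / d).
exists M, (fun x => inord (Num.truncn ((x + B) / d))) => x y xB yB.
have pos z : `|z| <= B -> 0 <= (z + B) / d.
  by move=> zB; rewrite divr_ge0 ?(ltW d0) //; move: zB; rewrite ler_norml; lra.
have lt z : `|z| <= B -> (Num.truncn ((z + B) / d) < M.+1)%N.
  move=> zB; rewrite ltnS ltnW // -(ltr_nat R); have /andP[h _] := Num.Theory.truncn_itv (pos z zB).
  apply: le_lt_trans h _; apply: le_lt_trans (_ : 2 * B / d < _).
    by rewrite ler_pM2r ?invr_gt0 //; move: zB; rewrite ler_norml; lra.
  by apply: archi_boundP; rewrite divr_ge0 ?mulr_ge0 ?(ltW d0) ?(ltW B0).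
move/(congr1 (@nat_of_ord _)); rewrite !inordK ?lt // => e.
have /andP[h1 h2] := Num.Theory.truncn_itv (pos x xB);
  have /andP[] := Num.Theory.truncn_itv (pos y yB).
rewrite -e => h3 h4.
rewrite -(ler_pM2r (x := d^-1)) ?invr_gt0 // divff ?gt_eqF // -[X in _ * X]gtr0_norm ?invr_gt0 //
  -normrM.
rewrite mulrBl; move: h1 h2 h3 h4; rewrite -natr1 !mulrDl ler_norml; lra.
Qed.

End FrameChange.

Section CountingKeys.
Context {R : realType}.

(* Cauchy-Schwarz over the fibres of [kx] *)
Lemma sqr_mass_le (I : finType) (K : eqType) (kx : I -> K) (keys : seq K) (w : I -> R) :
  (forall i, 0 <= w i) -> (forall i, w i != 0 -> kx i \in keys) ->
  (\sum_i w i) ^+ 2 <= (size keys)%:R * \sum_i \sum_i' (kx i == kx i')%:R * (w i * w i').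
Proof.
move=> w0 wk; pose D := undup keys; pose W k := \sum_i (kx i == k)%:R * w i.
have wD i : w i != 0 -> kx i \in D by move=> /wk; rewrite mem_undup.
have e1 : \sum_i w i = \sum_(k <- D) W k.
  rewrite exchange_big; apply: eq_bigr => i _; have [->|wi] := eqVneq (w i) 0.
    by rewrite big1 // => k _; rewrite mulr0.
  rewrite (bigD1_seq (kx i)) ?undup_uniq ?wD //= eqxx mul1r big1 ?addr0 // => l.
  by rewrite eq_sym => /negbTE ->; rewrite mul0r.
have e2 := sum_keys kx w (undup_uniq keys) wD.
rewrite e1 e2 -/W; under [X in _ * X]eq_bigr => k _ do rewrite -expr2.
apply: le_trans (_ : (size D)%:R * \sum_(k <- D) W k ^+ 2 <= _); last first.
  rewrite ler_wpM2r ?sumr_ge0 // => [k _|]; first exact: sqr_ge0.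
  by rewrite ler_nat size_undup.
have dbl : \sum_(k <- D) \sum_(l <- D) (W k ^+ 2 + W l ^+ 2) =
  2 * ((size D)%:R * \sum_(k <- D) W k ^+ 2).
  under eq_bigr => k _ do rewrite big_split /= big_const_seq count_predT iter_addr_0 -mulr_natl.
  by rewrite big_split /= -mulr_sumr big_const_seq count_predT iter_addr_0 -mulr_natl; ring.
rewrite -(ler_pM2l (x := 2)) // -dbl expr2 big_distrlr mulr_sumr; apply: ler_sum => k _.
rewrite mulr_sumr; apply: ler_sum => l _; rewrite -subr_ge0.
have -> : W k ^+ 2 + W l ^+ 2 - 2 * (W k * W l) = (W k - W l) ^+ 2 by ring.
exact: sqr_ge0.
Qed.

(** The factor [g] is not a product over the indices. Summing over the values [u], [v] at the first
    two indices, recorded by indicators [h], makes it one, and distributivity applies. *)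
Lemma sum_ffun2 (S : finType) (mu : S -> R) (g : S -> S -> R) k :
  \sum_(f : {ffun 'I_k.+2 -> S}) g (f ord0) (f (inord 1)) * \prod_c mu (f c) =
  (\sum_u \sum_v g u v * (mu u * mu v)) * (\sum_x mu x) ^+ k.
Proof.
pose h (u v : S) (c : 'I_k.+2) (x : S) : R :=
  if c == ord0 then (x == u)%:R else if c == inord 1 then (x == v)%:R else 1.
have n10 : inord 1 != ord0 :> 'I_k.+2 by rewrite -val_eqE /= inordK.
have e1 (f : {ffun 'I_k.+2 -> S}) : g (f ord0) (f (inord 1)) * \prod_c mu (f c) =
   \sum_u \sum_v g u v * \prod_c (h u v c (f c) * mu (f c)).
  rewrite (bigD1 (f ord0)) //= (bigD1 (f (inord 1))) //= [X in _ + X + _]big1 => [|v vn];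
    last first.
    by rewrite (bigD1 (inord 1)) //= /h (negbTE n10) eqxx eq_sym (negbTE vn) !mul0r mulr0.
  rewrite [X in _ + X]big1 => [|u un]; last first.
    by rewrite big1 // => v _; rewrite (bigD1 ord0) //= /h eqxx eq_sym (negbTE un) !mul0r mulr0.
  rewrite !addr0; congr (_ * _); apply: eq_bigr => c _; rewrite /h.
  by case: eqP => [->|_]; [rewrite eqxx mul1r|case: eqP => [->|_]; rewrite ?eqxx mul1r].
under eq_bigr => f _ do rewrite e1.
rewrite exchange_big mulr_suml; apply: eq_bigr => u _; rewrite exchange_big mulr_suml;
  apply: eq_bigr => v _ /=.
rewrite -mulr_sumr -(bigA_distr_bigA (fun c x => h u v c x * mu x)) -mulrA; congr (_ * _).
rewrite (bigD1 ord0) //= (bigD1 (inord 1)) //= mulrA; congr (_ * _ * _).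
- by rewrite (bigD1 u) //= /h !eqxx mul1r big1 ?addr0 // => x /negbTE ->; rewrite mul0r.
- rewrite (bigD1 v) //= /h (negbTE n10) !eqxx mul1r big1 ?addr0 // => x /negbTE ->;
  by rewrite mul0r.
transitivity (\prod_(c < k.+2 | (c != ord0) && (c != inord 1)) \sum_x mu x).
  by apply: eq_bigr => c /andP[c0 c1]; apply: eq_bigr => x _;
    rewrite /h (negbTE c0) (negbTE c1) mul1r.
rewrite prodr_const; congr (_ ^+ _).
have := cardC (pred2 ord0 (inord 1 : 'I_k.+2)).
rewrite card2 eq_sym n10 card_ord => /eqP; rewrite eqn_add2l => /eqP; apply: etrans.
by apply: eq_card => c; rewrite !inE negb_or.
Qed.

Lemma sum_ffun_pair (S : finType) N (F : {ffun 'I_N -> S} -> {ffun 'I_N -> S} -> R) :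
  \sum_f \sum_f' F f f' = \sum_(h : {ffun 'I_N -> S * S}) F [ffun c => (h c).1] [ffun c => (h c).2].
Proof.
rewrite pair_bigA (reindex (fun h : {ffun 'I_N -> S * S} => ([ffun c => (h c).1], [ffun c =>
  (h c).2]))) //=.
exists (fun p : {ffun 'I_N -> S} * {ffun 'I_N -> S} => [ffun c => (p.1 c, p.2 c)]) =>
  [h _|[f f'] _].
  by apply/ffunP => c; rewrite !ffunE; case: (h c).
by congr pair; apply/ffunP => c; rewrite !ffunE.
Qed.

Lemma expn_lt_eps (c x e : R) : 0 <= c -> 0 <= x -> x < 1 -> 0 < e -> exists n, c * x ^+ n <= e.
Proof.
move=> c0 x0 x1 e0; have c1 : 0 < c + 1 by rewrite ltr_wpDl.
have : `|x| < 1 by rewrite ger0_norm.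
move/cvg_expr/cvgrPdist_le => /(_ _ (divr_gt0 e0 c1))[n _ /(_ n (leqnn n)) h]; exists n.
apply: le_trans (_ : (c + 1) * x ^+ n <= _); first by rewrite ler_wpM2r ?exprn_ge0 // lerDl.
by rewrite mulrC -ler_pdivlMr //; apply: le_trans h; rewrite sub0r normrN ler_norm.
Qed.

End CountingKeys.

Section AreaTypeCount.
Context {R : realType}.

(* The coordinates of [A x] in the flat, for the points [x i = (U i, V i)]. *)
Definition area_coord k (U V : 'I_k.+2 -> R) (m : nat) : R :=
  let i := inord (m + 3)./2 in
  if odd (m + 3) then U ord0 * V i - V ord0 * U i
  else (U i * V (inord 1) - V i * U (inord 1)) / (U ord0 * V (inord 1) - V ord0 * U (inord 1)).

(** The coordinates of the flat omit three normalized coordinates of the first two points; these are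
    constants, so the comparison holds for all indices [i]. *)
Lemma area_coord_diff k (U V U' V' : 'I_k.+2 -> R) (e : R) : 0 <= e ->
  let a := U ord0 * V (inord 1) - V ord0 * U (inord 1) in
  let a' := U' ord0 * V' (inord 1) - V' ord0 * U' (inord 1) in
  a != 0 -> a' != 0 ->
  (forall m, (m < k.*2.+1)%N -> `|area_coord U V m - area_coord U' V' m| <= e) ->
  [/\ `|a - a'| <= e,
    forall i, `|(U i * V (inord 1) - V i * U (inord 1)) / a - (U' i * V' (inord 1)
      - V' i * U' (inord 1)) / a'| <= e &
    forall i, `|(U ord0 * V i - V ord0 * U i) - (U' ord0 * V' i - V' ord0 * U' i)| <= e].
Proof.
move=> e0 a a' a0 a'0 h.
(* Coordinate [0] of the flat is the area of the first two points. *)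
have haa : `|a - a'| <= e by have := h 0%N isT.
split=> // i.
- case: (ltngtP i 1) => i1.
  + have -> : i = ord0 by apply: val_inj => /=; move: i1; case: (nat_of_ord i).
    by rewrite -/a -/a' !divff // subrr normr0.
  + have := h (i.*2 - 3)%N; rewrite /area_coord subnK; last by move: i1; clear; lia.
    rewrite odd_double doubleK inord_val; apply.
    by have := ltn_ord i; clear; lia.
  + have -> : i = inord 1 by apply: val_inj; rewrite /= inordK.
    by rewrite ![V _ * U _]mulrC ![V' _ * U' _]mulrC !subrr !mul0r subrr normr0.
- case: (posnP i) => [i0|i0].
    have -> : i = ord0 by apply: val_inj.
    by rewrite ![V _ * U _]mulrC ![V' _ * U' _]mulrC !subrr normr0.
  have := h (i.*2 - 2)%N; rewrite /area_coord.
  have -> : (i.*2 - 2 + 3 = i.*2.+1)%N by move: i0; clear; lia.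
  rewrite /= odd_double uphalf_double inord_val; apply.
  by have := ltn_ord i; clear; lia.
Qed.

(** The constant [M] refines the precision [2 ^- J], so that equal keys meet the small tolerances of
    [frame_change] and [close_conf]. *)
Definition area_key k (M J : nat) (U V : 'I_k.+2 -> R) : {ffun 'I_(k.*2.+1) -> int} :=
  [ffun m : 'I_(k.*2.+1) => Num.floor (area_coord U V m * (M%:R * 2 ^+ J))].

Lemma area_key_diff k M J (U V U' V' : 'I_k.+2 -> R) m : (0 < M)%N -> (m < k.*2.+1)%N ->
  area_key M J U V = area_key M J U' V' ->
    `|area_coord U V m - area_coord U' V' m| <= (M%:R * 2 ^+ J)^-1.
Proof.
move=> M0 mk /ffunP/(_ (Ordinal mk)); rewrite !ffunE /=.
have p0 : 0 < M%:R * 2 ^+ J :> R by rewrite mulr_gt0 ?ltr0n ?exprn_gt0.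
move: (M%:R * 2 ^+ J) p0 => p p0 e.
have /andP[h1 h2] := floor_itv (area_coord U V m * p);
  have /andP[] := floor_itv (area_coord U' V' m * p).
rewrite -e => h3 h4.
rewrite -(ler_pM2r p0) mulVf ?gt_eqF // -[X in _ * X]gtr0_norm // -normrM mulrBl.
move: h1 h2 h3 h4; rewrite intrD ler_norml; lra.
Qed.

(** [sqr_mass_le] is applied to the key made of the cells of the first two points and the rounded
    area type. Equal keys give a [close_conf] by [frame_change], so the correlation is bounded by
    [pair_count_le]. Restricting to first areas at least [r1] bounds the denominators. *)
Lemma area_type_count k (CF a B A q : R) : 1 <= B -> 0 <= CF -> 0 < a -> a < 2^-1 ->
  2 * a < A -> 2^-1 < A -> A < 1 -> 0 < q -> q < 1 -> 2 ^+ k.+1 * A ^+ k.+2 < q ^+ k.+2 ->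
  exists (r1 : R) (M : nat) (c : R) (J0 : nat), [/\ 0 < r1, (0 < M)%N, 0 < c &
    forall J (S : finType) (X Y mu : S -> R) (Q : seq {ffun 'I_(k.*2.+1) -> int}),
    (J0 <= J)%N -> (forall x, 0 <= mu x) -> \sum_x mu x = 1 -> ball_bound X Y mu CF a J ->
    (forall x, `|X x| <= B) -> (forall x, `|Y x| <= B) ->
    (forall f : 'I_k.+2 -> S,
       r1 <= `|X (f ord0) * Y (f (inord 1)) - Y (f ord0) * X (f (inord 1))| ->
       area_key M J (X \o f) (Y \o f) \in Q) ->
    c * (2 ^+ J) ^+ (2 * k + 1) <= (size Q)%:R].
Proof.
move=> B1 CF0 a0 a12 aA A12 A1 q0 q1 hq.
have a1 : a < 1 by move: a12; lra.
have B0 : 0 < B by exact: lt_le_trans B1.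
have [i0 hi0] : exists i0, CF * a ^+ i0 <= 2^-1 by apply: expn_lt_eps; rewrite ?invr_gt0 // ltW.
have [i1 hi1] : exists i1, 2 * (Num.bound B)%:R * 2 ^+ i1 * (CF * a ^+ i1) <= 16^-1.
  have [||||n hn] := @expn_lt_eps R (2 * (Num.bound B)%:R * CF) (2 * a) 16^-1.
  - by rewrite !mulr_ge0 ?ler0n.
  - by rewrite mulr_ge0 ?ler0n // ltW.
  - by move: a12; lra.
  - by rewrite invr_gt0 ltr0n.
  by exists n; apply: le_trans hn; rewrite exprMn le_eqVlt; apply/orP; left; apply/eqP; ring.
pose r0 : R := (2 ^+ i0)^-1; pose r1 : R := r0 / 2 ^+ i1.+1.
have r00 : 0 < r0 by rewrite invr_gt0 exprn_gt0.
have r10 : 0 < r1 by rewrite divr_gt0 // exprn_gt0.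
pose e := Num.bound (18 * B).
have he : 18 * B <= 2 ^+ e.
  apply: le_trans (ltW (archi_boundP _)) _; first by rewrite mulr_ge0 ?ler0n ?ltW.
  by rewrite -natrX ler_nat ltnW // ltn_expl.
have [C C0 hC] := pair_count_le r00 B1 he CF0 a0 a12 aA A12 A1 q0 q1 hq.
(* Then [2 * (B / r1 * d) = 1/200], half of the tolerance [1/100] of [frame_change]. *)
pose d := r1 / (400 * B).
have pos n : 0 < n.+1%:R :> R by rewrite ltr0n.
have d0 : 0 < d := divr_gt0 r10 (mulr_gt0 (pos 399%N) B0).
have [Mc [cell hcell]] := finite_cells B0 d0.
(* [M > b1] brings the displacement below [r0 * eps / 2000], and [M > b2] keeps the effect of
   replacing [a] by [a'] below [1/200]. *)
pose b1 := 2000 * (B + B / r1) / r0; pose b2 := 200 * (B * (B / r1 / r1)).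
have b10 : 0 < b1 := divr_gt0 (mulr_gt0 (pos 1999%N) (addr_gt0 B0 (divr_gt0 B0 r10))) r00.
have b20 : 0 < b2 := mulr_gt0 (pos 199%N) (mulr_gt0 B0 (divr_gt0 (divr_gt0 B0 r10) r10)).
pose M := (Num.bound (b1 + b2)).
have hM : b1 + b2 < M%:R by apply: archi_boundP; rewrite addr_ge0 // ltW.
have M0r : 0 < M%:R :> R by apply: lt_trans hM; exact: addr_gt0.
have M0 : (0 < M)%N by rewrite -(ltr_nat R).
pose T : finType := ('I_Mc.+1 * 'I_Mc.+1 * ('I_Mc.+1 * 'I_Mc.+1))%type.
have T0 : 0 < #|T|%:R :> R by rewrite ltr0n !card_prod !card_ord.
(* From [good_sector]: mass [1/8] for the first point, [1/16] for a second one spanning enough area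
   with it, and [1/8] for each other point. *)
pose m0 : R := 8^-1 * 16^-1 * 8^-1 ^+ k.
have m00 : 0 < m0 by rewrite !mulr_gt0 ?exprn_gt0 ?invr_gt0 ?ltr0n.
exists r1, M, (m0 ^+ 2 / (#|T|%:R * C)), (4 + i0 + i1)%N; split=> //.
  by rewrite divr_gt0 ?exprn_gt0 ?mulr_gt0.
move=> J S X Y mu Q J0 mu0 mass ball XB YB keysQ.
have J4 : (4 <= J)%N by move: J0; clear; lia.
have i0J : (i0 <= J)%N by move: J0; clear; lia.
have i1J : (i1 <= J)%N by move: J0; clear; lia.
have [X' [Y' [w [[w0 w1 wball] [Xge Xle YX] wedge w8 pairs]]]] :=
  good_sector mu0 mass ball i0J i1J hi0 CF0 (ltW a0) B1 XB YB hi1.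
have X'B x : `|X' x| <= B by rewrite ger0_norm ?Xle // ltW // (lt_le_trans r00 (Xge x)).
have Y'B x : `|Y' x| <= B by exact: le_trans (YX x) (Xle x).
set p2 : R := 2 ^+ J; have p20 : 0 < p2 by rewrite exprn_gt0.
have wball' i x : (i <= J)%N -> \sum_x' (dist X' Y' x x' <= (2 ^+ i)^-1)%R%:R * w x' <= CF * a ^+ i.
  move/(wball i (X' x) (Y' x)); apply: le_trans; rewrite le_eqVlt; apply/orP; left; apply/eqP.
  by apply: eq_bigr => x' _; rewrite /dist (distrC (X' x)) (distrC (Y' x)).
have := hC J S X' Y' w J4 w0 w1 Xge Xle YX wball'; rewrite -/p2.
set P := \sum_f _ => hP.
pose n01 : 'I_k.+2 := inord 1.
pose good u v : R := (r1 <= `|X' u * Y' v - Y' u * X' v|)%R%:R.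
pose W (f : {ffun 'I_k.+2 -> S}) := good (f ord0) (f n01) * \prod_c w (f c).
have W0 f : 0 <= W f by rewrite mulr_ge0 ?ler0n // prodr_ge0.
have massW : m0 <= \sum_f W f.
  rewrite /W /n01 (@sum_ffun2 R S w good) /m0.
  apply: ler_pM; rewrite ?mulr_ge0 ?exprn_ge0 ?invr_ge0 ?ler0n //; last by apply: lerXn2r;
    rewrite // nnegrE ?invr_ge0 ?ler0n // sumr_ge0.
  apply: le_trans (_ : (\sum_u w u) * 16^-1 <= _); first by rewrite ler_wpM2r ?invr_ge0 ?ler0n.
  rewrite mulr_suml; apply: ler_sum => u _.
  under eq_bigr => v _ do rewrite mulrCA.
  by rewrite -mulr_sumr ler_wpM2l //; exact: pairs.
pose kx (f : {ffun 'I_k.+2 -> S}) := (((cell (X' (f ord0)), cell (Y' (f ord0))),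
  (cell (X' (f n01)), cell (Y' (f n01)))),
   area_key M J (X' \o f) (Y' \o f)).
pose keys := [seq (t, q') | t <- enum T, q' <- Q].
have keysP f : W f != 0 -> kx f \in keys.
  rewrite mulf_eq0 negb_or prodf_seq_neq0 => /andP[gd /allP/= nz].
  have nz' c : w (f c) != 0 by apply: (nz c); rewrite mem_index_enum.
  apply: allpairs_f; first by rewrite mem_enum.
  (* Area types are built from determinants, which the quarter-turn preserves on the support of
     [w]. *)
  have -> : area_key M J (X' \o f) (Y' \o f) = area_key M J (X \o f) (Y \o f).
    by apply/ffunP => m; rewrite !ffunE /area_coord /= !wedge.
  apply: keysQ; move: gd; rewrite /good -wedge //; case: (r1 <= _) => //.
  by rewrite eqxx.
have hCS := sqr_mass_le W0 keysP.
have bnd : \sum_f \sum_f' (kx f == kx f')%:R * (W f * W f') <= P.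
  rewrite (sum_ffun_pair (fun f f' => (kx f == kx f')%:R * (W f * W f'))).
  apply: ler_sum => h _; set f := [ffun c => (h c).1]; set f' := [ffun c => (h c).2].
  have wE : \prod_c (w (h c).1 * w (h c).2) = \prod_c w (f c) * \prod_c w (f' c).
    by rewrite -big_split; apply: eq_bigr => c _; rewrite !ffunE.
  have wp : 0 <= \prod_c w (f c) * \prod_c w (f' c) by rewrite mulr_ge0 ?prodr_ge0.
  rewrite wE /W /good.
  case: eqP => [ke|_]; last by rewrite mul0r mulr_ge0 ?ler0n.
  case: (lerP r1 `|X' (f ord0) * _ - _|) => [g1|_]; last by rewrite !mul0r mulr0 mulr_ge0 ?ler0n.
  case: (lerP r1 `|X' (f' ord0) * _ - _|) => [g2|_]; last by rewrite !mul0r !mulr0 mulr_ge0 ?ler0n.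
  rewrite !mul1r.
  case: asboolP => [_|]; first by rewrite mulr1.
  case.
  have [ke1 ke2 ke3 ke4 kea] : [/\ cell (X' (f ord0)) = cell (X' (f' ord0)),
    cell (Y' (f ord0)) = cell (Y' (f' ord0)),
     cell (X' (f n01)) = cell (X' (f' n01)), cell (Y' (f n01)) = cell (Y' (f' n01)) &
     area_key M J (X' \o f) (Y' \o f) = area_key M J (X' \o f') (Y' \o f')] by case: ke =>
       -> -> -> -> ->.
  pose e2 := (M%:R * p2)^-1.
  have e20 : 0 <= e2 by rewrite invr_ge0 mulr_ge0 // ltW.
  have n0 (x : R) : r1 <= `|x| -> x != 0 by move=> h1; rewrite -normr_gt0; exact: lt_le_trans h1.
  have [d1 d2 d3] := @area_coord_diff k (X' \o f) (Y' \o f) (X' \o f') (Y' \o f') e2 e20 (n0 _ g1)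
    (n0 _ g2)
    (fun m mk => area_key_diff M0 mk kea).
  have p21 : 1 <= p2 by rewrite exprn_ege1 // ler1n.
  have e2M : e2 <= M%:R^-1 by rewrite lef_pV2 ?posrE ?mulr_gt0 // ler_peMr // ltW.
  have [|||ca [cb [cc [cd [h1 h2 h3]]]]] :=
    @frame_change R _ ord0 n01 (X' \o f) (Y' \o f) (X' \o f') (Y' \o f') B r1 d e2 r10 g1 g2 d1
    _ _ _ d2 d3.
  - by move=> i; split=> /=.
  - by split=> /=; apply: hcell.
  - have -> : B / r1 * d = 400^-1 by rewrite /d; field; rewrite !gt_eqF.
    have : b2 * e2 <= 1.
      apply: le_trans (_ : M%:R * M%:R^-1 <= _); last by rewrite divff ?gt_eqF.
      by apply: ler_pM => //; [exact: ltW|apply: le_trans (ltW hM); rewrite lerDr ltW].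
    have -> : B * (B / r1 * (e2 / r1)) = b2 * e2 / 200 by rewrite /b2; field; rewrite gt_eqF.
    by move: (b2 * e2) => z; clear; lra.
  exists ca, cb, cc, cd; split=> // c; have [] := h3 c; rewrite /= !ffunE => h4 h5.
  have lerho : e2 * B + e2 * (B / r1) <= r0 * p2^-1 / 2000.
    have -> : e2 * B + e2 * (B / r1) = b1 / M%:R * (r0 * p2^-1 / 2000).
      by rewrite /e2 /b1; field; rewrite !gt_eqF.
    apply: ler_piMl; first by rewrite !mulr_ge0 ?invr_ge0 ?ler0n ?(ltW p20) ?(ltW r00).
    by rewrite ler_pdivrMr // mul1r; apply: le_trans (ltW hM); rewrite lerDl ltW.
  by split; [exact: le_trans h4 lerho|exact: le_trans h5 lerho].
rewrite mulrAC ler_pdivrMr ?mulr_gt0 //.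
have pn : 0 < p2 ^+ (2 * k + 1) by rewrite exprn_gt0.
rewrite -(ler_pM2r (x := (p2 ^+ (2 * k + 1))^-1)) ?invr_gt0 // mulfK ?gt_eqF //.
apply: le_trans (_ : (\sum_f W f) ^+ 2 <= _); first by apply: lerXn2r;
  rewrite ?nnegrE ?sumr_ge0 // ltW.
apply: le_trans hCS _; rewrite size_allpairs -cardE natrM.
apply: le_trans (ler_wpM2l _ (le_trans bnd hP)) _; first by rewrite mulr_ge0 ?ler0n.
by rewrite exprVn le_eqVlt; apply/orP; left; apply/eqP; ring.
Qed.

End AreaTypeCount.

(** * Frostman measures *)

Lemma nested_le (S T : Type) (kap : nat -> S -> T) :
  (forall j x y, kap j.+1 x = kap j.+1 y -> kap j x = kap j y) ->
  forall i j x y, (i <= j)%N -> kap j x = kap j y -> kap i x = kap i y.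
Proof.
move=> nested i j x y ij; rewrite -(subnK ij); elim: (j - i)%N => // d IH.
by rewrite addSn => /nested; exact: IH.
Qed.

Section FrostmanWeights.
Context {R : realType} {S : finType} {T : eqType} (kap : nat -> S -> T) (occ : pred S).
Hypothesis nested : forall j x y, kap j.+1 x = kap j.+1 y -> kap j x = kap j y.

Definition cell_mass (w : S -> R) j x := \sum_(y | kap j y == kap j x) w y.

Lemma cell_mass_ge0 w j x : (forall y, 0 <= w y) -> 0 <= cell_mass w j x.
Proof. by move=> w0; apply: sumr_ge0. Qed.

Lemma eq_cell_mass w j x y : kap j x = kap j y -> cell_mass w j x = cell_mass w j y.
Proof. by rewrite /cell_mass => ->. Qed.

(** Frostman's construction from the finest level upwards: at each coarser level, every cell with
    mass above [a ^ j] is scaled down to [a ^ j]. A point either lies in a cell just scaled, which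
    is then saturated, or keeps its weights and its earlier saturated cell. *)
Lemma saturated_weights (a : R) j0 d : 0 < a ->
  {in occ &, injective (kap (j0 + d))} ->
  exists w : S -> R, [/\ forall x, 0 <= w x, forall x, ~~ occ x -> w x = 0,
    forall j x, (j0 <= j <= j0 + d)%N -> cell_mass w j x <= a ^+ j &
    forall x, occ x -> exists2 j, (j0 <= j <= j0 + d)%N & cell_mass w j x = a ^+ j].
Proof.
move=> a0; elim: d j0 => [|d IH] j0 inj.
  rewrite addn0 in inj *.
  exists (fun x => (occ x)%:R * a ^+ j0).
  have E x : cell_mass (fun x => (occ x)%:R * a ^+ j0) j0 x =
     [exists y, (kap j0 y == kap j0 x) && occ y]%:R * a ^+ j0.
    rewrite /cell_mass; case: existsP => [[y /andP[/eqP yx oy]]|nex].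
      rewrite (bigD1 y) ?yx //= oy big1 ?addr0 // => z /andP[/eqP zx zy].
      by case: (boolP (occ z)) => oz; rewrite ?mul0r //; case/eqP: zy; apply: inj; rewrite // zx.
    rewrite big1 ?mul0r // => y yx; case: (boolP (occ y)) => oy; rewrite ?mul0r //.
    by case: nex; exists y; rewrite yx.
  split=> [x|x /negbTE->|j x|x ox]; first by rewrite mulr_ge0 ?ler0n ?exprn_ge0 ?ltW.
  - by rewrite mul0r.
  - rewrite -eqn_leq => /eqP <-; rewrite E ler_piMl ?exprn_ge0 ?(ltW a0) //.
    by rewrite -[1]/(true%:R) ler_nat; case: [exists y, _].
  - exists j0; rewrite ?leqnn // E; case: existsP => [_|[]]; rewrite ?mul1r //.
    by exists x; rewrite eqxx.
have [|w [w0 wO wle wsat]] := IH j0.+1; first by rewrite addSnnS.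
pose sc x := Num.min 1 (a ^+ j0 / cell_mass w j0 x).
have aj0 : 0 < a ^+ j0 by rewrite exprn_gt0.
have sc0 x : 0 <= sc x.
  by rewrite /sc le_min ler01 divr_ge0 ?(ltW aj0) //; exact: cell_mass_ge0.
have sc1 x : sc x <= 1 by rewrite ge_min lexx.
have scE x y : kap j0 x = kap j0 y -> sc x = sc y by move=> xy; rewrite /sc (eq_cell_mass _ xy).
have mE j x : (j0 <= j)%N -> cell_mass (fun y => w y * sc y) j x = cell_mass w j x * sc x.
  move=> j0j; rewrite /cell_mass mulr_suml; apply: eq_bigr => y /eqP yx.
  by congr (_ * _); apply: scE; exact: (nested_le nested j0j yx).
exists (fun y => w y * sc y); split=> [x|x ox|j x|x ox].
- exact: mulr_ge0.
- by rewrite wO ?mul0r.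
- move=> /andP[]; rewrite leq_eqVlt => /orP[/eqP<- _|j0j jd].
    rewrite mE //; have := cell_mass_ge0 j0 x w0; rewrite le_eqVlt => /orP[/eqP<-|W0].
      by rewrite mul0r ltW.
    by rewrite mulrC -ler_pdivlMr // /sc ge_min lexx orbT.
  rewrite mE ?(ltnW j0j) //; apply: le_trans (_ : cell_mass w j x <= _).
    by rewrite ler_piMr ?sc1 //; exact: cell_mass_ge0.
  by apply: wle; rewrite j0j addSnnS.
- case: (lerP (cell_mass w j0 x) (a ^+ j0)) => [le|lt].
    have [j /andP[j1 j2] jE] := wsat x ox; exists j; first by rewrite (ltnW j1) -addSnnS.
    rewrite mE ?(ltnW j1) // jE; rewrite /sc.
    have W0 : 0 < cell_mass w j0 x.
      apply: lt_le_trans (_ : cell_mass w j x <= _); first by rewrite jE exprn_gt0.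
      rewrite /cell_mass big_mkcond [leRHS]big_mkcond; apply: ler_sum => y _.
      case: eqP => // [yx|_]; last by case: eqP.
      by rewrite (nested_le nested (ltnW j1) yx) eqxx.
    by rewrite min_l ?mulr1 // ler_pdivlMr // mul1r.
  have W0 : 0 < cell_mass w j0 x by apply: lt_trans lt.
  exists j0; first by rewrite leqnn leq_addr.
  rewrite mE // /sc min_r; first by rewrite mulrC divfK // gt_eqF.
  by rewrite ler_pdivrMr // mul1r ltW.
Qed.

(* The maximal saturated cells partition [occ], so the mass is the sum of [a ^+ level] over them. *)
Lemma saturated_mass (a c : R) (w : S -> R) j0 N : (forall x, 0 <= w x) ->
  (forall x, ~~ occ x -> w x = 0) ->
  (forall x, occ x -> exists2 j, (j0 <= j <= N)%N & cell_mass w j x = a ^+ j) ->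
  (forall D : seq S, forall l : S -> nat, (forall x, (j0 <= l x <= N)%N) ->
     (forall x, occ x -> exists2 y, y \in D & kap (l y) x = kap (l y) y) ->
       c <= \sum_(y <- D) a ^+ l y) ->
  (exists x, occ x) ->
  c <= \sum_x w x.
Proof.
move=> w0 wO wsat cov [x0 ox0].
pose P x (j : 'I_N.+1) := (j0 <= j)%N && (cell_mass w j x == a ^+ j).
have ex x : exists j : 'I_N.+1, occ x ==> P x j.
  case: (boolP (occ x)) => ox; last by exists ord0.
  have [j /andP[j1 j2] jE] := wsat x ox.
  by exists (inord j); rewrite /P inordK ?ltnS // j1 jE eqxx.
(* The coarsest saturated level. The default [N] only keeps [l] in range when there is none. *)
pose l x : nat := if [pick j0 | P x j0] is Some j1 then [arg min_(j < j1 | P x j) j] else N.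
have lE x : occ x -> [/\ (j0 <= l x <= N)%N, cell_mass w (l x) x = a ^+ l x &
    forall j, (j0 <= j <= N)%N -> cell_mass w j x = a ^+ j -> (l x <= j)%N].
  move=> ox; rewrite /l; case: pickP => [j1 Pj1|none].
    case: arg_minnP => // j /andP[jj /eqP jE] jmin; split=> //.
      by rewrite jj -ltnS ltn_ord.
    move=> i /andP[i0 iN] iE; have := jmin (inord i).
    by rewrite /P inordK ?ltnS // i0 iE eqxx => ->.
  by have [j] := ex x; rewrite ox none.
have j0N : (j0 <= N)%N.
  by have [/andP[h1 h2] _ _] := lE x0 ox0; exact: leq_trans h2.
have lB x : (j0 <= l x <= N)%N.
  rewrite /l; case: pickP => [j1 Pj1|none]; last by rewrite j0N leqnn.
  by case: arg_minnP => // j /andP[jj _] _; rewrite jj -ltnS ltn_ord.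
have lC x y : occ x -> occ y -> kap (l x) y = kap (l x) x -> l y = l x.
  move=> ox oy yx; have [x1 x2 x3] := lE x ox; have [y1 y2 y3] := lE y oy.
  have h1 : (l y <= l x)%N by apply: y3 => //; rewrite (eq_cell_mass _ yx).
  apply/eqP; rewrite eqn_leq h1; apply: x3 => //.
  by rewrite -(eq_cell_mass _ (nested_le nested h1 yx)).
(* The picked point depends only on the maximal saturated cell of [x], so [r] chooses one
   representative for each cell. *)
pose r x := odflt x [pick y | [&& occ y, l y == l x & kap (l x) y == kap (l x) x]].
have rP x : occ x -> [/\ occ (r x), l (r x) = l x & kap (l x) (r x) = kap (l x) x].
  move=> ox; rewrite /r; case: pickP => [y /and3P[oy /eqP ly /eqP ky]|none] //=.
rewrite (bigID occ) /= [X in _ + X]big1 => [|x nx]; last by rewrite wO.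
rewrite addr0.
pose D := undup [seq r x | x <- enum occ].
have DE x : occ x -> r x \in D.
  by move=> ox; rewrite mem_undup; apply: map_f; rewrite mem_enum.
have /le_trans : c <= \sum_(y <- D) a ^+ l y.
  apply: cov => //.
  move=> x ox; exists (r x); first exact: DE.
  by have [_ -> ->] := rP x ox.
apply.
rewrite (partition_big r (fun x => x \in D) DE) /=.
rewrite -big_uniq ?undup_uniq //= le_eqVlt; apply/orP; left; apply/eqP.
rewrite big_seq [RHS]big_seq; apply: eq_bigr => d.
rewrite mem_undup => /mapP[z]; rewrite mem_enum => oz ->.
have [or lr kr] := rP z oz; have [_ e _] := lE _ or; rewrite -e /cell_mass.
rewrite (bigID occ) /= [X in _ + X]big1 => [|x /andP[_ nx]]; last by rewrite wO.
rewrite addr0; apply: eq_bigl => x; case: (boolP (occ x)) => ox; rewrite ?andbF ?andbT //=.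
rewrite lr kr; apply/eqP/eqP => [xz|rxz].
  have lxz := lC z x oz ox xz.
  rewrite /r; have -> : [pick y | [&& occ y, l y == l x & kap (l x) y == kap (l x) x]] =
     [pick y | [&& occ y, l y == l z & kap (l z) y == kap (l z) z]].
    by apply: eq_pick => y; rewrite lxz xz.
  by case: pickP => // /(_ z); rewrite /= [occ z]oz !eqxx.
have [_ lx kx] := rP x ox.
have lxz : l x = l z by rewrite -lx rxz lr.
by rewrite -lxz -kx rxz lxz kr.
Qed.

End FrostmanWeights.

Section HausdorffCovers.
Context {R : realType}.

(** Below the dimension the measure of exponent [s] is nonzero, hence so is the premeasure for some
    [delta]; [h] is a finite positive lower bound for it. *)
Lemma hausdorff_cover n (E : set 'cV[R]_n) (s : R) : 0 <= s -> (s%:E < hausdorff_dim E)%E ->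
  exists delta h : R, [/\ 0 < delta, 0 < h &
    forall (S : Type) (D : seq S) (U : S -> set 'cV[R]_n),
      (forall x, (diameter (U x) <= delta%:E)%E) ->
      (forall v, E v -> exists2 i, (i < size D)%N & forall x, U (nth x D i) v) ->
      (h%:E <= \sum_(x <- D) diameter_pow s (U x))%E].
Proof.
move=> s0 sE.
have pow0 (U : set 'cV[R]_n) : (0 <= diameter_pow s U)%E.
  by rewrite /diameter_pow; case: ifP => // _; exact: poweR_ge0.
have pre0 d : (0 <= hausdorff_premeasure s d E)%E.
  by apply: le_ereal_inf_tmp => _ [U _ <-]; exact: nneseries_ge0.
have [d d0 dE] : exists2 d : R, 0 < d & (0 < hausdorff_premeasure s d E)%E.
  apply: contrapT => none.
  suff h0 : hausdorff_measure s E = 0%E.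
    move: sE; rewrite ltNge => /negP; apply.
    by apply: ereal_inf_lbound; exists s.
  apply/eqP; rewrite eq_le; apply/andP; split.
    apply: ge_ereal_sup => _ [d d0 <-]; rewrite leNgt; apply/negP => lt.
    by apply: none; exists d.
  apply: le_trans (pre0 1) _; apply: ereal_sup_ubound; exists 1 => //; exact: ltr01.
have [h h0 hE] : exists2 h : R, 0 < h & (h%:E <= hausdorff_premeasure s d E)%E.
  case: hausdorff_premeasure dE => [r| |] //; first by rewrite lte_fin => r0; exists r.
  by exists 1; rewrite ?leey.
exists d, h; split=> // S D U Ud cov; apply: le_trans hE _.
apply: ereal_inf_lbound.
case: D cov => [|x0 D] cov.
  exists (fun=> set0); first split=> [j|v /cov[]//].
    by rewrite /diameter set0X image_set0 ereal_sup0 leNye.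
  rewrite big_nil; apply: eseries0 => i _ _; by rewrite /diameter_pow eqxx.
(* The finite cover is padded with empty sets, which have weight [0] for every [s]. *)
pose V j := if (j < size (x0 :: D))%N then U (nth x0 (x0 :: D) j) else set0.
exists V; first split=> [j|v /cov[i iD Uv]].
- rewrite /V; case: ifP => _; first exact: Ud.
  by rewrite /diameter set0X image_set0 ereal_sup0 leNye.
- by exists i => //; rewrite /V iD.
rewrite (@nneseries_split _ _ 0 (size (x0 :: D))); last by move=> k _; exact: pow0.
rewrite eseries0 ?addr0 => [|i Di _]; last first.
  by rewrite /V ltnNge Di /diameter_pow eqxx.
rewrite add0n [RHS](big_nth x0).
by apply: eq_big_nat => i /andP[_ iD]; rewrite /V iD.
Qed.

Lemma diameter_box (U : set 'cV[R]_2) (r : R) : 0 <= r ->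
  (forall u v, U u -> U v -> forall i, `|u i 0 - v i 0| <= r) -> (diameter U <= (2 * r)%:E)%E.
Proof.
move=> r0 Ur; apply: ge_ereal_sup => _ [[u v] [/= Uu Uv] <-]; rewrite lee_fin /euclidean_dist.
rewrite -[leRHS]ger0_norm ?mulr_ge0 // -sqrtr_sqr; apply: ler_wsqrtr.
rewrite !big_ord_recl big_ord0 addr0.
have sq i : (u i 0 - v i 0) ^+ 2 <= r ^+ 2.
  by rewrite -[leLHS]real_normK ?num_real // lerXn2r ?nnegrE //; exact: Ur.
apply: le_trans (lerD (sq _) (sq _)) _.
rewrite exprMn; have := sqr_ge0 r; clear; lra.
Qed.

Lemma diameter_pow_box (U : set 'cV[R]_2) (s r : R) : 0 <= s -> 0 <= r ->
  (forall u v, U u -> U v -> forall i, `|u i 0 - v i 0| <= r) ->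
  (diameter_pow s U <= ((2 * r) `^ s)%:E)%E.
Proof.
move=> s0 r0 Ur; rewrite /diameter_pow; case: eqP => [_|/eqP/set0P[v Uv]].
  by rewrite lee_fin powR_ge0.
rewrite -poweR_EFin; apply: gt0_ler_poweR => //.
- rewrite in_itv /= leey andbT.
  apply: ereal_sup_ubound; exists (v, v) => //=.
  rewrite /euclidean_dist big1 ?sqrtr0 // => i _.
  by rewrite subrr expr0n.
- by rewrite in_itv /= leey andbT lee_fin mulr_ge0.
- exact: diameter_box.
Qed.

Definition grid j (v : 'cV[R]_2) : int * int :=
  (Num.floor (2 ^+ j * v 0 0), Num.floor (2 ^+ j * v 1 0)).

Lemma floor_double (x y : R) : Num.floor (2 * x) = Num.floor (2 * y) -> Num.floor x = Num.floor y.
Proof.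
move=> e; apply/eqP; rewrite floor_eq.
have /andP[] := floor_itv y; have /andP[] := floor_itv (2 * y); have /andP[] := floor_itv (2 * x).
rewrite -e; set m := Num.floor (2 * x); set p := Num.floor y; rewrite !intrD => h1 h2 h3 h4 h5 h6.
have l1 : p * 2 < m + 1 by rewrite -(ltr_int R) intrD intrM; move: h5 h4; clear; lra.
have l2 : m < (p + 1) * 2 by rewrite -(ltr_int R) intrM intrD; move: h3 h6; clear; lra.
have l3 : (p * 2 <= m) by move: l1; clear; lia.
have l4 : (m + 1 <= (p + 1) * 2) by move: l2; clear; lia.
move: l3 l4; rewrite -!(ler_int R) !intrM !intrD => l3 l4.
by move: h1 h2 l3 l4; clear; lra.
Qed.

Lemma grid_nested j u v : grid j.+1 u = grid j.+1 v -> grid j u = grid j v.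
Proof.
by rewrite /grid !exprS -!mulrA => -[/floor_double -> /floor_double ->].
Qed.

Lemma floor_scale (j : nat) (x y : R) : Num.floor (2 ^+ j * x) = Num.floor (2 ^+ j * y) ->
  `|x - y| <= (2 ^+ j)^-1.
Proof.
move=> e; have /andP[] := floor_itv (2 ^+ j * y); have /andP[] := floor_itv (2 ^+ j * x).
rewrite -e intrD => h1 h2 h3 h4.
have p0 : 0 < 2 ^+ j :> R by rewrite exprn_gt0.
rewrite -(ler_pM2l p0) divff ?gt_eqF // -[X in X * _]gtr0_norm // -normrM mulrBr ler_norml.
by move: h1 h2 h3 h4; clear; lra.
Qed.

Lemma floor_scale_near (j : nat) (x z : R) : `|x - z| <= (2 ^+ j)^-1 ->
  exists d : 'I_3, Num.floor (2 ^+ j * x) = Num.floor (2 ^+ j * z) + (d : nat)%:Z - 1.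
Proof.
move=> xz.
have /andP[g1 g2] := floor_itv (2 ^+ j * x); have /andP[g3 g4] := floor_itv (2 ^+ j * z).
have : `|2 ^+ j * x - 2 ^+ j * z| <= 1.
    rewrite -mulrBr normrM ger0_norm ?exprn_ge0 // mulrC -ler_pdivlMr ?exprn_gt0 //.
    by rewrite mul1r.
rewrite ler_norml => /andP[g5 g6].
set m := Num.floor (2 ^+ j * x) in g1 g2 *; set q := Num.floor (2 ^+ j * z) in g3 g4 *.
have l1 : m < q + 2 by rewrite -(ltr_int R) intrD; move: g1 g4 g6; rewrite intrD; clear; lra.
have l2 : q < m + 2 by rewrite -(ltr_int R) intrD; move: g2 g3 g5; rewrite intrD; clear; lra.
have lm : (`|(m - q + 1)%R|%N < 3)%N by move: l1 l2; clear; lia.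
by exists (Ordinal lm) => /=; move: l1 l2; clear; lia.
Qed.

End HausdorffCovers.

Section Frostman.
Context {R : realType}.
Variables (E : set 'cV[R]_2) (s R0 : R).
Hypotheses (s0 : 0 <= s) (sE : (s%:E < hausdorff_dim E)%E).
Hypothesis bounded : forall v i, E v -> `|v i 0| <= R0.
Hypothesis R00 : 0 <= R0.

Let a : R := 2 `^ (- s).

Let a0 : 0 < a. Proof. exact: powR_gt0. Qed.

Lemma powR_half_expn l : (2 * (2 ^+ l)^-1) `^ s = 2 `^ s * a ^+ l :> R.
Proof.
rewrite powRM ?invr_ge0 ?exprn_ge0 //; congr (_ * _).
have -> : (2 ^+ l)^-1 = 2 `^ (- l%:R) :> R by rewrite powRN powR_mulrn.
by rewrite -powRrM -[a ^+ l]powR_mulrn ?powR_ge0 // -powRrM; congr (_ `^ _); ring.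
Qed.

(** The saturated cells are dyadic squares covering [E]. A square of side [2 ^- l] has weight at
    most [2 ^ s * a ^ l] in the premeasure, so [saturated_mass] gives the bound [h / 2 ^ s],
    uniformly in [N]. *)
Lemma frostman_cells : exists j0 (c : R), 0 < c /\ forall N, exists (S : finType) (p : S ->
  'cV[R]_2)
  (w : S -> R), [/\ forall x, E (p x), forall x, 0 <= w x, c <= \sum_x w x &
   forall j x, (j0 <= j <= j0 + N)%N -> \sum_(y | grid j (p y) == grid j (p x)) w y <= a ^+ j].
Proof.
have [d [h [d0 h0 cov]]] := hausdorff_cover s0 sE.
have [v0 Ev0] : exists v0, E v0.
  apply: contrapT => nE; have := cov unit [::] (fun=> set0); rewrite big_nil lee_fin.
  have h' : ~ (h <= 0) by apply/negP; rewrite -ltNge.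
  move=> H; apply: h'; apply: H => [_|v Ev]; last by case: nE; exists v.
  by rewrite /diameter set0X image_set0 ereal_sup0 leNye.
(* Squares of level at least [j0] have diameter at most [d], so they are admissible in the
   premeasure. *)
pose j0 := Num.bound (2 / d).
have hj0 : 2 * (2 ^+ j0)^-1 <= d.
  rewrite ler_pdivrMr ?exprn_gt0 // mulrC -ler_pdivrMr //; apply: ltW.
  apply: lt_le_trans (archi_boundP _) _; first by rewrite divr_ge0 // ltW.
  by rewrite -natrX ler_nat; apply: ltnW; exact: ltn_expl.
exists j0, (h / 2 `^ s); split; first by rewrite divr_gt0 ?powR_gt0.
move=> N; pose L := Num.bound (2 ^+ (j0 + N) * R0).
pose S : finType := ('I_(2 * L).+1 * 'I_(2 * L).+1)%type.
pose key (t : S) : int * int := ((t.1 : nat)%:Z - L%:Z, (t.2 : nat)%:Z - L%:Z).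
have key_inj : injective key.
  move=> [x1 x2] [y1 y2] [/addIr e1 /addIr e2]; congr pair; apply: val_inj.
    by case: e1.
  by case: e2.
have hL : 2 ^+ (j0 + N) * R0 < L%:R by apply: archi_boundP; rewrite mulr_ge0 ?exprn_ge0.
have keyP v : E v -> exists t, key t = grid (j0 + N) v.
  move=> Ev.
  have b i : exists m : 'I_(2 * L).+1, (m : nat)%:Z - L%:Z = Num.floor (2 ^+ (j0 + N) * v i 0).
    set y := 2 ^+ _ * _; have yL : `|y| < L%:R.
      rewrite /y normrM ger0_norm ?exprn_ge0 //; apply: le_lt_trans hL.
      by rewrite ler_pM2l ?exprn_gt0 //; exact: bounded.
    have /andP[h1 h2] := floor_itv y; move: yL; rewrite ltr_norml => /andP[y1 y2].
    have l1 : - L%:Z <= Num.floor y.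
      have : - L%:Z < Num.floor y + 1.
        by rewrite -(ltr_int R) intrN -pmulrn; exact: lt_trans y1 h2.
      by clear; lia.
    have l2 : Num.floor y < L%:Z.
      by rewrite -(ltr_int R) -pmulrn; exact: le_lt_trans h1 y2.
    have lm : (`|(Num.floor y + L%:Z)%R|%N < (2 * L).+1)%N by move: l1 l2; clear; lia.
    by exists (Ordinal lm) => /=; move: l1 l2; clear; lia.
  have [m1 e1] := b 0; have [m2 e2] := b 1.
  by exists (m1, m2); rewrite /key /= e1 e2.
(* Squares that miss [E] receive the default point [v0]; their weight will be [0]. *)
have exp t : exists v, E v /\ ((exists u, E u /\ grid (j0 + N) u = key t) ->
  grid (j0 + N) v = key t).
  have [[u [Eu uk]]|nu] := pselect (exists u, E u /\ grid (j0 + N) u = key t).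
    by exists u.
  by exists v0; split=> // /nu.
have [p hp] := choice exp.
pose occ t := `[< exists u, E u /\ grid (j0 + N) u = key t >].
have occE t : occ t -> grid (j0 + N) (p t) = key t.
  by move/asboolP => h1; have [_] := hp t; apply.
pose kap j t := grid j (p t).
have nest j x y : kap j.+1 x = kap j.+1 y -> kap j x = kap j y by exact: grid_nested.
have inj : {in occ &, injective (kap (j0 + N)%N)}.
  by move=> x y ox oy; rewrite /kap !occE // => /key_inj.
have [w [w0 wO wle wsat]] := saturated_weights nest a0 inj.
exists S, p, w; split=> //; first by move=> x; have [] := hp x.
apply: (saturated_mass nest (a := a) (j0 := j0) (N := j0 + N) w0 wO wsat); last first.
  by have [t te] := keyP v0 Ev0; exists t; apply/asboolP; exists v0.
move=> D l lB hD; rewrite ler_pdivrMr ?powR_gt0 // mulr_suml.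
have cl x (u v : 'cV[R]_2) : grid (l x) u = grid (l x) (p x) -> grid (l x) v = grid (l x) (p x) ->
    forall i, `|u i 0 - v i 0| <= (2 ^+ l x)^-1.
  move=> uk vk i; apply: floor_scale; have : grid (l x) u = grid (l x) v by rewrite uk vk.
  rewrite /grid => -[f1 f2]; case: i => [[|[]]//] hi.
    by have -> : Ordinal hi = 0 :> 'I_2 by exact: val_inj.
  by have -> : Ordinal hi = 1 :> 'I_2 by exact: val_inj.
have := cov S D (fun x => [set v | grid (l x) v = grid (l x) (p x)]%classic).
have i0 x : 0 <= (2 ^+ l x)^-1 :> R by rewrite invr_ge0 exprn_ge0.
move=> /(_ _ _)/le_trans cov'; rewrite -lee_fin; apply: cov'.
- move=> x; apply: le_trans (diameter_box (i0 x) (cl x)) _; rewrite lee_fin.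
  apply: le_trans hj0; rewrite ler_pM2l // lef_pV2 ?posrE ?exprn_gt0 //.
  by rewrite ler_weXn2l ?ler1n //; have /andP[] := lB x.
- move=> v Ev; have [t te] := keyP v Ev.
  have ot : occ t by apply/asboolP; exists v.
  have [y yD yk] := hD t ot.
  exists (index y D); first by rewrite index_mem.
  move=> x; rewrite /mkset nth_index //; apply: etrans _ yk; rewrite /kap.
  have /andP[_ hl] := lB y; apply: (nested_le (@grid_nested R) hl).
  by rewrite -te occE.
rewrite -sumEFin; apply: lee_sum => x _; rewrite mulrC -powR_half_expn.
apply: diameter_pow_box => //; exact: cl.
Qed.

(** A sup-norm ball of radius [2 ^- j] meets at most nine dyadic squares of level [j]. Normalizing
    the mass costs [1 / c]; for [j < j0] the total mass is used, at the cost of [a ^- j0]. *)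
Lemma frostman_balls : exists CF : R, 0 <= CF /\ forall N, exists (S : finType) (p : S -> 'cV[R]_2)
  (w : S -> R), [/\ forall x, E (p x), forall x, 0 <= w x, \sum_x w x = 1 &
   forall j u v, (j <= N)%N ->
    \sum_x (Num.max `|p x 0 0 - u| `|p x 1 0 - v| <= (2 ^+ j)^-1)%R%:R * w x <= CF * a ^+ j].
Proof.
have [j0 [c [c0 H]]] := frostman_cells.
exists (9 * (c^-1 + (a ^+ j0)^-1)); split.
  by rewrite mulr_ge0 // addr_ge0 // invr_ge0 ?exprn_ge0 // ltW.
move=> N; have [S [p [w [Ep w0 wc wle]]]] := H N; exists S, p.
set M := \sum_x w x in wc.
have M0 : 0 < M by exact: lt_le_trans wc.
have a1 : a <= 1.
  by rewrite -(powRr0 2) /a; apply: ler_powR; rewrite ?ler1n // oppr_le0.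
exists (fun x => w x / M); split=> //.
- by move=> x; rewrite divr_ge0 // ltW.
- by rewrite -mulr_suml divff // gt_eqF.
move=> j u v jN.
have cell m : \sum_(y | grid j (p y) == m) w y / M <= (c^-1 + (a ^+ j0)^-1) * a ^+ j.
  have aj : 0 <= a ^+ j by rewrite exprn_ge0 // ltW.
  case: (leqP j0 j) => [j0j|jj0].
    have [/existsP[x /eqP xm]|/existsPn nx] := boolP [exists x, grid j (p x) == m]; last first.
      rewrite big1 => [|y ym]; last by have := nx y; rewrite ym.
      by rewrite mulr_ge0 // addr_ge0 ?invr_ge0 ?exprn_ge0 // ltW.
    rewrite -mulr_suml ler_pdivrMr //; apply: le_trans (_ : a ^+ j <= _).
      by rewrite -xm; apply: wle; rewrite j0j /= (leq_trans jN) // leq_addl.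
    rewrite mulrAC ler_peMl //; apply: le_trans (_ : c^-1 * M <= _).
      by rewrite mulrC ler_pdivlMr // mul1r.
    by rewrite ler_pM2r // lerDl invr_ge0 exprn_ge0 // ltW.
  apply: le_trans (_ : 1 <= _).
    rewrite -mulr_suml ler_pdivrMr // mul1r [leRHS](bigID (fun y => grid j (p y) == m)) /= lerDl.
    exact: sumr_ge0.
  apply: le_trans (_ : (a ^+ j0)^-1 * a ^+ j <= _); last by rewrite ler_wpM2r // lerDr invr_ge0 ltW.
  rewrite mulrC ler_pdivlMr ?exprn_gt0 // mul1r; apply: ler_wiXn2l => //; [exact: ltW|exact: ltnW].
pose f1 := Num.floor (2 ^+ j * u); pose f2 := Num.floor (2 ^+ j * v).
apply: le_trans (_ : \sum_(d : 'I_3 * 'I_3) \sum_(y | grid j (p y) == (f1 + (d.1 : nat)%:Z - 1,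
  f2 + (d.2 : nat)%:Z - 1)) w y / M <= _).
  have -> : \sum_(d : 'I_3 * 'I_3) \sum_(y | grid j (p y) == (f1 + (d.1 : nat)%:Z - 1, f2 + (d.2 :
    nat)%:Z - 1)) w y / M
    = \sum_y (\sum_(d : 'I_3 * 'I_3) (grid j (p y) == (f1 + (d.1 : nat)%:Z - 1, f2 + (d.2 :
      nat)%:Z - 1))%:R) * (w y / M).
    under [RHS]eq_bigr => y _ do rewrite mulr_suml.
    rewrite [RHS]exchange_big; apply: eq_bigr => d _; rewrite big_mkcond; apply: eq_bigr => y _ /=.
    by case: eqP; rewrite ?mul1r ?mul0r.
  apply: ler_sum => y _; apply: ler_wpM2r; first by rewrite divr_ge0 // ltW.
  case: (boolP (Num.max `|p y 0 0 - u| `|p y 1 0 - v| <= _)) => [|_]; last by apply: sumr_ge0 =>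
    d _; rewrite ler0n.
  rewrite ge_max => /andP[h1 h2].
  have [d1 e1] := floor_scale_near h1; have [d2 e2] := floor_scale_near h2.
  by rewrite (bigD1 (d1, d2)) //= /grid e1 e2 eqxx lerDl; apply: sumr_ge0 => d _; rewrite ler0n.
apply: le_trans (_ : \sum_(d : 'I_3 * 'I_3) (c^-1 + (a ^+ j0)^-1) * a ^+ j <= _).
  by apply: ler_sum => d _; exact: cell.
by rewrite sumr_const card_prod card_ord -[X in X <= _]mulr_natl mulrA.
Qed.

End Frostman.

(** * Null sets *)

Section NullSetKeys.
Context {R : realType}.

(** Continuity of a finite product; it serves both to thicken boxes and to perturb the exponents. *)
Lemma prod_add_le (I : Type) (r : seq I) (F : I -> R) (eta : R) : (forall i, 0 <= F i) -> 0 < eta ->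
  exists2 t, 0 < t & \prod_(i <- r) (F i + t) <= \prod_(i <- r) F i + eta.
Proof.
move=> F0; elim: r eta => [|x r IH] eta eta0.
  by exists 1; rewrite ?big_nil ?lerDl ?(ltW eta0) //; exact: ltr01.
set P := \prod_(i <- r) F i in IH.
have P0 : 0 <= P by apply: prodr_ge0.
have x1 : 0 < F x + 1 by rewrite ltr_wpDl.
have [t1 t10 h1] := IH (eta / 2 / (F x + 1)) (divr_gt0 (divr_gt0 eta0 (ltr0n _ 2)) x1).
have P1 : 0 < P + eta / 2 / (F x + 1) by rewrite ltr_wpDl ?divr_gt0.
pose t := Num.min t1 (eta / 2 / (P + eta / 2 / (F x + 1))).
have t0 : 0 < t by rewrite lt_min t10 !divr_gt0.
have tt1 : t <= t1 by rewrite ge_min lexx.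
exists t => //; rewrite !big_cons -/P.
apply: le_trans (_ : (F x + t) * (P + eta / 2 / (F x + 1)) <= _).
  rewrite ler_wpM2l ?addr_ge0 ?(ltW t0) //; apply: le_trans h1.
  apply: ler_prod => i _; rewrite addr_ge0 ?(ltW t0) //=.
  by rewrite lerD2l.
rewrite mulrDl mulrDr -addrA lerD2l.
rewrite [leRHS](splitr eta); apply: lerD.
  by rewrite mulrCA ler_piMr ?divr_ge0 ?(ltW eta0) // ler_pdivrMr // mul1r lerDl.
by rewrite -ler_pdivlMr // ge_min lexx orbT.
Qed.

(** The box of index [j] in a closed cover is thickened at the cost of a volume
    [kappa / 2 ^ (j + 2)]. Open boxes are needed for compactness, and flat boxes acquire sides of
    positive length. *)
Lemma open_boxes n (A : set 'rV[R]_n) (kappa : R) : (lebesgue_measure_rV A <= 0)%E -> 0 < kappa ->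
  exists lo hi : nat -> 'rV[R]_n, [/\ forall j i, lo j 0 i < hi j 0 i,
    forall x, A x -> exists j, forall i, lo j 0 i < x 0 i < hi j 0 i &
    forall N, \sum_(0 <= j < N) \prod_i (hi j 0 i - lo j 0 i) <= kappa].
Proof.
move=> A0 k0; have k2 : 0 < kappa / 2 by rewrite divr_gt0.
have lt2 : (lebesgue_measure_rV A < (kappa / 2)%:E)%E by apply: le_lt_trans A0 _; rewrite lte_fin.
have [_ [[lo hi] [/= lohi cov] <-] vol] := ereal_inf_lt lt2.
have fat j : exists2 t, 0 < t & \prod_(i < n) (hi j 0 i - lo j 0 i + t) <=
    \prod_(i < n) (hi j 0 i - lo j 0 i) + kappa / 2 / 2 ^+ j.+1.
  by apply: prod_add_le => [i|]; rewrite ?subr_ge0 // !divr_gt0 // exprn_gt0.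
have {}fat j : exists t, 0 < t /\ \prod_(i < n) (hi j 0 i - lo j 0 i + t) <=
    \prod_(i < n) (hi j 0 i - lo j 0 i) + kappa / 2 / 2 ^+ j.+1.
  by have [t] := fat j; exists t.
have [t ht] := choice fat.
exists (fun j => \row_i (lo j 0 i - t j / 2)), (fun j => \row_i (hi j 0 i + t j / 2)); split.
- by move=> j i; rewrite !mxE; have [t0 _] := ht j; have := lohi j i; move: t0; clear; lra.
- move=> x /cov[j _ xj]; exists j => i; rewrite !mxE; have /andP[] := xj i; have [t0 _] := ht j.
  by move: t0; clear; lra.
move=> N; rewrite [leRHS](splitr kappa).
apply: le_trans (_ : \sum_(0 <= j < N) (\prod_(i < n) (hi j 0 i - lo j 0 i)
  + kappa / 2 / 2 ^+ j.+1) <= _).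
  apply: ler_sum => j _; have [_] := ht j; apply: le_trans; rewrite le_eqVlt; apply/orP; left;
    apply/eqP.
  by apply: eq_bigr => i _; rewrite !mxE; field.
rewrite big_split; apply: lerD.
  rewrite -lee_fin -sumEFin; apply: le_trans (ltW vol); apply: nneseries_lim_ge => j _ _.
  by rewrite lee_fin; apply: prodr_ge0 => i _; rewrite subr_ge0.
have -> : \sum_(0 <= j < N) kappa / 2 / 2 ^+ j.+1 = kappa / 2 * (1 - (2 ^+ N)^-1).
  elim: N => [|N IH]; first by rewrite big_geq // expr0 invr1 subrr mulr0.
  by rewrite big_nat_recr //= IH !exprS; field; rewrite gt_eqF // exprn_gt0.
by rewrite ler_piMr ?(ltW k2) // gerBl invr_ge0 exprn_ge0.
Qed.

Lemma card_prod_family n (L : 'I_n -> nat) m : (forall i, (L i <= m)%N) ->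
  #|family (fun i : 'I_n => [pred x : 'I_m | x < L i])%N| = (\prod_i L i)%N.
Proof.
move=> Lm; rewrite card_family foldrE big_map big_enum; apply: eq_bigr => i _.
rewrite -sum1_card -[RHS]muln1 -[in RHS](card_ord (L i)) -sum1_card.
transitivity (\sum_(x < m | (x < L i)%N) 1)%N; first by apply: eq_bigl => x; rewrite inE.
by rewrite (big_ord_narrow (Lm i)) /= sum1_card card_ord muln1.
Qed.

(** A side of length [d] meets at most [d t + 2] cells of the grid of step [1 / t], hence at most
    [2 d t] when [d t >= 2]. *)
Lemma box_keys n (lo hi : 'rV[R]_n) (t : R) : 0 < t -> (forall i, 2 <= (hi 0 i - lo 0 i) * t) ->
  exists Q : seq {ffun 'I_n -> int}, (size Q)%:R <= (2 * t) ^+ n * \prod_i (hi 0 i - lo 0 i) /\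
    forall y : 'I_n -> R, (forall i, lo 0 i < y i < hi 0 i) -> [ffun i =>
      Num.floor (y i * t)] \in Q.
Proof.
move=> t0 big2.
pose f i := Num.floor (lo 0 i * t); pose L i := `|(Num.floor (hi 0 i * t) - f i + 1)%R|%N.
pose m := (\max_i L i)%N.
have Lm i : (L i <= m)%N by exact: leq_bigmax.
exists [seq [ffun i => f i + (g i : nat)%:Z] | g : {ffun 'I_n -> 'I_m} <- enum (family (fun i :
  'I_n => [pred x : 'I_m | x < L i])%N)].
split=> [|y hy].
  rewrite size_map -cardE card_prod_family // natr_prod.
  rewrite -[X in _ ^+ X](card_ord n) -prodr_const -big_split; apply: ler_prod => i _ /=.
  rewrite ler0n /=.
  have /andP[h1 h2] := floor_itv (lo 0 i * t); have /andP[h3 h4] := floor_itv (hi 0 i * t).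
  have b2 := big2 i.
  have le : f i <= Num.floor (hi 0 i * t) by apply: le_floor; move: b2; rewrite mulrBl; clear; lra.
  have -> : (L i)%:R = (Num.floor (hi 0 i * t) - f i + 1)%:~R :> R.
    by rewrite pmulrn; congr (_%:~R); rewrite /L; move: le; clear; lia.
  move: h1 h2 h3 h4 b2; rewrite -/(f i) !intrD intrN; clear; set u := (f i)%:~R; move: u => u.
  by rewrite mulrBl mulrBr -mulrA (mulrC t) -mulrA (mulrC t (lo 0 i)); lra.
have lt i : (`|(Num.floor (y i * t) - f i)%R|%N < L i)%N /\ f i <= Num.floor (y i * t).
  have /andP[y1 y2] := hy i.
  have l1 : f i <= Num.floor (y i * t) by apply: le_floor; rewrite ler_pM2r // ltW.
  have l2 : Num.floor (y i * t) <= Num.floor (hi 0 i * t) by apply: le_floor;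
    rewrite ler_pM2r // ltW.
  by split=> //; rewrite /L; move: l1 l2; clear; lia.
have ltm i : (`|(Num.floor (y i * t) - f i)%R|%N < m)%N by have [h _] := lt i;
  exact: leq_trans h (Lm i).
apply/mapP; exists [ffun i => Ordinal (ltm i)].
  by rewrite mem_enum; apply/familyP => i; rewrite inE ffunE /=; have [] := lt i.
apply/ffunP => i; rewrite !ffunE /=; have [_] := lt i; clear; lia.
Qed.

(** Arbitrarily thin boxes would meet too many cells for their volume. Compactness leaves finitely
    many boxes, and for large [t] all of them are wide compared with [1 / t]. *)
Lemma few_keys (T : ptopologicalType) (K : set T) n (A : set 'rV[R]_n) (y : T -> 'I_n ->
  R) (kappa : R) :
  compact K -> (forall x, K x -> A (\row_i y x i)) ->
  (forall x i, K x -> {for x, continuous (y ^~ i)}) ->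
  (lebesgue_measure_rV A <= 0)%E -> 0 < kappa ->
  exists t0 : R, forall t, t0 <= t -> 0 < t -> exists Q : seq {ffun 'I_n -> int},
    (size Q)%:R <= kappa * t ^+ n /\ forall x, K x -> [ffun i => Num.floor (y x i * t)] \in Q.
Proof.
move=> Kc KA ycont A0 k0.
have k2 : 0 < kappa / 2 ^+ n by rewrite divr_gt0 // exprn_gt0.
have [lo [hi [lohi cov vol]]] := open_boxes A0 k2.
pose B j : set T := [set x | forall i, lo j 0 i < y x i < hi j 0 i]%classic.
move: Kc; rewrite compact_cover => /(_ _ setT (fun j => interior (B j))).
case=> [j _|x Kx|D _ hD].
- exact: open_interior.
- have [j hj] := cov _ (KA _ Kx); exists j => //; apply: filter_forall => i.
  have := hj i; rewrite mxE => /andP[h1 h2].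
  have o : open `]lo j 0 i, hi j 0 i[%classic by exact: interval_open.
  have := ycont x i Kx; move=> /(_ `]lo j 0 i, hi j 0 i[%classic).
  rewrite /= => h; have : nbhs x ((y^~ i) @^-1` `]lo j 0 i, hi j 0 i[%classic)%classic.
    by apply: h; apply: open_nbhs_nbhs; split=> //=; rewrite in_itv /= h1 h2.
  by apply: filterS => z /=; rewrite in_itv.
pose N := (\max_(j <- finmap.enum_fset D) j).+1.
have DN (j : nat) : j \in finmap.enum_fset D -> (j < N)%N by move=> jD; rewrite ltnS;
  exact: leq_bigmax_seq.
pose t0 := \sum_(0 <= j < N) \sum_(i < n) 2 / (hi j 0 i - lo j 0 i).
exists t0 => t tt0 tpos.
have box (j : 'I_N) : exists Q : seq {ffun 'I_n -> int},
    (size Q)%:R <= (2 * t) ^+ n * \prod_i (hi j 0 i - lo j 0 i) /\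
    forall y : 'I_n -> R, (forall i, lo j 0 i < y i < hi j 0 i) -> [ffun i =>
      Num.floor (y i * t)] \in Q.
  apply: box_keys => // i; rewrite mulrC -ler_pdivrMr ?subr_gt0 //; apply: le_trans tt0.
  rewrite /t0 big_mkord (bigD1 j) //= (bigD1 i) //= -addrA lerDl.
  have pos j' i' : 0 <= 2 / (hi j' 0 i' - lo j' 0 i') by rewrite divr_ge0 // subr_ge0 ltW.
  by rewrite addr_ge0 ?sumr_ge0 // => j' _; rewrite sumr_ge0.
have [Q hQ] := choice box.
exists (flatten [seq Q j | j <- enum 'I_N]); split=> [|x Kx].
  rewrite size_flatten /shape -map_comp sumnE big_map big_enum natr_sum.
  apply: le_trans (_ : \sum_(j < N) (2 * t) ^+ n * \prod_i (hi j 0 i - lo j 0 i) <= _).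
    by apply: ler_sum => j _; have [] := hQ j.
  rewrite -mulr_sumr -(big_mkord predT (fun j => \prod_i (hi j 0 i - lo j 0 i))).
  apply: le_trans (ler_wpM2l _ (vol N)) _; first by rewrite exprn_ge0 // mulr_ge0 // ltW.
  by rewrite exprMn [X in X * _]mulrC mulrACA divff ?expf_neq0 // mulr1 mulrC.
have [j jD /interior_subset Bx] := hD x Kx.
apply/flattenP; exists (Q (Ordinal (DN j jD))).
  by apply: map_f; rewrite mem_enum.
by have [_] := hQ (Ordinal (DN j jD)); apply.
Qed.

End NullSetKeys.

(** * Area types *)

Section Exponents.
Context {R : realType}.

Lemma powR2_lt (x y : R) : x < y -> 2 `^ x < 2 `^ y.
Proof.
move=> xy; rewrite -[y](subrK x) powRD; last by apply/implyP => _; rewrite pnatr_eq0.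
have e : 1 = 1 `^ (y - x) :> R by rewrite powR1.
rewrite ltr_pMl ?powR_gt0 // [ltLHS]e; apply: gt0_ltr_powR; rewrite ?subr_gt0 ?nnegrE ?ltr1n //.
Qed.

(** At [A = 2 a] and [q = 1] the last inequality reads [(k + 1) + (k + 2) (1 - s) < 0], that is
    [s > 2 - 1 / (k + 2)], and [k + 2 <= 2 (k + 1)]. Being strict, it survives a small increase of
    [A] and decrease of [q]. The bound [s < 2] gives [a > 1/4], hence [A > 1/2]. *)
Lemma exponents_exist k (s : R) : 2 - 1 / (2 * k.+1%:R) < s -> s < 2 -> exists A q : R,
  [/\ 2 * 2 `^ (- s) < A, 2^-1 < A, A < 1, 0 < q < 1 & 2 ^+ k.+1 * A ^+ k.+2 < q ^+ k.+2].
Proof.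
move=> sk s2; set a := 2 `^ (- s).
have k0 : 0 < k.+1%:R :> R by rewrite ltr0n.
have a0 : 0 < a by exact: powR_gt0.
have th1 : 2 ^+ k.+1 * (2 * a) ^+ k.+2 < 1.
  have e1 : 2 * a = 2 `^ (1 - s) by rewrite powRD ?powRr1 //; apply/implyP => _; rewrite pnatr_eq0.
  rewrite e1 -powR_mulrn // -[_ ^+ k.+2]powR_mulrn ?powR_ge0 // -powRrM -powRD; last first.
    by apply/implyP => _; rewrite pnatr_eq0.
  rewrite -[ltRHS](powRr0 2); apply: powR2_lt.
  have -> : k.+2%:R = k.+1%:R + 1 :> R by rewrite natr1.
  have hs : (s - 2) * (2 * k.+1%:R) > - 1.
    rewrite -ltr_pdivrMr ?mulr_gt0 // ltrBrDl mulN1r -div1r; exact: sk.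
  have : s - 2 < 0 by rewrite subr_lt0.
  have : 1 <= k.+1%:R :> R by rewrite ler1n.
  move: hs k0; move: (k.+1%:R) => x; clear; nra.
have a4 : 4^-1 < a.
  have -> : 4^-1 = 2 `^ (- 2) :> R by rewrite powRN powR_mulrn // -natrX.
  by apply: powR2_lt; rewrite ltrN2.
set th := 2 ^+ k.+1 * (2 * a) ^+ k.+2 in th1 *.
have th0 : 0 < th by rewrite mulr_gt0 ?exprn_gt0 // mulr_gt0.
pose eta := (th^-1 - 1) / 2.
have eta0 : 0 < eta by rewrite divr_gt0 // subr_gt0 invf_gt1.
(* Of the [2 (k + 2)] factors [1 + t], half enlarge [A] to [2 a (1 + t)] and half shrink [q] to
   [1 / (1 + t)]. *)
have [t t0 ht] := @prod_add_le R 'I_(k.+2 + k.+2) (index_enum _) (fun=> 1) eta (fun=> ler01) eta0.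
rewrite !prodr_const card_ord expr1n exprD in ht.
have t1 : 1 < 1 + t by rewrite ltrDl.
have t10 : 0 < 1 + t by apply: lt_trans t1.
have key : 2 ^+ k.+1 * (2 * a * (1 + t)) ^+ k.+2 < (1 + t)^-1 ^+ k.+2.
  rewrite (_ : 2 ^+ k.+1 * (2 * a * (1 + t)) ^+ k.+2 = th * (1 + t) ^+ k.+2);
    last by rewrite /th [in LHS]exprMn mulrA.
  rewrite exprVn -[ltRHS]mul1r ltr_pdivlMr ?exprn_gt0 // -mulrA.
  apply: le_lt_trans (ler_wpM2l (ltW th0) ht) _.
  have -> : th * (1 + eta) = (th + 1) / 2 by rewrite /eta; field; rewrite gt_eqF.
  by move: th1; clear; lra.
exists (2 * a * (1 + t)), (1 + t)^-1; split=> //.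
- by rewrite ltr_pMr // mulr_gt0.
- by apply: lt_trans (_ : 2 * a < _); [move: a4; clear; lra|rewrite ltr_pMr // mulr_gt0].
- rewrite ltNge; apply/negP => A1; move: key; rewrite ltNge => /negP; apply.
  apply: le_trans (_ : 1 <= _); first by rewrite exprn_ile1 ?invr_ge0 ?(ltW t10) // invf_le1 // ltW.
  by rewrite -[leLHS]mulr1; apply: ler_pM => //; rewrite exprn_ege1 // ler1n.
- by rewrite invr_gt0 t10 invf_lt1.
Qed.

End Exponents.

Section AreaTypes.
Context {R : realType}.

Lemma mulmx2 m n (g : 'M[R]_(m, 2)) (v : 'M[R]_(2, n)) i j :
  (g *m v) i j = g i 0 * v 0 j + g i 1 * v 1 j.
Proof.
rewrite mxE !big_ord_recl big_ord0 addr0.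
by have -> : lift ord0 ord0 = 1 :> 'I_2 by exact: val_inj.
Qed.

Lemma dotp_perp (u v : 'cV[R]_2) : dotp u (perp v) = u 0 0 * v 1 0 - u 1 0 * v 0 0.
Proof. by rewrite /dotp mulmx2 /perp !mxE /= mulrN. Qed.

Lemma cV2P (u v : 'cV[R]_2) : u 0 0 = v 0 0 -> u 1 0 = v 1 0 -> u = v.
Proof.
move=> h0 h1; apply/matrixP => i j; rewrite ord1; case: i => [[|[|//]]] hi.
  by have -> : Ordinal hi = 0 by exact: val_inj.
by have -> : Ordinal hi = 1 by exact: val_inj.
Qed.

Lemma inord_bool (b : bool) : inord b = (if b then 1 else 0) :> 'I_2.
Proof. by apply: val_inj; rewrite /= inordK; case: b. Qed.

(* The normalizer maps [z] to [((z wedge x^2) / a, x^1 wedge z)] with [a = x^1 wedge x^2]. *)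
Lemma last_coords_area_type k (E : set 'cV[R]_2) (x : 'I_k.+2 -> 'cV[R]_2) :
  (forall i, E (x i)) -> dotp (x ord0) (perp (x (inord 1))) != 0 ->
  (last_coords @` (area_types k.+1 E `&` flat k.+1))%classic
    (\row_(m < k.*2.+1) area_coord (fun i => x i 0 0) (fun i => x i 1 0) m).
Proof.
move=> Ex; set a := dotp _ _ => a0.
have aE : a = x ord0 0 0 * x (inord 1) 1 0 - x ord0 1 0 * x (inord 1) 0 0 by exact: dotp_perp.
pose g : 'M[R]_2 := \matrix_(i,
  j) (if i == 0 then (if j == 0 then x (inord 1) 1 0 / a else - x (inord 1) 0 0 / a)
   else (if j == 0 then - x ord0 1 0 else x ord0 0 0)).
have g0 (z : 'cV[R]_2) : (g *m z) 0 0 = (z 0 0 * x (inord 1) 1 0 - z 1 0 * x (inord 1) 0 0) / a.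
  by rewrite mulmx2 !mxE /=; ring.
have g1 (z : 'cV[R]_2) : (g *m z) 1 0 = x ord0 0 0 * z 1 0 - x ord0 1 0 * z 0 0.
  by rewrite mulmx2 !mxE /=; ring.
have gx0 : g *m x ord0 = vec2 1 0.
  by apply: cV2P; rewrite ?g0 ?g1 !mxE /= -?aE ?divff // mulrC subrr.
have gx1 : g *m x (inord 1) = vec2 0 a.
  by apply: cV2P; rewrite ?g0 ?g1 !mxE /= -?aE // [X in X - _]mulrC subrr mul0r.
have hm (m : nat) : (m < k.+1.*2.+2)%N -> (inord m : 'I_(k.+1.*2.+2)) = m :> nat by move=> ?;
  rewrite inordK.
exists (act_coords g x); [split|].
- exists x, g; split=> //.
  + rewrite /nondegenerate_conf free_cons span_seq1 seq1_free; apply/andP; split.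
      apply/negP => /vlineP[c xc]; move: a0; rewrite aE xc !mxE => /eqP; apply; ring.
    by apply: contraNneq a0 => x0; rewrite aE x0 !mxE !mulr0 subrr.
  + split=> //; rewrite (expand_det_row _ 0) !big_ord_recl big_ord0 addr0.
    have -> : lift ord0 ord0 = 1 :> 'I_2 by exact: val_inj.
    rewrite /cofactor !det_mx11 !mxE /=; rewrite -[RHS](divff a0) [X in _ = X / _]aE; field;
      exact: a0.
- have i0 : inord 0 = ord0 :> 'I_k.+2 by apply: val_inj; rewrite /= inordK.
  split; rewrite mxE hm //=; rewrite ?i0 ?gx0 ?gx1 ?(inord_bool false) ?(inord_bool true) !mxE //.
apply/rowP => m; have m3 : (m + 3 < k.+1.*2.+2)%N by have h := ltn_ord m; move: (m : nat) h => i;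
  rewrite doubleS; clear; lia.
rewrite [LHS]mxE [RHS]mxE [LHS]mxE hm // /area_coord inord_bool -aE.
by case: ifP => _; rewrite ?g0 ?g1.
Qed.

Lemma det_continuous (T : topologicalType) (f g h l : T -> R) x : {for x, continuous f} -> {for x,
  continuous g} ->
  {for x, continuous h} -> {for x, continuous l} -> {for x, continuous (fun v =>
    f v * g v - h v * l v)}.
Proof. by move=> fc gc hc lc; apply: cvgB; apply: cvgM. Qed.

Lemma quotient_continuous (T : topologicalType) (f g : T -> R) x : g x != 0 ->
  {for x, continuous f} -> {for x, continuous g} -> {for x, continuous (fun v => f v / g v)}.
Proof. by move=> g0 fc gc; apply: cvgM => //; apply: cvgV. Qed.

Lemma coord_rV_continuous (T : topologicalType) n (i : 'I_n) : continuous (fun v : 'rV[T]_n =>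
  v 0 i).
Proof.
move=> v A vA; exists (fun j l => [set z | l = i -> A z]%classic) => [j l|w hw].
  by rewrite ord1; have [->|ne] := eqVneq l i; [apply: filterS vA =>
    z Az _|apply: filterS filterT => z _ li; case/eqP: ne].
exact: hw.
Qed.

End AreaTypes.

Unset Implicit Arguments.
Set Strict Implicit.
Set Printing Implicit Defensive.

Theorem theorem1 (R : realType) (k : nat) (k_ge1 : (1 <= k)%N)
    (E : set 'cV[R]_2) (E_compact : compact E)
    (E_dim : ((2 - 1 / (2 * k%:R))%:E < hausdorff_dim E)%E) :
  (0 < flat_measure (area_types k E))%E.
Proof.
(* From here [k] is one less than in the statement: there are [k.+2] points and the flat has
   dimension [2 k + 1]. *)
case: k k_ge1 E_dim => // k _ E_dim.
rewrite ltNge; apply/negP => meas0.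
have k0 : 0 < 2 * k.+1%:R :> R by rewrite mulr_gt0 // ltr0n.
(* The minimum with [2] provides the bound [s < 2] of [exponents_exist], whatever the extended-real
   value of the dimension. *)
have [s [sk s2 sE]] : exists s : R, [/\ 2 - 1 / (2 * k.+1%:R) < s,
  s < 2 & (s%:E < hausdorff_dim E)%E].
  have l2 : 2 - 1 / (2 * k.+1%:R) < 2 :> R by rewrite gtrBl divr_gt0.
  set m := 2 - _ in E_dim l2 *.
  case: (hausdorff_dim E) E_dim => [d| |] //.
    rewrite lte_fin => md; exists ((m + Num.min d 2) / 2).
    have : m < Num.min d 2 by rewrite lt_min md.
    have : Num.min d 2 <= 2 by rewrite ge_min lexx orbT.
    have : Num.min d 2 <= d by rewrite ge_min lexx.
    by move: (Num.min d 2) => y h1 h2 h3; split; rewrite ?lte_fin; lra.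
  by move=> _; exists ((m + 2) / 2); split; [lra|lra|exact: ltry].
have s0 : 0 <= s.
  apply: le_trans (ltW sk); rewrite subr_ge0 ler_pdivrMr // mulrA.
  by rewrite -!natrM ler1n.
have s1 : 1 < s.
  apply: le_lt_trans sk; rewrite lerBrDr -lerBrDl ler_pdivrMr //.
  have : 1 <= k.+1%:R :> R by rewrite ler1n.
  by move: (k.+1%:R : R) => x; clear; lra.
have [B B1 EB] : exists2 B : R, 1 <= B & forall v i, E v -> `|v i 0| <= B.
  have [M [_ hM]] := compact_bounded E_compact.
  exists (Num.max 1 (M + 1)); first by rewrite le_max lexx.
  move=> v i Ev; rewrite le_max; apply/orP; right.
  apply: le_trans (hM (M + 1) _ v Ev); last by rewrite ltrDl.
  by rewrite [leRHS]mx_normrE; apply: (le_bigmax _ (fun ij => `|v ij.1 ij.2|) (i, 0)).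
have [A [q [aA A12 A1 /andP[q0 q1] hq]]] := exponents_exist sk s2.
have [CF [CF0 fam]] := frostman_balls s0 sE EB (le_trans ler01 B1).
set a := 2 `^ (- s) in aA fam.
have a12 : a < 2^-1 by move: aA A1; clear; lra.
have a0 : 0 < a by exact: powR_gt0.
have [r1 [M [c [J0 [r10 M0 c0 count]]]]] := area_type_count B1 CF0 a0 a12 aA A12 A1 q0 q1 hq.
pose T : ptopologicalType := 'rV['cV[R]_2]_k.+2.
pose pt (v : T) : 'I_k.+2 -> 'cV[R]_2 := (v : 'rV['cV[R]_2]_k.+2) 0.
pose U (v : T) i : R := pt v i 0 0; pose V (v : T) i : R := pt v i 1 0.
pose det v := U v ord0 * V v (inord 1) - V v ord0 * U v (inord 1).
have Uc i : continuous (U ^~ i).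
  move=> v; apply: (@continuous_comp _ _ _ (fun v : T => pt v i) (fun z : 'cV[R]_2 => z 0 0)).
    exact: coord_rV_continuous.
  exact: coord_continuous.
have Vc i : continuous (V ^~ i).
  move=> v; apply: (@continuous_comp _ _ _ (fun v : T => pt v i) (fun z : 'cV[R]_2 => z 1 0)).
    exact: coord_rV_continuous.
  exact: coord_continuous.
have wc i j : continuous (fun v => U v i * V v j - V v i * U v j).
  by move=> v; apply: (@det_continuous R T (U ^~ i) (V ^~ j) (V ^~ i) (U ^~ j));
    first [exact: Uc|exact: Vc].
(* Bounding the first area from below makes the set of configurations compact and the coordinates of
   the flat continuous on it. *)
pose K : set T := ([set v | forall i, E (pt v i)] `&` [set v | r1 <= `|det v|])%classic.
have Kc : compact K.
  apply: compact_closedI; first exact: (@rV_compact _ _ (fun=> E)).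
  apply: (@closed_comp _ _ (fun v => `|det v|) [set y | r1 <= y]%classic); last exact: closed_ge.
  by move=> v _; apply: (@continuous_comp _ _ _ det (fun z : R => `|z|));
    [exact: wc|exact: norm_continuous].
have KA v : K v -> (last_coords @` (area_types k.+1 E `&` flat k.+1))%classic (\row_(m < k.*2.+1)
  area_coord (U v) (V v) m).
  move=> [Ev dv]; apply: (@last_coords_area_type R k E (pt v)) => //.
  by rewrite dotp_perp -normr_gt0; exact: lt_le_trans dv.
have yc v (m : 'I_k.*2.+1) : K v -> {for v, continuous (fun v => area_coord (U v) (V v) m)}.
  move=> [_ dv]; rewrite /area_coord; case: odd; first exact: wc.
  apply: (@quotient_continuous R T _ det); [|exact: wc|exact: wc].
  by rewrite -normr_gt0; exact: lt_le_trans dv.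
pose n := k.*2.+1.
have Mn : 0 < M%:R ^+ n :> R by rewrite exprn_gt0 // ltr0n.
(* With this choice [few_keys] gives at most [(c / 2) * (2 ^ J) ^ n] keys at precision
   [1 / (M * 2 ^ J)], against at least [c * (2 ^ J) ^ n] from [area_type_count]. *)
have kappa0 : 0 < c / 2 / M%:R ^+ n by rewrite !divr_gt0.
have [t0 ht] := few_keys Kc KA yc meas0 kappa0.
pose J := (J0 + Num.bound `|t0|)%N.
have t0J : t0 <= M%:R * 2 ^+ J.
  apply: le_trans (ler_norm _) _; apply: le_trans (ltW (archi_boundP (normr_ge0 t0))) _.
  rewrite -natrX -natrM ler_nat; apply: leq_trans (leq_pmull _ M0).
  by apply: leq_trans (ltnW (ltn_expl _ (ltnSn 1))) _; rewrite leq_exp2l // leq_addl.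
have p0 : 0 < M%:R * 2 ^+ J :> R by rewrite mulr_gt0 ?ltr0n ?exprn_gt0.
have [Q [sizeQ QK]] := ht _ t0J p0.
have [S [p [w [Ep w0 w1 ball]]]] := fam J.
have := count J S (fun x => p x 0 0) (fun x => p x 1 0) w Q (leq_addr _ _) w0 w1 ball
  (fun x => EB _ 0 (Ep x)) (fun x => EB _ 1 (Ep x)).
have keysQ (f : 'I_k.+2 -> S) :
    r1 <= `|p (f ord0) 0 0 * p (f (inord 1)) 1 0 - p (f ord0) 1 0 * p (f (inord 1)) 0 0| ->
    area_key M J ((fun x => p x 0 0) \o f) ((fun x => p x 1 0) \o f) \in Q.
  move=> hf; have Kf : K (\row_i p (f i)).
    by split; [move=> i; rewrite /pt mxE|rewrite /= /det /U /V /pt !mxE].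
  have := QK _ Kf; congr (_ \in Q); apply/ffunP => m; rewrite !ffunE.
  by rewrite /area_coord /U /V /pt /= !mxE.
move/(_ keysQ); rewrite leNgt => /negP; apply; apply: le_lt_trans sizeQ _.
have -> : (2 * k + 1 = n)%N by rewrite /n mul2n addn1.
have p2n : 0 < (2 ^+ J) ^+ n :> R by rewrite !exprn_gt0.
rewrite exprMn mulrA divfK ?gt_eqF // ltr_pM2r //.
by move: c0; clear; lra.
Qed.
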